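(* Let $K$ be a $TrV$ disk and let $v:\partial K\to\mathbb{R}^2$ be a vertical $SL$ embedding. If $v(\partial K)$ is convex and $K$ has no $v$-obstructive spanning 1-simplex, then $v$ extends to a vertical $SL$ embedding of $K$ in $\mathbb{R}^2$.
   Context: Coordinates in $\mathbb{R}^2$ are $(x,y)$; verticals are the lines parallel to the $y$-axis; $\pi_x$ is the projection to the $x$-axis. An $SL$ disk $K$ of $\mathbb{R}^2$ is a subset homeomorphic to the closed 2-disk together with a (finite) triangulation by affine simplices of $\mathbb{R}^2$; $\partial K$ carries the induced triangulation and is called an $SL$ circle. A map from $K$ (or $\partial K$) to $\mathbb{R}^2$ is $SL$ if it is continuous and affine on each simplex; an $SL$ embedding is an injective $SL$ map. An $SL$ map $f$ is vertical if it moves each vertex vertically, i.e. $\pi_x\circ f=\pi_x$. An $SL$ circle is convex if the disk it bounds is convex. An $SL$ disk $K$ is $TrV$ (transverse to the verticals) if every non-empty intersection of $K$ with a vertical line is connected. A 1-simplex $\sigma$ of $K$ is spanning if $\partial\sigma=\sigma\cap\partial K$. Given an $SL$ embedding $v:\partial K\to\mathbb{R}^2$ with convex image, a spanning 1-simplex $\sigma$ is $v$-obstructive if the $v$-image of one of the two arcs that $\partial\sigma$ bounds in $\partial K$ is flat (contained in a straight line). *)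

(* Defs.v *)
From HB Require Import structures.
From mathcomp Require Import all_boot all_order all_algebra finmap.
From mathcomp Require Import all_classical all_reals all_analysis.

Set Implicit Arguments.
Unset Strict Implicit.
Unset Printing Implicit Defensive.

Import Order.TTheory GRing.Theory Num.Theory.
Import numFieldNormedType.Exports.

Local Open Scope classical_set_scope.
Local Open Scope ring_scope.

(* [R^o] is [R] seen as a module over itself, which makes the plane a normed
   [R]-module; [p.1] is the x-coordinate and [p.2] the y-coordinate. *)
Notation plane R := (R^o * R^o)%type.

Section Defs.
Variable R : realType.
Implicit Types (A B C D : set (plane R)) (f v : plane R -> plane R).

Definition disk2 : set (plane R) := [set p | p.1 ^+ 2 + p.2 ^+ 2 <= 1].

Definition homeomorphic A B : Prop :=
  exists f g : plane R -> plane R,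
    [/\ {within A, continuous f}, {within B, continuous g},
        f @` A `<=` B, g @` B `<=` A
      & (forall p, A p -> g (f p) = p) /\ (forall q, B q -> f (g q) = q)].

Definition topological_disk D : Prop := homeomorphic disk2 D.

(* The boundary of a disk D in the plane is taken to be its frontier, which for
   such D is also the boundary of D as a manifold (invariance of domain). *)
Definition boundary D : set (plane R) := closure D `\` interior D.

(* A simplex is given by the finite set of its vertices. *)
Definition affinely_independent (s : {fset plane R}) : Prop :=
  forall w : plane R -> R,
    \sum_(p <- s) w p = 0 -> \sum_(p <- s) w p *: p = 0 ->
    forall p, p \in s -> w p = 0.

Definition hull (s : {fset plane R}) : set (plane R) :=
  [set q | exists w : plane R -> R,
     [/\ forall p, p \in s -> 0 <= w p,
         \sum_(p <- s) w p = 1 & q = \sum_(p <- s) w p *: p]].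

(* In the last condition u may be empty, and then so is its hull. *)
Definition simplicial_complex (K : {fset {fset plane R}}) : Prop :=
  [/\ forall s, s \in K -> s != fset0 /\ affinely_independent s,
      forall s t, s \in K -> t != fset0 -> fsubset t s -> t \in K
    & forall s t, s \in K -> t \in K ->
        exists u : {fset plane R},
          [/\ fsubset u s, fsubset u t & hull s `&` hull t = hull u]].

Definition realization (K : {fset {fset plane R}}) : set (plane R) :=
  [set p | exists2 s, s \in K & hull s p].

(* An SL disk is represented by its triangulation K; the disk itself is the
   subset [realization K] of the plane. *)
Definition SL_disk (K : {fset {fset plane R}}) : Prop :=
  simplicial_complex K /\ topological_disk (realization K).

Definition bd (K : {fset {fset plane R}}) : set (plane R) :=
  boundary (realization K).

Definition affine_on A f : Prop :=
  forall (p q : plane R) (t : R), A p -> A q -> 0 <= t <= 1 ->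
    f ((1 - t) *: p + t *: q) = (1 - t) *: f p + t *: f q.

(* A is meant to be [realization K] or [bd K], with the triangulation induced
   by K, i.e. formed by the simplices of K that lie in A. *)
Definition SL_map (K : {fset {fset plane R}}) A f : Prop :=
  {within A, continuous f} /\
  forall s, s \in K -> hull s `<=` A -> affine_on (hull s) f.

Definition SL_embedding (K : {fset {fset plane R}}) A f : Prop :=
  SL_map K A f /\ set_inj A f.

Definition vertical A f : Prop := forall p, A p -> (f p).1 = p.1.

Definition convex_circle C : Prop :=
  exists D, [/\ topological_disk D, boundary D = C & convex_set D].

Definition TrV D : Prop :=
  forall c : R, let I := D `&` [set p | p.1 = c] in I !=set0 -> connected I.

Definition spanning (K : {fset {fset plane R}}) (s : {fset plane R}) : Prop :=
  [/\ s \in K, #|` s| = 2%N & [set` s] = hull s `&` bd K].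

Definition arc_between A (a b : plane R) : Prop :=
  exists g : R -> plane R,
    [/\ {within `[0, 1], continuous g}, set_inj `[0, 1] g,
        g 0 = a, g 1 = b & A = g @` `[0, 1]].

Definition flat A : Prop :=
  exists p d : plane R, d != 0 /\ forall q, A q -> exists t : R, q = p + t *: d.

Definition obstructive (K : {fset {fset plane R}}) v (s : {fset plane R}) :
    Prop :=
  exists (a b : plane R) A,
    [/\ s = [fset a; b]%fset, A `<=` bd K, arc_between A a b & flat (v @` A)].

End Defs.

(* Main.v *)
(** In the image each triangle [T] must keep its vertical orientation, that is,
    the height function [h] must have a positive vertical slope [beta_T] on [T];
    conversely this suffices, since the vertical slices of a [TrV] disk are
    intervals.

    A vertical ray from an interior vertex [q] enters one triangle above [q] and
    one below [q], in which [q] is the middle vertex. Choose [h], with the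
    prescribed boundary values, so that these two triangles have the same slope
    [beta_q]; this is a linear system which obeys a maximum principle, hence it
    is solvable. Comparing the edge slopes around [q] shows that [beta_q] is a
    weighted average of the slopes of the other triangles at [q]: the slopes
    themselves obey a maximum principle, so it is enough to know that they are
    positive in the triangles whose middle vertex lies on the boundary. There
    convexity provides a line above the boundary values which touches them at
    that vertex; by the maximum principle [h] stays below it, and contact
    along a whole triangle would propagate to an obstructive spanning edge. *)
Require Import Defs.
From HB Require Import structures.
From mathcomp Require Import all_boot all_order all_algebra finmap.
From mathcomp Require Import ring lra.
From mathcomp Require Import all_classical all_reals all_analysis.

Set Implicit Arguments.
Unset Strict Implicit.
Unset Printing Implicit Defensive.

Import Order.TTheory GRing.Theory Num.Theory.
Import numFieldNormedType.Exports.

Local Open Scope classical_set_scope.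
Local Open Scope ring_scope.

(** * Monotone harmonic extensions *)

(** Why averages appear: over the star of an interior vertex [q] the differences of consecutive edge
    slopes add up to 0, for [h] as well as for [y]. In a triangle [T] the difference for [h] is
    [beta_T] times the one for [y], which is positive unless [q] is the middle vertex of [T]. The
    terms with [q] in the middle share the factor [beta_q]; moved to the other side, they exhibit
    [beta_q] as an average of the other [beta_T]. The obstacle is vertical edges: on them slopes are
    undefined, a vertical ray need not enter a unique triangle, and a triangle gets two middle
    vertices. Hence the conventional slope 0, the cross-multiplied equations, the lexicographic
    order, and the extra alternatives in the boundary conditions. Moreover [v] may reverse the
    vertical order; its heights are therefore multiplied by a sign before the extension, and again
    after it. *)

Section Core.
Variables (R : realFieldType) (I : finType).
Implicit Types (x y f g h : I -> R) (tri : I -> I -> I -> bool) (inn : pred I).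
Implicit Types (a b c d p q r : I).

(* On a triangle [a b c], [det3 x f a b c / det3 x y a b c] is the vertical slope
   of the affine function with the values [f] at the vertices. *)
Definition det3 x f a b c : R :=
  (x b - x a) * (f c - f a) - (f b - f a) * (x c - x a).

Lemma det3_rot x f a b c : det3 x f b c a = det3 x f a b c.
Proof. rewrite /det3; ring. Qed.

(* [tri] is the set of the counterclockwise triangles and [inn] that of the
   interior vertices; [tri_up] and [tri_down] provide the triangles entered by
   the vertical rays from a vertex, which are unique unless the ray runs along
   an edge. *)
Record triangulated x y tri inn : Prop := Triangulated {
  tri_rot : forall a b c, tri a b c -> tri b c a;
  tri_pos : forall a b c, tri a b c -> 0 < det3 x y a b c;
  tri_uniq : forall a b c d, tri a b c -> tri a b d -> c = d;
  tri_next : forall q a b, inn q -> tri q a b -> exists c, tri q b c;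
  tri_prev : forall q a b, inn q -> tri q a b -> exists c, tri q c a;
  tri_up : forall q, inn q -> exists a b, tri q a b && (x b <= x q <= x a);
  tri_down : forall q, inn q -> exists a b, tri q a b && (x a <= x q <= x b);
  tri_up_uniq : forall q a b a' b', tri q a b -> tri q a' b' ->
    x b <= x q <= x a -> x b' <= x q <= x a' ->
    [\/ a = a' /\ b = b', a = b' /\ x a = x q | b = a' /\ x b = x q];
  tri_down_uniq : forall q a b a' b', tri q a b -> tri q a' b' ->
    x a <= x q <= x b -> x a' <= x q <= x b' ->
    [\/ a = a' /\ b = b', a = b' /\ x a = x q | b = a' /\ x b = x q] }.

Definition slope x g p q : R := (g q - g p) / (x q - x p).

Lemma slopeC x g p q : slope x g p q = slope x g q p.
Proof. by rewrite /slope -(opprB (g p)) -(opprB (x p)) invrN mulrNN. Qed.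

Lemma slope_vertical x g p q : x p = x q -> slope x g p q = 0.
Proof. by rewrite /slope => ->; rewrite subrr invr0 mulr0. Qed.

(** Compared with the same identity for [y], this shows that the slope differences of [g] and [y] at
    a corner have the vertical slope of [g] as their ratio; at a non-central corner the denominator
    is positive. *)
Lemma slope_diff x g q a b : x a != x q -> x b != x q ->
  slope x g q b - slope x g q a =
  det3 x g q a b / ((x a - x q) * (x b - x q)).
Proof.
rewrite -(subr_eq0 (x a)) -(subr_eq0 (x b)) /slope /det3.
move: (x a - x q) (x b - x q) (g b - g q) (g a - g q) => u w s t hu hw.
by field; rewrite hu hw.
Qed.

Lemma sum_functional (P : I -> I -> bool) (F : I -> R) :
  (forall a a' b, P a b -> P a' b -> a = a') ->
  \sum_(ab : I * I | P ab.1 ab.2) F ab.2 = \sum_(b | [exists a, P a b]) F b.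
Proof.
move=> Puniq; rewrite -(pair_big_dep xpredT P (fun _ b => F b)) /=.
rewrite (exchange_big_dep (fun b => [exists a, P a b])) /=; last first.
  by move=> a b _ hab; apply/existsP; exists a.
apply: eq_bigr => b /existsP[a hab].
rewrite (big_pred1 a) // => a' /=; apply/idP/eqP => [h|->//].
exact: Puniq h hab.
Qed.

Section Triangulated.
Variables (x y : I -> R) (tri : I -> I -> I -> bool) (inn : pred I).
Hypothesis K : triangulated x y tri inn.

Lemma tri_not_vertical q a b : tri q a b -> x a = x q -> x b != x q.
Proof.
move=> /(tri_pos K) D xa; apply/eqP => xb; move: D.
by rewrite /det3 xa xb subrr mul0r mulr0 subrr ltxx.
Qed.

(** Around an interior vertex each neighbour is the first vertex of one triangle and the second
    vertex of another one, so the sum telescopes. *)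
Lemma star_sum q (F : I -> R) : inn q ->
  \sum_(ab : I * I | tri q ab.1 ab.2) (F ab.2 - F ab.1) = 0.
Proof.
move=> iq; rewrite sumrB.
rewrite (@sum_functional (tri q) F); last first.
  move=> a a' b h h'; apply: (tri_uniq K (a := b) (b := q));
  exact/(tri_rot K)/(tri_rot K).
have -> : \sum_(ab : I * I | tri q ab.1 ab.2) F ab.1 =
    \sum_(ab : I * I | tri q ab.2 ab.1) F ab.2.
  rewrite (reindex (fun ab : I * I => (ab.2, ab.1))) //=.
  by exists (fun ab : I * I => (ab.2, ab.1)) => -[].
rewrite (@sum_functional (fun a b => tri q b a) F); last first.
  by move=> a a' b h h'; apply: (tri_uniq K h h').
rewrite (eq_bigl (fun b => [exists a, tri q b a])) ?subrr // => b.
apply/existsP/existsP => -[a h]; first exact: (tri_next K iq h).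
exact: (tri_prev K iq h).
Qed.

(** [q] is the middle one of the three vertices in the order of abscissae. The comparison is weak:
    both ends of a vertical edge are central. *)
Definition central q a b := (x a - x q) * (x b - x q) <= 0.

Lemma centralE q a b :
  central q a b = (x b <= x q <= x a) || (x a <= x q <= x b).
Proof.
rewrite /central -(subr_le0 (x q) (x b)) -(subr_ge0 (x q) (x a)).
rewrite -(subr_le0 (x q) (x a)) -(subr_ge0 (x q) (x b)).
move: (x a - x q) (x b - x q) => u v.
case: (ltgtP u 0) => [u0|u0|->]; last by rewrite mul0r lexx !andbT le_total.
- by rewrite nmulr_rle0 // andbF.
- by rewrite pmulr_rle0 // andbT orbF.
Qed.

Let rot (t : I * I * I) : I * I * I := (t.1.2, t.2, t.1.1).
Let rot' (t : I * I * I) : I * I * I := (t.2, t.1.1, t.1.2).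
Let rot_bij : bijective rot.
Proof. by exists rot'; move=> [[]]. Qed.
Let rot'_bij : bijective rot'.
Proof. by exists rot; move=> [[]]. Qed.

Lemma triple_sum (F : {pred I}) (G : I -> I -> I -> R) :
  \sum_(q | q \in F) \sum_(ab : I * I | tri q ab.1 ab.2) G q ab.1 ab.2 =
  \sum_(t : I * I * I | (t.1.1 \in F) && tri t.1.1 t.1.2 t.2) G t.1.1 t.1.2 t.2.
Proof.
rewrite pair_big_dep /=.
rewrite (reindex (fun t : I * I * I => (t.1.1, (t.1.2, t.2)))) //=.
exists (fun t : I * (I * I) => (t.1, t.2.1, t.2.2)); first by move=> [[]].
by move=> [a []].
Qed.

(* The sum over the star of [q] of the slope differences of [g] vanishes; the
   terms at a vertical edge with both ends in [F] cancel each other, and all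
   the other terms are nonnegative. *)
Lemma flat_star (F : {pred I}) g :
  (forall q, q \in F -> inn q) ->
  (forall a b c, tri a b c -> 0 <= det3 x g a b c) ->
  (forall q a b, q \in F -> tri q a b -> central q a b -> det3 x g q a b = 0) ->
  (forall q a b, q \in F -> tri q a b -> x a = x q -> a \notin F ->
     0 <= slope x g q b) ->
  (forall q a b, q \in F -> tri q a b -> x b = x q -> b \notin F ->
     slope x g q a <= 0) ->
  forall q a b, q \in F -> tri q a b ->
  [/\ det3 x g q a b = 0,
      x a = x q -> a \notin F -> slope x g q b = 0 &
      x b = x q -> b \notin F -> slope x g q a = 0].
Proof.
move=> Fi g0 Fc Fa Fb.
pose P (t : I * I * I) := (t.1.1 \in F) && tri t.1.1 t.1.2 t.2.
pose A (t : I * I * I) := (x t.1.2 == x t.1.1) && (t.1.2 \in F).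
pose B (t : I * I * I) := (x t.2 == x t.1.1) && (t.2 \in F).
pose c (t : I * I * I) := slope x g t.1.1 t.2 - slope x g t.1.1 t.1.2.
(* At a vertical edge with both ends in [F], [k] removes the slope towards the third vertex that is
   left over in [c]. *)
pose k (t : I * I * I) := (if B t then slope x g t.1.1 t.1.2 else 0)
   - (if A t then slope x g t.1.1 t.2 else 0).
have sc : \sum_(t | P t) c t = 0.
  rewrite -(triple_sum F (fun q a b => slope x g q b - slope x g q a)).
  by apply: big1 => q /Fi iq; apply: (star_sum (slope x g q) iq).
have sk : \sum_(t | P t) k t = 0.
  rewrite sumrB; apply/eqP; rewrite subr_eq0; apply/eqP.
  rewrite -!big_mkcondr /= [RHS](reindex rot') /=; last exact: onW_bij.
  apply: eq_big => [[[q a] b]|[[q a] b]]; rewrite /P /A /B /=.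
    apply/andP/andP => -[/andP[h1 h2] /andP[/eqP h3 h4]].
      by rewrite h4 h3 h1 eqxx (tri_rot K (tri_rot K h2)).
    by rewrite h4 h3 h1 eqxx (tri_rot K h2).
  move=> /andP[/andP[h1 h2] /andP[/eqP h3 h4]].
  (* The triangle is central at [q], hence flat, so [g] agrees at both ends of the vertical edge and
     the slopes from them to the third vertex are equal. *)
  have := Fc q a b h1 h2; rewrite /central h3 subrr mulr0 => /(_ (lexx _)).
  have := tri_pos K h2.
  rewrite /det3 /slope h3 subrr !mulr0 !subr0 => h5 /eqP.
  rewrite mulf_eq0 => /orP[/eqP h6|]; first by move: h5; rewrite h6 mul0r ltxx.
  by rewrite subr_eq0 => /eqP ->.
have ck0 t : P t -> 0 <= c t + k t.
  case: t => [[q a] b]; rewrite /P /c /k /A /B /= => /andP[qF h].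
  have D := tri_pos K h; have Dg := g0 _ _ _ h; have C := Fc q a b qF h.
  have [xa|xa] := eqVneq (x a) (x q); have [xb|xb] := eqVneq (x b) (x q) => /=.
  - by case/eqP: (tri_not_vertical h xa).
  - rewrite [slope x g q a]slope_vertical //; case: ifP => aF; first lra.
    by have := Fa q a b qF h xa (negbT aF); lra.
  - rewrite [slope x g q b]slope_vertical //; case: ifP => bF; first lra.
    by have := Fb q a b qF h xb (negbT bF); lra.
  rewrite subr0 addr0 slope_diff //; case: (boolP (central q a b)) => [/C->|].
    by rewrite mul0r.
  by rewrite /central -ltNge => cp; rewrite divr_ge0 // ltW.
have := psumr_eq0P ck0; rewrite big_split /= sc sk addr0 => /(_ erefl) z.
move=> q a b qF h; have D := tri_pos K h.
have := z (q, a, b); rewrite /P /= qF h => /(_ isT).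
rewrite /c /k /A /B /= => E.
split.
- case: (boolP (central q a b)) => [/(Fc q a b qF h)//|nc].
  have [xa|xa] := eqVneq (x a) (x q).
    by move: nc; rewrite /central xa subrr mul0r lexx.
  have [xb|xb] := eqVneq (x b) (x q).
    by move: nc; rewrite /central xb subrr mulr0 lexx.
  move: E; rewrite (negbTE xa) (negbTE xb) /= subr0 addr0 slope_diff //.
  move/eqP; rewrite mulf_eq0 invr_eq0 mulf_eq0 => /orP[/eqP//|].
  by rewrite !subr_eq0 (negbTE xa) (negbTE xb).
- move=> xa aF.
  have xb := tri_not_vertical h xa.
  move: E; rewrite xa eqxx (negbTE aF) (negbTE xb) /=.
  by rewrite [slope x g q a]slope_vertical // !subr0 addr0.
- move=> xb bF.
  have [xa|xa] := eqVneq (x a) (x q).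
    by case/eqP: (tri_not_vertical h xa).
  move: E; rewrite xb eqxx (negbTE bF) (negbTE xa) /=.
  rewrite [slope x g q b]slope_vertical // sub0r subr0 addr0 => /eqP.
  by rewrite oppr_eq0 => /eqP.
Qed.


Lemma lex_max (S : {pred I}) p : p \in S -> exists2 q, q \in S &
  forall r, r \in S -> x r <= x q /\ (x r = x q -> y r <= y q).
Proof.
move=> pS; case: (Order.TotalTheory.arg_maxP x pS) => q1 q1S q1max.
have q1S' : [pred i | (i \in S) && (x i == x q1)] q1 by rewrite /= [q1 \in S]q1S eqxx.
case: (Order.TotalTheory.arg_maxP y q1S') => q /andP[qS /eqP xq] qmax.
exists q => // r rS; split; first by rewrite xq; apply: q1max.
by rewrite xq => xr; apply: qmax; rewrite /= rS xr eqxx.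
Qed.

(** Orientation excludes that [a] lies vertically below [q], so [a] follows [q] strictly in the
    lexicographic order. Together with [lex_max] this ends a propagation: the last vertex of a set
    has a later neighbour. *)
Lemma up_lex q a b : tri q a b -> x b <= x q <= x a ->
  x q < x a \/ x a = x q /\ y q < y a.
Proof.
move=> /(tri_pos K); rewrite /det3 => D /andP[xb xa].
have [|xaq] := ltrP (x q) (x a); first by left.
have e : x a = x q by lra.
right; split=> //; move: D; rewrite e subrr mul0r sub0r oppr_gt0.
have [//|ya] := ltrP (y q) (y a).
by rewrite ltNge mulr_le0 // subr_le0.
Qed.

Lemma tri_slope_gt0 q a b : tri q a b -> ~~ central q a b ->
  0 < slope x y q b - slope x y q a.
Proof.
move=> h; rewrite /central -ltNge => c.
rewrite slope_diff ?divr_gt0 ?(tri_pos K) //.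
  by apply: contraTneq c => ->; rewrite subrr mul0r ltxx.
by apply: contraTneq c => ->; rewrite subrr mulr0 ltxx.
Qed.

(* Otherwise the flat triangles would fill the stars of their middle vertices.
   In each triangle the y-slope differences at the three vertices add up to 0,
   and so they do in the star of an interior vertex; hence the remaining
   corners of flat triangles, all of them non-central, contribute 0 although
   each of them is positive, and there are none. *)
Lemma flat_exit g a0 b0 c0 :
  (forall a b c, tri a b c -> 0 <= det3 x g a b c) ->
  (forall q a b a' b', inn q -> tri q a b -> tri q a' b' ->
     central q a b -> central q a' b' ->
     det3 x g q a b = 0 -> det3 x g q a' b' = 0) ->
  tri a0 b0 c0 -> det3 x g a0 b0 c0 = 0 ->
  exists q a b,
    [/\ ~~ inn q, tri q a b, central q a b & det3 x g q a b = 0].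
Proof.
move=> g0 gc h0 d0.
pose C (t : I * I * I) := [&& tri t.1.1 t.1.2 t.2, central t.1.1 t.1.2 t.2
  & det3 x g t.1.1 t.1.2 t.2 == 0].
have [|nex] := boolP [exists t : I * I * I, ~~ inn t.1.1 && C t].
  move=> /existsP[[[q a] b]] /andP[/= iq /and3P[h c /eqP d]].
  by exists q, a, b.
exfalso.
pose F := [pred q | [exists ab : I * I, C (q, ab.1, ab.2)]].
have FI q a b : tri q a b -> central q a b -> det3 x g q a b = 0 -> q \in F.
  by move=> h c d; apply/existsP; exists (a, b); rewrite /C /= h c d /=.
have Fi q : q \in F -> inn q.
  move=> /existsP[[a b] Ct]; apply: contraNT nex => iq.
  by apply/existsP; exists (q, a, b); rewrite /= iq.
have Fc q a b : q \in F -> tri q a b -> central q a b -> det3 x g q a b = 0.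
  move=> qF h c; have iq := Fi q qF; case/existsP: qF => -[a' b'] /and3P[/=].
  by move=> h' c' /eqP d'; apply: gc d'.
have Fv q a b : q \in F -> tri q a b -> x a = x q -> a \in F.
  move=> qF h xa; apply: (FI a b q); first exact: (tri_rot K h).
    by rewrite /central xa subrr mulr0.
  by rewrite det3_rot (Fc q a b) // /central xa subrr mul0r.
have Fv' q a b : q \in F -> tri q a b -> x b = x q -> b \in F.
  move=> qF h xb; apply: (FI b q a); first exact/(tri_rot K)/(tri_rot K).
    by rewrite /central xb subrr mul0r.
  by rewrite 2!det3_rot (Fc q a b) // /central xb subrr mulr0.
have Fs q a b : q \in F -> tri q a b -> det3 x g q a b = 0.
  move=> qF h; have [] := flat_star Fi g0 Fc _ _ qF h => //.
  - by move=> p c d pF hp xc /negP[]; apply: Fv hp xc.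
  - by move=> p c d pF hp xd /negP[]; apply: Fv' hp xd.
pose M (t : I * I * I) := tri t.1.1 t.1.2 t.2 && (det3 x g t.1.1 t.1.2 t.2 == 0).
pose d (t : I * I * I) := slope x y t.1.1 t.2 - slope x y t.1.1 t.1.2.
have sM : \sum_(t | M t) d t = 0.
  rewrite sumrB; apply/eqP; rewrite subr_eq0; apply/eqP.
  rewrite [RHS](reindex rot') /=; last exact: onW_bij.
  apply: eq_big => [[[q a] b]|[[q a] b] _]; rewrite /M /=; last exact: slopeC.
  rewrite -(det3_rot x g q a b) -(det3_rot x g a b q).
  by congr (_ && _); apply/idP/idP => h; do ?exact: (tri_rot K h);
    exact: (tri_rot K (tri_rot K h)).
have sF : \sum_(t | M t && (t.1.1 \in F)) d t = 0.
  transitivity (\sum_(q | q \in F) \sum_(ab : I * I | tri q ab.1 ab.2)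
    (slope x y q ab.2 - slope x y q ab.1)).
    rewrite (triple_sum F (fun q a b => slope x y q b - slope x y q a)).
    apply: eq_bigl => -[[q a] b]; rewrite /M /= andbC.
    case: (boolP (q \in F)) => //= qF; case: (boolP (tri q a b)) => //= h.
    by rewrite Fs ?eqxx.
  by apply: big1 => q /Fi iq; apply: (star_sum (slope x y q) iq).
have d0' t : M t && (t.1.1 \notin F) -> 0 < d t.
  case: t => [[q a] b] /andP[/andP[/= h /eqP dg] qF].
  apply: tri_slope_gt0 => //; apply/negP => c; move/negP: qF; apply.
  exact: (FI q a b h c dg).
move: sM; rewrite (bigID (fun t => t.1.1 \in F)) /= sF add0r => s0.
have MF q a b : tri q a b -> det3 x g q a b = 0 -> q \in F.
  move=> h dg; case: (boolP (q \in F)) => // qF; exfalso.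
  have Mt : M (q, a, b) && ((q, a, b).1.1 \notin F).
    by rewrite /M /= h dg eqxx qF.
  have := d0' _ Mt.
  by rewrite (psumr_eq0P (fun t Ht => ltW (d0' t Ht)) s0 Mt) ltxx.
(* Every vertex of a flat triangle is now in [F], and every triangle at a vertex of [F] is flat; the
   triangle above the last vertex of [F] thus yields a later one. *)
have [q qF qmax] := lex_max (MF _ _ _ h0 d0).
have [a [b /andP[h ub]]] := tri_up K (Fi _ qF).
have aF : a \in F.
  by apply: (MF a b q); [exact: (tri_rot K h)|rewrite det3_rot Fs].
have [xa ya] := qmax _ aF.
case: (up_lex h ub) => [|[/ya]]; lra.
Qed.


(** Equality of two quotients [det3 x h / det3 x y], cleared of its positive denominators. The
    instances with both triangles on the same side of [q] hold for every [h]; including them keeps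
    the notion invariant under half-turns. *)
Definition harmonic h := forall q a b a' b', inn q ->
  tri q a b -> tri q a' b' -> central q a b -> central q a' b' ->
  det3 x h q a b * det3 x y q a' b' = det3 x h q a' b' * det3 x y q a b.

Lemma det3_affine h m al be a b c :
  det3 x (fun p => h p - m * y p - (al * x p + be)) a b c =
  det3 x h a b c - m * det3 x y a b c.
Proof. rewrite /det3; ring. Qed.

Lemma harmonic_affine h m al be :
  harmonic h -> harmonic (fun p => h p - m * y p - (al * x p + be)).
Proof.
move=> H q a b a2 b2 iq h1 h2 c1 c2; rewrite !det3_affine.
have := H q a b a2 b2 iq h1 h2 c1 c2; lra.
Qed.

(** Let [q] be the lexicographically last maximum. The slope is at most 0 in the triangle above [q]
    and at least 0 in the one below, so harmonicity makes both vanish. But [a] has a smaller value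
    than [q], and so has [b] if it lies vertically above [q]; this makes the upper slope
    negative. *)
Lemma max_principle g : harmonic g -> (forall p, ~~ inn p -> g p <= 0) ->
  forall p, g p <= 0.
Proof.
move=> H gb p0; have [//|gp0] := lerP (g p0) 0; exfalso.
case: (Order.TotalTheory.arg_maxP g (isT : xpredT p0)) => p1 _ p1max.
have [q] := @lex_max [pred p | g p == g p1] p1 (eqxx _).
rewrite inE => /eqP gq qmax.
have gmax p : g p <= g q by rewrite gq; apply: p1max.
have iq : inn q.
  by apply: contraTT gp0 => /gb gq0; rewrite -leNgt (le_trans (gmax _)).
have out p : x q < x p \/ x p = x q /\ y q < y p -> g p < g q.
  move=> hp; rewrite lt_neqAle gmax andbT; apply/eqP => gp.
  by case: (qmax p); rewrite ?inE ?gp ?gq //; case: hp => [|[]]; lra.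
have [a [b /andP[h ub]]] := tri_up K iq.
have [a' [b' /andP[h' ub']]] := tri_down K iq.
have ga : g a < g q by apply/out/(up_lex h ub).
have D := tri_pos K h; have D' := tri_pos K h'.
have E : det3 x g q a b * det3 x y q a' b' = det3 x g q a' b' * det3 x y q a b.
  by apply: H; rewrite // centralE ?ub ?ub' ?orbT.
have [/andP[xb xa] /andP[xa' xb']] := (ub, ub').
have d1 : det3 x g q a b <= 0.
  have := gmax b; rewrite /det3 => gb'.
  by rewrite subr_le0 (@le_trans _ _ 0) // ?mulr_ge0_le0 ?mulr_le0 // ?subr_ge0 ?subr_le0 // ltW.
have d2 : 0 <= det3 x g q a' b'.
  have [ga' gb'] := (gmax a', gmax b'); rewrite /det3.
  by rewrite subr_ge0 (@le_trans _ _ 0) // ?mulr_le0_ge0 ?mulr_le0 // ?subr_ge0 ?subr_le0.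
have d10 : det3 x g q a b = 0.
  apply/eqP; rewrite eq_le d1 /= -(pmulr_lge0 _ D') E.
  by rewrite mulr_ge0 // ltW.
have xbq : x b = x q.
  apply/eqP; rewrite eq_le xb /= -subr_ge0 -(nmulr_rle0 _ (_ : g a - g q < 0)) ?subr_lt0 //.
  move/eqP: d10; rewrite /det3 subr_eq0 => /eqP <-.
  by rewrite mulr_ge0_le0 ?subr_ge0 ?subr_le0.
have xaq : x q < x a.
  rewrite lt_neqAle xa andbT eq_sym; apply/eqP => e.
  by case/eqP: (tri_not_vertical h e).
have gbq : g b < g q.
  apply: out; right; split=> //; rewrite -subr_gt0 -(pmulr_rgt0 _ (_ : 0 < x a - x q)) ?subr_gt0 //.
  by move: D; rewrite /det3 xbq subrr mulr0 subr0.
move/eqP: d10; rewrite /det3 xbq subrr mulr0 subr0 mulf_eq0 !subr_eq0.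
by rewrite (gt_eqF xaq) (lt_eqF gbq).
Qed.

(** Two triangles that contain the start of the same upward ray coincide or share a vertical edge,
    and along that edge both have the same vertical slope. *)
Lemma up_cross h q a b a' b' : tri q a b -> tri q a' b' ->
  x b <= x q <= x a -> x b' <= x q <= x a' ->
  det3 x h q a b * det3 x y q a' b' = det3 x h q a' b' * det3 x y q a b.
Proof.
move=> h1 h2 u1 u2; case: (tri_up_uniq K h1 h2 u1 u2).
- by move=> [-> ->]; rewrite mulrC.
- by move=> [<- e]; rewrite /det3 e; ring.
- by move=> [<- e]; rewrite /det3 e; ring.
Qed.

Lemma down_cross h q a b a' b' : tri q a b -> tri q a' b' ->
  x a <= x q <= x b -> x a' <= x q <= x b' ->
  det3 x h q a b * det3 x y q a' b' = det3 x h q a' b' * det3 x y q a b.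
Proof.
move=> h1 h2 u1 u2; case: (tri_down_uniq K h1 h2 u1 u2).
- by move=> [-> ->]; rewrite mulrC.
- by move=> [<- e]; rewrite /det3 e; ring.
- by move=> [<- e]; rewrite /det3 e; ring.
Qed.

Lemma cross_trans (u1 u2 u3 v1 v2 v3 : R) : v2 != 0 ->
  u1 * v2 = u2 * v1 -> u2 * v3 = u3 * v2 -> u1 * v3 = u3 * v1.
Proof.
move=> v0 e1 e2; apply: (mulIf v0).
by rewrite mulrAC e1 mulrAC e2 mulrAC.
Qed.

(** One equation at each interior vertex implies the others, since triangles on the same side of [q]
    agree for every [h]. The linear system can therefore be taken square. *)
Lemma harmonicI h :
  (forall q, inn q -> exists a b a' b',
    [/\ tri q a b, tri q a' b', x b <= x q <= x a, x a' <= x q <= x b' &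
     det3 x h q a b * det3 x y q a' b' = det3 x h q a' b' * det3 x y q a b]) ->
  harmonic h.
Proof.
move=> H q a b a' b' iq; have [c [d [c' [d' [t t' u u' E]]]]] := H q iq.
have n : det3 x y q c d != 0 by rewrite gt_eqF ?(tri_pos K t).
have n' : det3 x y q c' d' != 0 by rewrite gt_eqF ?(tri_pos K t').
have st a1 b1 : tri q a1 b1 -> central q a1 b1 ->
    det3 x h q a1 b1 * det3 x y q c d = det3 x h q c d * det3 x y q a1 b1.
  move=> h1; rewrite centralE => /orP[]u1; first exact: up_cross.
  exact: (cross_trans n' (down_cross h h1 t' u1 u') (esym E)).
move=> h1 h2 /(st _ _ h1) e1 /(st _ _ h2) e2.
exact: (cross_trans n e1 (esym e2)).
Qed.

Lemma harmonic_extension eta :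
  exists2 h, harmonic h & forall p, ~~ inn p -> h p = eta p.
Proof.
pose P q (t : I * I * (I * I)) := inn q ->
  [/\ tri q t.1.1 t.1.2, tri q t.2.1 t.2.2,
     x t.1.2 <= x q <= x t.1.1 & x t.2.1 <= x q <= x t.2.2].
have [ud udP] : exists ud, forall q, P q (ud q).
  apply: (@fin_all_exists _ (fun=> (I * I * (I * I))%type) P) => q.
  case: (boolP (inn q)) => iq; last by exists (q, q, (q, q)) => /(negP iq).
  have [a [b /andP[h u]]] := tri_up K iq.
  have [a' [b' /andP[h' u']]] := tri_down K iq.
  by exists (a, b, (a', b')).
(* One left-hand side per vertex; an outer vertex contributes its own value, so the kernel consists
   of the harmonic functions that vanish on the boundary. *)
pose e h q := if inn q then
    det3 x h q (ud q).1.1 (ud q).1.2 * det3 x y q (ud q).2.1 (ud q).2.2 -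
    det3 x h q (ud q).2.1 (ud q).2.2 * det3 x y q (ud q).1.1 (ud q).1.2
  else h q.
have eH h : (forall q, inn q -> e h q = 0) -> harmonic h.
  move=> H; apply: harmonicI => q iq; have [t t' u u'] := udP q iq.
  exists (ud q).1.1, (ud q).1.2, (ud q).2.1, (ud q).2.2; split => //.
  by move/eqP: (H q iq); rewrite /e iq subr_eq0 => /eqP.
pose fn (u : 'rV[R]_#|I|) : I -> R := fun p => u 0 (enum_rank p).
pose f (u : 'rV[R]_#|I|) : 'rV_#|I| := \row_j e (fn u) (enum_val j).
have fl : linear f.
  move=> k u v; apply/rowP => j; rewrite !mxE /e; case: ifP => _.
    by rewrite /det3 /fn !mxE; ring.
  by rewrite /fn !mxE.
pose fL : {linear 'rV[R]_#|I| -> 'rV[R]_#|I|} :=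
  HB.pack f (GRing.isLinear.Build R _ _ _ f fl).
have inj (u : 'rV[R]_#|I|) : u *m lin1_mx fL = 0 -> u = 0.
  rewrite mul_rV_lin1 /= => /rowP fu0.
  have e0 q : e (fn u) q = 0.
    by have := fu0 (enum_rank q); rewrite !mxE enum_rankK.
  have Hu : harmonic (fn u) by apply: eH.
  have Hv : harmonic (fn (- u)).
    apply: eH => q iq; move: (e0 q); rewrite /e iq /det3 /fn !mxE; lra.
  have bd p : ~~ inn p -> fn u p = 0.
    by move=> ip; have := e0 p; rewrite /e (negbTE ip).
  have fu_le p : fn u p <= 0 by apply: (max_principle Hu) => r /bd ->.
  have fu_ge p : fn (- u) p <= 0.
    apply: (max_principle Hv) => r /bd; rewrite /fn !mxE => ->.
    by rewrite oppr0.
  apply/rowP => j; move: (fu_le (enum_val j)) (fu_ge (enum_val j)).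
  by rewrite /fn !mxE enum_valK; lra.
have unitL : lin1_mx fL \in unitmx by rewrite -row_free_unit; apply: inj_row_free.
pose et : 'rV[R]_#|I| := \row_j (if inn (enum_val j) then 0 else eta (enum_val j)).
pose u := et *m invmx (lin1_mx fL).
have fu : f u = et by rewrite -[f u](mul_rV_lin1 fL) mulmxKV.
have eu q : e (fn u) q = if inn q then 0 else eta q.
  by have /rowP/(_ (enum_rank q)) := fu; rewrite !mxE enum_rankK.
exists (fn u); first by apply: eH => q iq; rewrite eu iq.
by move=> p ip; have := eu p; rewrite /e (negbTE ip).
Qed.


End Triangulated.

(** A half-turn preserves orientation and exchanges above and below, so what is proved for the upper
    boundary serves for the lower one. *)
Lemma triangulated_opp x y tri inn : triangulated x y tri inn ->
  triangulated (fun p => - x p) (fun p => - y p) tri inn.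
Proof.
move=> K; have neg3 (u v w : R) : (- u <= - v <= - w) = (w <= v <= u).
  by rewrite !lerN2 andbC.
split.
- exact: tri_rot K.
- by move=> a b c /(tri_pos K); rewrite /det3; lra.
- exact: tri_uniq K.
- exact: tri_next K.
- exact: tri_prev K.
- move=> q /(tri_down K)[a [b h]]; exists a, b; by rewrite neg3.
- move=> q /(tri_up K)[a [b h]]; exists a, b; by rewrite neg3.
- move=> q a b a' b' h h'; rewrite !neg3 => u u'.
  by case: (tri_down_uniq K h h' u u') => [[]|[? ->]|[? ->]]; constructor.
- move=> q a b a' b' h h'; rewrite !neg3 => u u'.
  by case: (tri_up_uniq K h h' u u') => [[]|[? ->]|[? ->]]; constructor.
Qed.

(* What convexity of the image of the boundary and the absence of obstructive
   edges say about the upper boundary; the conditions on the lower boundary are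
   those obtained by a half-turn. *)
Record boundary_above x y tri inn (eta : I -> R) : Prop := BoundaryAbove {
  above_support : forall b a c, ~~ inn b -> tri b a c -> x a <= x b <= x c ->
    [\/ [/\ forall j k, ~~ inn j -> ~~ inn k -> x j < x b < x k ->
            (eta j - eta b) * (x k - x b) + (eta k - eta b) * (x b - x j) <= 0,
           forall j, ~~ inn j -> x j = x b -> eta j <= eta b,
           x a = x b -> inn a & x c = x b -> inn c],
       x a = x b /\ eta a < eta b /\ ~~ inn a |
       x c = x b /\ eta c < eta b /\ ~~ inn c];
  above_edge : forall al be p r t,
    (forall j, ~~ inn j -> eta j <= al * x j + be) ->
    ~~ inn p -> ~~ inn r -> x p < x r -> tri p r t ->
    eta p = al * x p + be -> eta r = al * x r + be -> False;
  above_low : forall al be q u t,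
    (forall j, ~~ inn j -> eta j <= al * x j + be) ->
    ~~ inn u -> inn q -> tri q u t || tri u q t -> x u = x q -> y u < y q ->
    eta u < al * x u + be }.

(** By the first hypothesis each slope from [b] to the right is at most each slope to the left; the
    greatest right slope separates them, or the least left slope if nothing lies to the right. *)
Lemma support_slope (x eta : I -> R) (S : {pred I}) b :
  (forall j k, j \in S -> k \in S -> x j < x b < x k ->
     (eta j - eta b) * (x k - x b) + (eta k - eta b) * (x b - x j) <= 0) ->
  (forall j, j \in S -> x j = x b -> eta j <= eta b) ->
  exists al, forall j, j \in S -> eta j <= al * x j + (eta b - al * x b).
Proof.
move=> cv vert; suff [al [l r]] : exists al,
    (forall j, j \in S -> x j < x b -> al <= slope x eta b j) /\
    (forall j, j \in S -> x b < x j -> slope x eta b j <= al).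
  exists al => j jS; have [xj|xj|xj] := ltgtP (x j) (x b).
  - move: (l j jS xj); rewrite /slope ler_ndivlMr ?subr_lt0 //; lra.
  - move: (r j jS xj); rewrite /slope ler_pdivrMr ?subr_gt0 //; lra.
  - by rewrite xj; have := vert j jS xj; lra.
have lr j k : j \in S -> k \in S -> x j < x b < x k ->
    slope x eta b k <= slope x eta b j.
  move=> jS kS xjk; have := cv j k jS kS xjk; case/andP: xjk => xj xk.
  rewrite /slope ler_pdivrMr ?subr_gt0 // mulrAC ler_ndivlMr ?subr_lt0 //; lra.
case: (pickP [pred k | (k \in S) && (x b < x k)]) => [k kS|noR].
  case: (Order.TotalTheory.arg_maxP (slope x eta b) kS) => m /andP[mS mb] mx.
  exists (slope x eta b m); split=> j jS xj; first by apply: lr; rewrite ?xj.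
  by apply: mx; rewrite /= jS.
case: (pickP [pred k | (k \in S) && (x k < x b)]) => [k kS|noL].
  case: (Order.TotalTheory.arg_minP (slope x eta b) kS) => m /andP[mS mb] mn.
  exists (slope x eta b m); split=> j jS xj; first by apply: mn; rewrite /= jS.
  by have := noR j; rewrite /= jS xj.
exists 0; split=> j jS xj.
  by have := noL j; rewrite /= jS xj.
by have := noR j; rewrite /= jS xj.
Qed.

(** * Triangles below a vertex of the upper boundary *)

Section Above.
Variables (x y : I -> R) (tri : I -> I -> I -> bool) (inn : pred I).
Variables (eta h : I -> R).
Hypothesis K : triangulated x y tri inn.
Hypothesis A : boundary_above x y tri inn eta.
Hypothesis hh : harmonic x y tri inn h.
Hypothesis hb : forall p, ~~ inn p -> h p = eta p.

(** The maximum principle turns a line above the boundary values into a line above all of [h]. The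
    alternatives with a boundary vertex on the vertical of [b] do not occur: the smaller value there
    would make the slope positive. *)
Lemma support_above b a c : ~~ inn b -> tri b a c -> x a <= x b <= x c ->
  det3 x h b a c <= 0 ->
  exists2 al, (forall j, h j <= al * x j + (h b - al * x b)) &
    (x a = x b -> inn a) /\ (x c = x b -> inn c).
Proof.
move=> ib t u d; case: (above_support A ib t u).
- move=> [cv vert ia ic].
  have [al sup] := @support_slope x eta [pred j | ~~ inn j] b cv vert.
  exists al => // j; rewrite -subr_le0.
  have := max_principle K (harmonic_affine 0 al (h b - al * x b) hh).
  move=> /(_ _ j); rewrite mul0r subr0; apply=> p ip.
  by have := sup p ip; rewrite mul0r subr0 !hb // subr_le0.
- move=> [xa [ea ia]]; move: d; rewrite /det3 (hb ia) (hb ib) xa subrr mul0r sub0r.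
  rewrite oppr_le0 nmulr_rge0 ?subr_lt0 // subr_le0 => xc.
  case/eqP: (tri_not_vertical K t xa); lra.
- move=> [xc [ec ic]]; move: d; rewrite /det3 (hb ib) (hb ic) xc subrr mulr0 subr0.
  rewrite nmulr_lle0 ?subr_lt0 // subr_ge0 => xa.
  have xa' : x a = x b by lra.
  by case/eqP: (tri_not_vertical K t xa').
Qed.

(** With a negative slope the interpolated value on the edge [a c], vertically below [b], would
    exceed [h b], against the support line through [b]. *)
Lemma det3_above_ge0 b a c : ~~ inn b -> tri b a c -> x a <= x b <= x c ->
  0 <= det3 x h b a c.
Proof.
move=> ib t u; have [//|d] := lerP 0 (det3 x h b a c); exfalso.
have [al sup _] := support_above ib t u (ltW d).
move: d (sup a) (sup c) u; rewrite /det3; nra.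
Qed.


(** If the slope vanishes, [h] touches the support line. At an interior contact vertex the triangle
    above has slope at most 0 because of the line and at least 0 by assumption; harmonicity makes
    the central triangles there flat, and [flat_star] the whole star. So contact crosses every
    non-vertical contact edge with an interior end. *)
Lemma strict_above b a c : (forall p q r, tri p q r -> 0 <= det3 x h p q r) ->
  ~~ inn b -> tri b a c -> x a <= x b <= x c -> 0 < det3 x h b a c.
Proof.
move=> h0 ib t u; rewrite lt_neqAle h0 // andbT eq_sym; apply/eqP => d0.
have dle0 : det3 x h b a c <= 0 by rewrite d0.
have [al sup [ia ic]] := support_above ib t u dle0.
pose be := h b - al * x b; pose f p := h p - (al * x p + be).
have f0 p : f p <= 0 by rewrite /f subr_le0.
have fh p q r : det3 x f p q r = det3 x h p q r by rewrite /f /det3; ring.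
have fb : f b = 0 by rewrite /f /be; ring.
have fle j : ~~ inn j -> eta j <= al * x j + be by move=> ij; rewrite -hb.
have feq j : ~~ inn j -> f j = 0 -> eta j = al * x j + be.
  by move=> ij; rewrite /f hb // => /eqP; rewrite subr_eq0 => /eqP.
pose F := [pred p | inn p && (f p == 0)].
have Fc q p r : q \in F -> tri q p r -> central x q p r -> det3 x f q p r = 0.
  move=> /andP[iq /eqP fq] t1 c1.
  have [p' [r' /andP[t2 u2]]] := tri_up K iq.
  have c2 : central x q p' r' by rewrite centralE u2.
  have E := hh iq t1 t2 c1 c2.
  have D1 := tri_pos K t1; have D2 := tri_pos K t2.
  have z2 : det3 x h q p' r' = 0.
    apply/eqP; rewrite eq_le (h0 _ _ _ t2) andbT -fh /det3 fq.
    by have := (f0 p', f0 r'); case/andP: u2 => ? ? [? ?]; nra.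
  move/eqP: E; rewrite z2 mul0r mulf_eq0 (gt_eqF D2) orbF fh => /eqP //.
(* A boundary contact vertex on the vertical of [q] and adjacent to it lies above it, as [above_low]
   excludes contact below. This gives the signs that [flat_star] asks for at vertical edges leaving
   [F]. *)
have Fv q p r : q \in F -> tri q p r || tri p q r -> x p = x q -> p \notin F ->
    f p = 0 -> y q < y p.
  move=> /andP[iq /eqP fq] t1 xp; rewrite inE => pF fp.
  have ip : ~~ inn p by move: pF; rewrite fp eqxx andbT.
  have [//|ypq] := ltrP (y q) (y p).
  have ypq' : y p < y q.
    rewrite lt_neqAle ypq andbT; apply/eqP => e.
    by case/orP: t1 => /(tri_pos K); rewrite /det3 xp e !subrr !mul0r ?mulr0 subrr ltxx.
  have := above_low A fle ip iq t1 xp ypq'.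
  by rewrite (feq p ip fp) ltxx.
have Fa q p r : q \in F -> tri q p r -> x p = x q -> p \notin F ->
    0 <= slope x f q r.
  move=> qF t1 xp pF; have fq : f q = 0 by case/andP: qF => _ /eqP.
  have xr := tri_not_vertical K t1 xp.
  have dF : det3 x f q p r = 0.
    by apply: Fc => //; rewrite /central xp subrr mul0r.
  have fp : f p = 0.
    move/eqP: dF; rewrite /det3 xp fq subrr mul0r sub0r oppr_eq0 mulf_eq0.
    by rewrite (subr_eq0 (x r)) (negbTE xr) orbF subr0 => /eqP.
  have yqp : y q < y p by apply: (Fv q p r); rewrite ?t1.
  have := tri_pos K t1; rewrite /det3 xp subrr mul0r sub0r oppr_gt0.
  rewrite pmulr_rlt0 ?subr_gt0 // => xrq.
  by rewrite /slope fq subr0 mulr_le0 ?invr_le0 ?f0 // ltW.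
have Fb q p r : q \in F -> tri q p r -> x r = x q -> r \notin F ->
    slope x f q p <= 0.
  move=> qF t1 xr rF; have fq : f q = 0 by case/andP: qF => _ /eqP.
  have xp : x p != x q.
    by apply/eqP => xp; case/eqP: (tri_not_vertical K t1 xp).
  have dF : det3 x f q p r = 0.
    by apply: Fc => //; rewrite /central xr subrr mulr0.
  have fr : f r = 0.
    move/eqP: dF; rewrite /det3 xr fq subrr mulr0 subr0 mulf_eq0.
    by rewrite (subr_eq0 (x p)) (negbTE xp) subr0 => /eqP.
  have yqr : y q < y r.
    by apply: (Fv q r p) => //; rewrite (tri_rot K (tri_rot K t1)) orbT.
  have := tri_pos K t1; rewrite /det3 xr subrr mulr0 subr0.
  rewrite pmulr_lgt0 ?subr_gt0 // => xrq.
  by rewrite /slope fq subr0 mulr_le0_ge0 ?invr_ge0 ?f0 ?subr_ge0 // ltW.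
have star q p r : q \in F -> tri q p r ->
  [/\ det3 x f q p r = 0,
      x p = x q -> p \notin F -> slope x f q r = 0 &
      x r = x q -> r \notin F -> slope x f q p = 0].
  apply: (flat_star K) => //; first by move=> ? /andP[].
  by move=> *; rewrite fh h0.
have bF : b \notin F by rewrite inE (negbTE ib).
have dF : det3 x f b a c = 0 by rewrite fh.
(* If [a] or [c] is on the vertical of [b], it is interior and thus in [F]; [b] being outside [F],
   [star] at that vertex gives contact at the remaining one. *)
have [fa fc] : f a = 0 /\ f c = 0.
  case/andP: u => xa xc; have [xab|xab] := eqVneq (x a) (x b).
    have xcb := tri_not_vertical K t xab.
    have fa : f a = 0.
      move/eqP: dF; rewrite /det3 xab fb subrr mul0r sub0r oppr_eq0 mulf_eq0.
      by rewrite (subr_eq0 (x c)) (negbTE xcb) orbF subr0 => /eqP.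
    have aF : a \in F by rewrite inE fa eqxx ia.
    have [_ _ /(_ (esym xab) bF)] := star a c b aF (tri_rot K t).
    rewrite /slope fa subr0 xab => /eqP.
    by rewrite mulf_eq0 invr_eq0 (subr_eq0 (x c)) (negbTE xcb) orbF => /eqP.
  have [xcb|xcb] := eqVneq (x c) (x b).
    have fc : f c = 0.
      move/eqP: dF; rewrite /det3 xcb fb subrr mulr0 subr0 mulf_eq0.
      by rewrite (subr_eq0 (x a)) (negbTE xab) subr0 => /eqP.
    have cF : c \in F by rewrite inE fc eqxx ic.
    have [_ /(_ (esym xcb) bF) + _] := star c b a cF (tri_rot K (tri_rot K t)).
    rewrite /slope fc subr0 xcb => /eqP.
    by rewrite mulf_eq0 invr_eq0 (subr_eq0 (x a)) (negbTE xab) orbF => /eqP.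
  have xa' : x a < x b by rewrite lt_neqAle xab.
  have xc' : x b < x c by rewrite lt_neqAle eq_sym xcb.
  move: dF (f0 a) (f0 c); rewrite /det3 fb !subr0 => E fa fc.
  by split; nra.
have xac : x a < x c.
  case/andP: u => xa xc; rewrite lt_neqAle (le_trans xa) // andbT.
  apply/eqP => e; have e' : x a = x b by lra.
  by case/eqP: (tri_not_vertical K t e'); rewrite -e.
have closed p r s : (p \in F) || (r \in F) -> f p = 0 -> f r = 0 ->
    x p < x r -> tri r p s -> f s = 0.
  move=> pr fp fr xpr t1; have dF1 : det3 x f r p s = 0.
    case/orP: pr => qF; last by have [] := star _ _ _ qF t1.
    by rewrite -det3_rot; have [] := star _ _ _ qF (tri_rot K t1).
  move/eqP: dF1; rewrite /det3 fp fr subrr mul0r subr0 subr0 mulf_eq0.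
  by rewrite (subr_eq0 (x p)) (lt_eqF xpr) => /eqP.
(* Among the triangles on which [h] touches the support line, consider the one
   with the lowest lower edge over an abscissa [x0] which is not that of a
   vertex: both ends of this edge lie on the boundary. *)
have [m /= am mmin] : exists2 m, x a < x m & forall p, x a < x p -> x m <= x p.
  by case: (Order.TotalTheory.arg_minP x (xac : [pred p | x a < x p] c)) => m; exists m.
pose x0 := (x a + x m) / 2%:R.
have x0a : x a < x0 by rewrite /x0; lra.
have x0m : x0 < x m by rewrite /x0; lra.
have x0N p : x p != x0.
  have [/mmin mp|pa] := ltrP (x a) (x p); first by rewrite gt_eqF // (lt_le_trans x0m).
  by rewrite lt_eqF // (le_lt_trans pa).
pose C (t : I * I * I) := [&& tri t.1.1 t.1.2 t.2,
  (f t.1.1 == 0) && (f t.1.2 == 0), f t.2 == 0 & x t.1.1 < x0 < x t.1.2].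
pose E (t : I * I * I) := y t.1.1 + slope x y t.1.1 t.1.2 * (x0 - x t.1.1).
have C0 : C (a, c, b).
  by rewrite /C /= (tri_rot K t) fa fb fc eqxx x0a (lt_le_trans x0m) ?mmin.
case: (Order.TotalTheory.arg_minP E C0) => -[[p r] q] /and4P[/= t1].
move=> /andP[/eqP fp /eqP fr] /eqP fq /andP[xp xr] Emin.
have xpr := lt_trans xp xr.
case: (boolP ((p \in F) || (r \in F))) => [prF|]; last first.
  rewrite !inE fp fr eqxx !andbT negb_or => /andP[ip ir].
  exact: (above_edge A fle ip ir xpr t1 (feq p ip fp) (feq r ir fr)).
(* With an interior end there is a triangle below the edge [p r]; its third vertex is a contact
   vertex too, and its side that passes over [x0] is lower than [p r]. *)
have [s ts] : exists s, tri r p s.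
  case/orP: (prF) => /andP[iv _].
    by have [s /(tri_rot K)/(tri_rot K)] := tri_prev K iv t1; exists s.
  by have [s] := tri_next K iv (tri_rot K t1); exists s.
have fs := closed p r s prF fp fr xpr ts.
have D := tri_pos K ts.
have [xs|xs|/eqP] := ltgtP x0 (x s); last by rewrite eq_sym (negbTE (x0N s)).
  have Cs : C (p, s, r) by rewrite /C /= (tri_rot K ts) fp fs fr eqxx xp xs.
  have := Emin _ Cs; rewrite /E /= lerD2l ler_pM2r ?subr_gt0 //.
  rewrite /slope ler_pdivrMr ?subr_gt0 // mulrAC ler_pdivlMr; last first.
    by rewrite subr_gt0 (lt_trans xp).
  by move: D; rewrite /det3; lra.
have Cs : C (s, r, p).
  by rewrite /C /= (tri_rot K (tri_rot K ts)) fp fs fr eqxx xs xr.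
have := Emin _ Cs.
have Er i j : x i < x j ->
    y i + slope x y i j * (x0 - x i) = y j + slope x y i j * (x0 - x j).
  by rewrite /slope -subr_gt0 => ij; field; apply: lt0r_neq0.
rewrite /E /= !Er ?(lt_trans xs) // lerD2l ler_nM2r ?subr_lt0 //.
rewrite /slope ler_pdivrMr ?subr_gt0 ?(lt_trans xs) // mulrAC ler_pdivlMr; last first.
  by rewrite subr_gt0.
by move: D; rewrite /det3; lra.
Qed.

End Above.

(* Strict monotonicity along the verticals: first [det3 x h >= 0] everywhere, by
   [flat_exit] applied to [h - m y] where [m] is the least vertical slope
   of [h], then strict positivity, by [flat_exit] applied to [h]. *)
Theorem monotone_extension x y tri inn eta :
  triangulated x y tri inn ->
  boundary_above x y tri inn eta ->
  boundary_above (fun p => - x p) (fun p => - y p) tri inn (fun p => - eta p) ->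
  exists2 h, forall p, ~~ inn p -> h p = eta p &
    forall a b c, tri a b c -> 0 < det3 x h a b c.
Proof.
move=> K A A'; have [h hh hb] := harmonic_extension K eta; exists h => //.
have K' := triangulated_opp K.
have det_opp f a b c : det3 (fun p => - x p) (fun p => - f p) a b c = det3 x f a b c.
  by rewrite /det3; lra.
have hh' : harmonic (fun p => - x p) (fun p => - y p) tri inn (fun p => - h p).
  move=> q a b a' b' iq t t' c c'; rewrite !det_opp; apply: hh => //.
    by move: c; rewrite /central; lra.
  by move: c'; rewrite /central; lra.
have hb' p : ~~ inn p -> - h p = - eta p by move=> /hb ->.
have bd_ge0 b a c : ~~ inn b -> tri b a c -> central x b a c ->
    0 <= det3 x h b a c.
  move=> ib t; rewrite centralE => /orP[]/andP[u1 u2]; last first.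
    by apply: (det3_above_ge0 K A hh hb); rewrite ?u1.
  rewrite -det_opp; apply: (det3_above_ge0 K' A' hh' hb') => //.
  by rewrite !lerN2 u1 u2.
have h0 a b c : tri a b c -> 0 <= det3 x h a b c.
  move=> t; have [//|d] := lerP 0 (det3 x h a b c); exfalso.
  pose T (s : I * I * I) := tri s.1.1 s.1.2 s.2.
  pose B (s : I * I * I) := det3 x h s.1.1 s.1.2 s.2 / det3 x y s.1.1 s.1.2 s.2.
  case: (Order.TotalTheory.arg_minP B (t : T (a, b, c))) => -[[p q] r] tm mm.
  pose m := B (p, q, r); have m0 : m < 0.
    apply: le_lt_trans (mm (a, b, c) t) _.
    by rewrite /B /= pmulr_llt0 // invr_gt0 (tri_pos K t).
  have eg := det3_affine x y h m 0 0.
  set g := fun p => _ in eg.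
  have g0 u v w : tri u v w -> 0 <= det3 x g u v w.
    move=> tt; rewrite eg subr_ge0 -ler_pdivlMr ?(tri_pos K tt) //.
    exact: (mm (u, v, w) tt).
  have gh : harmonic x y tri inn g by apply: harmonic_affine.
  have [||u [v [w [iu tu cu]]]] := flat_exit K g0 _ tm.
  - move=> u v w v' w' iu t1 t2 c1 c2 d1; apply/eqP.
    have := gh u v w v' w' iu t1 t2 c1 c2.
    rewrite d1 mul0r => /esym/eqP; rewrite mulf_eq0 => /orP[//|].
    by rewrite (gt_eqF (tri_pos K t1)).
  - rewrite eg; apply/eqP; rewrite subr_eq0; apply/eqP; rewrite /m /B /= divfK //.
    by rewrite gt_eqF ?(tri_pos K tm).
  rewrite eg => /eqP; rewrite subr_eq0 => /eqP e.
  have := bd_ge0 u v w iu tu cu; rewrite e leNgt nmulr_rlt0 ?(tri_pos K tu) //.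
move=> a b c t; rewrite lt_neqAle h0 // andbT eq_sym; apply/eqP => d0.
have [|u [v [w [iu tu]]]] := flat_exit K h0 _ t d0.
  move=> u v w v' w' iu t1 t2 c1 c2 d1; apply/eqP.
  have := hh u v w v' w' iu t1 t2 c1 c2.
  rewrite d1 mul0r => /esym/eqP; rewrite mulf_eq0 => /orP[//|].
  by rewrite (gt_eqF (tri_pos K t1)).
rewrite centralE => /orP[]/andP[u1 u2] e.
  have : 0 < det3 (fun p => - x p) (fun p => - h p) u v w.
    apply: (strict_above K' A' hh' hb') => //; last by rewrite !lerN2 u1 u2.
    by move=> *; rewrite det_opp h0.
  by rewrite det_opp e ltxx.
have : 0 < det3 x h u v w by apply: (strict_above K A hh hb); rewrite ?u1.
by rewrite e ltxx.
Qed.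

End Core.

(** * Hulls and disks in the plane *)

Section Plane.
Variable R : realType.
Implicit Types (p q z d a b c : plane R) (s : {fset plane R}) (k : R).

Lemma scalep1 k p : (k *: p).1 = k * p.1. Proof. by []. Qed.
Lemma scalep2 k p : (k *: p).2 = k * p.2. Proof. by []. Qed.
Lemma addp1 p q : (p + q).1 = p.1 + q.1. Proof. by []. Qed.
Lemma addp2 p q : (p + q).2 = p.2 + q.2. Proof. by []. Qed.
Lemma oppp1 p : (- p).1 = - p.1. Proof. by []. Qed.
Lemma oppp2 p : (- p).2 = - p.2. Proof. by []. Qed.
Definition planeE := (scalep1, scalep2, addp1, addp2, oppp1, oppp2).

Lemma plane_eq p q : p.1 = q.1 -> p.2 = q.2 -> p = q.
Proof. by case: p q => [p1 p2] [q1 q2] /= -> ->. Qed.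

Lemma near_box z (P : plane R -> Prop) : (\forall p \near z, P p) <->
  exists2 e, 0 < e & forall p, `|p.1 - z.1| < e -> `|p.2 - z.2| < e -> P p.
Proof.
split=> [/nbhs_ballP[e /= e0 H]|[e e0 H]].
  exists e => // p p1 p2; apply: H; split; rewrite /ball /= distrC //.
apply/nbhs_ballP; exists e => //= p [].
by rewrite /ball /= distrC => p1; rewrite distrC => p2; apply: H.
Qed.

Lemma near_dir z d (P : plane R -> Prop) : (\forall p \near z, P p) ->
  exists2 t0, 0 < t0 & forall t, 0 <= t <= t0 -> P (z + t *: d).
Proof.
move/near_box => [e e0 H]; have m0 : 0 < `|d.1| + `|d.2| + 1.
  by rewrite ltr_wpDl ?addr_ge0.
exists (e / (`|d.1| + `|d.2| + 1) / 2%:R); first by rewrite !divr_gt0.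
move=> t /andP[t0 te].
have te' : t * (`|d.1| + `|d.2| + 1) < e.
  rewrite -ltr_pdivlMr // (le_lt_trans te) // ltr_pdivrMr ?ltr0n //.
  by rewrite ltr_pMr ?divr_gt0 // ltr1n.
apply: H; rewrite !planeE addrC addKr normrM (ger0_norm t0).
  apply: le_lt_trans te'; rewrite ler_wpM2l // -addrA lerDl addr_ge0 //.
apply: le_lt_trans te'; rewrite ler_wpM2l //.
by rewrite addrAC lerDr addr_ge0.
Qed.

Lemma near_all_seq (T : eqType) z (l : seq T) (P : T -> plane R -> Prop) :
  (forall i, i \in l -> \forall p \near z, P i p) ->
  \forall p \near z, forall i, i \in l -> P i p.
Proof.
elim: l => [_|i l IH H]; first by near=> p.
have H1 := H i (mem_head _ _).
have H2 := IH (fun j jl => H j (mem_behead (s := i :: l) jl)).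
near=> p => j; rewrite inE => /predU1P[->|jl].
  by near: p.
by move: j jl; near: p.
Unshelve. all: by end_near. Qed.

Section HullBasics.

Lemma hull_convex s : forall p q k, hull s p -> hull s q -> 0 <= k <= 1 ->
  hull s ((1 - k) *: p + k *: q).
Proof.
move=> p q k [w [w0 w1 ->]] [w' [w'0 w'1 ->]] /andP[k0 k1].
exists (fun r => (1 - k) * w r + k * w' r); split.
- by move=> r rs; rewrite addr_ge0 // mulr_ge0 ?subr_ge0 ?w0 ?w'0.
- by rewrite big_split /= -!mulr_sumr w1 w'1 !mulr1 subrK.
- rewrite !scaler_sumr -big_split /=; apply: eq_bigr => r _.
  by rewrite 2!scalerA -scalerDl.
Qed.

Lemma delta_sum s a k : a \in s -> \sum_(p <- s) (p == a)%:R * k = k.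
Proof.
move=> sa; rewrite (big_fsetD1 a) //= eqxx mul1r big_seq big1 ?addr0 // => p.
by rewrite in_fsetD1 => /andP[/negbTE -> _]; rewrite mul0r.
Qed.

Lemma delta_sumv s a k : a \in s -> \sum_(p <- s) ((p == a)%:R * k) *: p = k *: a.
Proof.
move=> sa; rewrite (big_fsetD1 a) //= eqxx mul1r big_seq big1 ?addr0 // => p.
by rewrite in_fsetD1 => /andP[/negbTE -> _]; rewrite mul0r scale0r.
Qed.

Lemma mem_hull s a : a \in s -> hull s a.
Proof.
move=> sa; exists (fun p => (p == a)%:R * 1); split.
- by move=> p _; rewrite mulr1 ler0n.
- exact: delta_sum.
- by rewrite delta_sumv // scale1r.
Qed.

Lemma hull_sub s t : fsubset s t -> hull s `<=` hull t.
Proof.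
move=> st p [w [w0 w1 ->]]; exists (fun q => if q \in s then w q else 0); split.
- by move=> q _; case: ifP => // /w0.
- rewrite -w1 -(big_fset_incl _ st) /=; last by move=> q _ /negbTE ->.
  by rewrite big_seq [RHS]big_seq; apply: eq_bigr => q ->.
- rewrite -(big_fset_incl _ st) /=; last by move=> q _ /negbTE ->; rewrite scale0r.
  by rewrite big_seq [RHS]big_seq; apply: eq_bigr => q ->.
Qed.

Lemma hull0 p : ~ hull fset0 p.
Proof. by move=> [w [_ + _]]; rewrite big_seq_fset0 => /eqP; rewrite eq_sym oner_eq0. Qed.

Lemma hull_fset1U a s p : hull (a |` s)%fset p ->
  p = a \/ exists q k, [/\ hull s q, 0 <= k <= 1 & p = (1 - k) *: a + k *: q].
Proof.
have [as_|nas] := boolP (a \in s).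
  rewrite mem_fset1U // => hp; right; exists p, 1; split=> //.
    by rewrite ler01 lexx.
  by rewrite subrr scale0r add0r scale1r.
move=> [w [w0 + ->]]; rewrite !big_fsetU1 //=.
have ws q : q \in s -> 0 <= w q by move=> qs; rewrite w0 // in_fset1U qs orbT.
set k := \sum_(q <- s) w q => wk.
have k0 : 0 <= k by rewrite /k big_seq sumr_ge0.
have wa : w a = 1 - k by rewrite -wk addrK.
have wa0 : 0 <= w a by rewrite w0 // in_fset1U eqxx.
have [kz|kn] := eqVneq k 0; last first.
  right; exists (\sum_(q <- s) (w q / k) *: q), k; split.
  - exists (fun q => w q / k); split=> //.
      by move=> q qs; rewrite divr_ge0 // ws.
    by rewrite -mulr_suml divff.
  - by rewrite k0 /= -subr_ge0 -wa.
  - rewrite wa; congr (_ + _); rewrite scaler_sumr; apply: eq_bigr => q _.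
    by rewrite scalerA mulrC divfK.
left; rewrite wa kz subr0 scale1r big_seq big1 ?addr0 // => q qs.
have : w q = 0; last by move->; rewrite scale0r.
apply/eqP; rewrite eq_le ws // andbT -kz /k (big_fsetD1 q) //= lerDl.
by rewrite big_seq sumr_ge0 // => r; rewrite in_fsetD1 => /andP[_ /ws].
Qed.

Lemma hull1 a p : hull [fset a]%fset p -> p = a.
Proof.
rewrite -[[fset a]%fset](fsetU0) => /hull_fset1U[//|[q [k [/hull0]]]] //.
Qed.

Lemma hull2 a b p : hull [fset a; b]%fset p ->
  exists2 k, 0 <= k <= 1 & p = (1 - k) *: a + k *: b.
Proof.
move=> /hull_fset1U[->|[q [k [/hull1-> k01 ->]]]]; last by exists k.
exists 0; first by rewrite lexx ler01.
by rewrite subr0 scale1r scale0r addr0.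
Qed.

Lemma comb_hull s a b c (ka kb kc : R) : a \in s -> b \in s -> c \in s ->
  0 <= ka -> 0 <= kb -> 0 <= kc -> ka + kb + kc = 1 ->
  hull s (ka *: a + kb *: b + kc *: c).
Proof.
move=> sa sb sc a0 b0 c0 abc.
exists (fun p => (p == a)%:R * ka + (p == b)%:R * kb + (p == c)%:R * kc); split.
- by move=> p _; rewrite !addr_ge0 // mulr_ge0 ?ler0n.
- by rewrite !big_split /= !delta_sum.
- under eq_bigr do rewrite !scalerDl.
  by rewrite !big_split /= !delta_sumv.
Qed.

Lemma hull3 a b c p : hull [fset a; b; c]%fset p ->
  exists ka kb kc, [/\ [/\ 0 <= ka, 0 <= kb & 0 <= kc], ka + kb + kc = 1 &
    p = ka *: a + kb *: b + kc *: c].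
Proof.
rewrite fsetUC => /hull_fset1U[->|[q [k [/hull2 [l l01 ->]] k01 ->]]].
  exists 0, 0, 1; split=> //; first by rewrite !add0r.
  by rewrite !scale0r !add0r scale1r.
exists (k * (1 - l)), (k * l), (1 - k).
case/andP: l01 => l0 l1; case/andP: k01 => k0 k1; split; last first.
- by rewrite scalerDr !scalerA addrC.
- ring.
- by split; rewrite ?mulr_ge0 ?subr_ge0.
Qed.

(** By induction on the vertices, the hull is the image of [[0, 1]] times a smaller hull under the
    cone map; the separate [[set a]] takes care of an empty base. *)
Lemma hull_compact s : compact (hull s).
Proof.
elim/finSet_rect: s => s IH.
have [->|/fset0Pn[a sa]] := eqVneq s fset0.
  rewrite (_ : hull fset0 = set0); first exact: compact0.
  by apply/seteqP; split=> p // /hull0.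
rewrite -(fsetD1K sa); set t := (s `\ a)%fset.
have -> : hull (a |` t)%fset = [set a] `|`
    (fun kq : R * plane R => (1 - kq.1) *: a + kq.1 *: kq.2) @` (`[0, 1]%classic `*` hull t).
  apply/seteqP; split=> p.
    move=> /hull_fset1U[->|[q [k [hq k01 ->]]]]; first by left.
    by right; exists (k, q) => //; split=> //=; rewrite in_itv.
  move=> [->|]; first by apply: mem_hull; rewrite in_fset1U eqxx.
  move=> [[k q] [/=]]; rewrite in_itv /= => k01 hq <-.
  apply: hull_convex => //; first by apply: mem_hull; rewrite in_fset1U eqxx.
  by apply: hull_sub hq; rewrite fsubsetU1.
apply: compactU; first exact: compact_set1.
apply: continuous_compact; last first.
  apply: compact_setX; first exact: segment_compact.
  by apply: IH; rewrite fproperD1.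
apply: continuous_subspaceT => kq.
apply: cvgD; apply: cvgZ.
- by apply: cvgB; [exact: cvg_cst|exact: cvg_fst].
- exact: cvg_cst.
- exact: cvg_fst.
- exact: cvg_snd.
Qed.

Lemma hull_closed s : closed (hull s).
Proof.
apply: compact_closed; last exact: hull_compact.
exact: norm_hausdorff.
Qed.

End HullBasics.

(** Twice the signed area, positive for a counterclockwise triangle: [det3] of the coordinate
    functions. *)
Definition area a b c : R :=
  (b.1 - a.1) * (c.2 - a.2) - (b.2 - a.2) * (c.1 - a.1).

Lemma area_rot a b c : area b c a = area a b c.
Proof. rewrite /area; ring. Qed.

Lemma area_swap a b c : area b a c = - area a b c.
Proof. rewrite /area; ring. Qed.

Lemma area_comb a b c ka kb kc (p := ka *: a + kb *: b + kc *: c) :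
  ka + kb + kc = 1 ->
  [/\ area p b c = ka * area a b c, area a p c = kb * area a b c
    & area a b p = kc * area a b c].
Proof.
move=> abc; rewrite /area /p !planeE.
by have -> : ka = 1 - kb - kc by [lra]; split; ring.
Qed.

Lemma area_sum a b c p : area p b c + area a p c + area a b p = area a b c.
Proof. rewrite /area; ring. Qed.

Lemma barycentric a b c p : area a b c != 0 ->
  p = (area p b c / area a b c) *: a + (area a p c / area a b c) *: b +
      (area a b p / area a b c) *: c.
Proof.
by move=> n0; apply: plane_eq; rewrite !planeE; move: n0;
  rewrite /area => n0; field.
Qed.

Lemma hull3_area a b c p : 0 < area a b c -> hull [fset a; b; c]%fset p <->
  [/\ 0 <= area p b c, 0 <= area a p c & 0 <= area a b p].
Proof.
move=> abc; split.
  move=> /hull3[ka [kb [kc [[a0 b0 c0] k1 ->]]]].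
  by have [-> -> ->] := area_comb a b c k1; rewrite !mulr_ge0 // ltW.
move=> [a0 b0 c0]; rewrite [p](@barycentric a b c) ?gt_eqF //.
have abc0 := ltW abc; apply: comb_hull; rewrite ?inE ?eqxx ?orbT ?divr_ge0 //.
by rewrite -!mulrDl area_sum divff // gt_eqF.
Qed.

End Plane.

Section WithinNear.

Lemma within_near (T U : topologicalType) (A : set T) (f : T -> U) z
    (P : U -> Prop) : {within A, continuous f} -> A z ->
  (\forall q \near f z, P q) -> \forall p \near z, A p -> P (f p).
Proof. by move=> /subspace_continuousP fA Az; apply: fA. Qed.

Lemma near_within (T U : topologicalType) (A : set T) (f : T -> U) :
  (forall z (P : U -> Prop), A z -> (\forall q \near f z, P q) ->
    \forall p \near z, A p -> P (f p)) -> {within A, continuous f}.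
Proof. by move=> H; apply/subspace_continuousP => z Az P; apply: H. Qed.

Lemma within_comp (T U V : topologicalType) (A : set T) (B : set U)
    (f : T -> U) (g : U -> V) : (forall p, A p -> B (f p)) ->
  {within A, continuous f} -> {within B, continuous g} ->
  {within A, continuous (g \o f)}.
Proof.
move=> AB fA gB; apply: near_within => z P Az HP.
have H1 := within_near gB (AB z Az) HP.
have H2 := within_near fA Az H1.
by apply: filterS H2 => p H Ap; apply: H => //; apply: AB.
Qed.

End WithinNear.

(** * Local topology of the disk *)

Section Disk.
Variable R : realType.
Implicit Types (p q z d a b c : plane R) (k : R).

Lemma continuous_affine_path a b :
  continuous (fun k : R => (1 - k) *: a + k *: b : plane R).
Proof.
move=> k; apply: cvgD; apply: cvgZ.
- by apply: cvgB; [exact: cvg_cst|exact: cvg_id].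
- exact: cvg_cst.
- exact: cvg_id.
- exact: cvg_cst.
Qed.

Lemma disk2_convex p q k : disk2 p -> disk2 q -> 0 <= k <= 1 ->
  disk2 ((1 - k) *: p + k *: q).
Proof.
rewrite /disk2 /= => hp hq /andP[k0 k1].
have -> : ((1 - k) * p.1 + k * q.1) ^+ 2 + ((1 - k) * p.2 + k * q.2) ^+ 2 =
  (1 - k) * (p.1 ^+ 2 + p.2 ^+ 2) + k * (q.1 ^+ 2 + q.2 ^+ 2) -
  k * (1 - k) * ((p.1 - q.1) ^+ 2 + (p.2 - q.2) ^+ 2) by ring.
have : 0 <= k * (1 - k) * ((p.1 - q.1) ^+ 2 + (p.2 - q.2) ^+ 2).
  apply: mulr_ge0; last by rewrite addr_ge0 ?sqr_ge0.
  by rewrite mulr_ge0 // subr_ge0.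
have : k * (q.1 ^+ 2 + q.2 ^+ 2) <= k * 1 by rewrite ler_wpM2l.
have : (1 - k) * (p.1 ^+ 2 + p.2 ^+ 2) <= (1 - k) * 1.
  by rewrite ler_wpM2l ?subr_ge0.
lra.
Qed.

Lemma disk2_off_line a b : a != b -> exists2 m, disk2 m & area a b m != 0.
Proof.
move=> ab; apply: contrapT => H.
have z m : disk2 m -> area a b m = 0.
  by move=> hm; apply: contrapT => /eqP n; apply: H; exists m.
have /z h0 : disk2 ((0, 0) : plane R) by rewrite /disk2 /= expr0n /= addr0.
have /z h1 : disk2 ((1, 0) : plane R) by rewrite /disk2 /= expr0n /= expr1n addr0.
have /z h2 : disk2 ((0, 1) : plane R) by rewrite /disk2 /= expr0n /= expr1n add0r.
move: h0 h1 h2; rewrite /area /= => h0 h1 h2.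
by case/eqP: ab; apply: plane_eq; lra.
Qed.

Lemma near_in_box z e : 0 < e ->
  \forall p \near z, `|p.1 - z.1| < e /\ `|p.2 - z.2| < e.
Proof. by move=> e0; apply/near_box; exists e. Qed.

Lemma norm_convex (u v w e k : R) : 0 <= k <= 1 -> `|u - w| < e ->
  `|v - w| < e -> `|(1 - k) * u + k * v - w| < e.
Proof.
move=> /andP[k0 k1] ue ve.
have -> : (1 - k) * u + k * v - w = (1 - k) * (u - w) + k * (v - w) by ring.
apply: le_lt_trans (ler_normD _ _) _.
rewrite !normrM (ger0_norm k0) ger0_norm ?subr_ge0 //.
pose m := Num.max `|u - w| `|v - w|.
apply: (@le_lt_trans _ _ m); last by rewrite gt_max ue ve.
have : (1 - k) * `|u - w| <= (1 - k) * m by rewrite ler_wpM2l ?subr_ge0 // le_max lexx.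
have : k * `|v - w| <= k * m by rewrite ler_wpM2l // le_max lexx orbT.
lra.
Qed.

(* Locally, a disk is not separated by one of its points. *)
Lemma disk_no_cut (D : set (plane R)) z (phi : plane R -> R) :
  topological_disk D -> D z -> continuous phi -> phi z = 0 ->
  (\forall p \near z, D p -> phi p = 0 -> p = z) ->
  (forall P : plane R -> Prop, (\forall p \near z, P p) ->
    exists p q, [/\ D p /\ D q, P p, P q & phi p < 0 < phi q]) -> False.
Proof.
move=> [f [g [fc gc fD gD [gf fg]]]] Dz phic phiz nz sides.
have a2 : disk2 (g z) by apply: gD; exists z.
have fgz : f (g z) = z := fg z Dz.
have Df b : disk2 b -> D (f b) by move=> hb; apply: fD; exists b.
have nz' : \forall q \near f (g z), D q -> phi q = 0 -> q = z by rewrite fgz.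
have /near_box[e e0 He] := within_near fc a2 nz'.
pose B b := [/\ disk2 b, `|b.1 - (g z).1| < e & `|b.2 - (g z).2| < e].
have nB : \forall p \near z, D p -> B (g p).
  have := within_near gc Dz (near_in_box (g z) e0).
  apply: filterS => p H Dp; have [H1 H2] := H Dp.
  by split=> //; apply: gD; exists p.
have B0 b : B b -> phi (f b) = 0 -> b = g z.
  by move=> [b2 b1 b3] h; rewrite -(gf b b2) (He b b1 b3 b2 (Df b b2) h).
(* [B] is convex, so the intermediate value theorem puts a zero of [phi \o f] on the segment and in
   [B], where [g z] is the only one. *)
have seg b b' : B b -> B b' -> phi (f b) < 0 < phi (f b') ->
    exists2 k, 0 <= k <= 1 & g z = (1 - k) *: b + k *: b'.
  move=> [b2 b11 b12] [b'2 b'11 b'12] /andP[fb fb'].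
  have conv k : 0 <= k <= 1 -> disk2 ((1 - k) *: b + k *: b').
    by apply: disk2_convex.
  have C : {within `[0, 1], continuous
      (phi \o (f \o (fun k : R => (1 - k) *: b + k *: b' : plane R)))}.
    apply: (within_comp (B := setT)) => //; last exact: continuous_subspaceT.
    apply: (within_comp _ _ fc); first by move=> k /=; rewrite in_itv; apply: conv.
    by apply: continuous_subspaceT; apply: continuous_affine_path.
  have [] := IVT ler01 C (v := 0).
    rewrite /= !subr0 subrr !scale1r !scale0r addr0 add0r.
    by rewrite minElt maxElt; case: ifP; lra.
  move=> k; rewrite in_itv => k01 /= k0; exists k => //; apply/esym/B0 => //.
  split; first exact: conv.
    by rewrite !planeE norm_convex.
  by rewrite !planeE norm_convex.
have [p [q [[Dp Dq] Bp Bq pq]]] := sides _ nB.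
have {}Bp := Bp Dp; have {}Bq := Bq Dq.
set b := g p in Bp; set b' := g q in Bq.
have Fb : phi (f b) < 0 by rewrite /b fg //; case/andP: pq.
have Fb' : 0 < phi (f b') by rewrite /b' fg //; case/andP: pq.
have [k k01 gzk] : exists2 k, 0 <= k <= 1 & g z = (1 - k) *: b + k *: b'.
  by apply: seg; rewrite ?Fb.
have bb' : b != b' by apply/eqP => e1; move: Fb'; rewrite -e1; lra.
(* Take [c] near [g z] off the line through [b] and [b']. The segment from [c] to the end with the
   opposite sign contains [g z] too, so [g z] would be that end, where [phi \o f] is not 0. *)
have [m m2 marea] := disk2_off_line bb'.
have [t0 t00 Ht0] := near_dir (m - g z) (near_in_box (g z) e0).
pose t := Num.min t0 1.
have t_gt0 : 0 < t by rewrite lt_min t00 ltr01.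
have t01 : 0 <= t <= 1 by rewrite ltW //= ge_min lexx orbT.
pose c := (1 - t) *: g z + t *: m.
have ce : c = g z + t *: (m - g z).
  by rewrite /c scalerBl scalerBr scale1r addrA addrAC.
have areaz : area b b' (g z) = 0 by rewrite gzk /area !planeE; ring.
have areac : area b b' c != 0.
  have -> : area b b' c = t * area b b' m + (1 - t) * area b b' (g z).
    by rewrite /c /area !planeE; ring.
  by rewrite areaz mulr0 addr0 mulf_neq0 // gt_eqF.
have Bc : B c.
  split; first exact: disk2_convex.
    by rewrite ce; apply: (Ht0 t _).1; rewrite ltW //= ge_min lexx.
  by rewrite ce; apply: (Ht0 t _).2; rewrite ltW //= ge_min lexx.
have Fc : phi (f c) != 0.
  by apply/eqP => /(B0 c Bc) cz; move: areac; rewrite cz areaz eqxx.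
case: (ltgtP (phi (f c)) 0) Fc => // Fc _.
  have [l l01 gl] := seg c b' Bc Bq (introT andP (conj Fc Fb')).
  have : area b b' (g z) = (1 - l) * area b b' c.
    by rewrite gl /area !planeE; ring.
  rewrite areaz => /esym/eqP; rewrite mulf_eq0 (negbTE areac) orbF subr_eq0.
  move=> /eqP l1; move: gl Fb'; rewrite -l1 subrr scale0r scale1r add0r => <-.
  by rewrite fgz phiz ltxx.
have [l l01 gl] := seg b c Bp Bc (introT andP (conj Fb Fc)).
have : area b b' (g z) = l * area b b' c.
  by rewrite gl /area !planeE; ring.
rewrite areaz => /esym/eqP; rewrite mulf_eq0 (negbTE areac) orbF.
move=> /eqP l1; move: gl Fb; rewrite l1 subr0 scale0r scale1r addr0 => <-.
by rewrite fgz phiz ltxx.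
Qed.

End Disk.

(** * Simplicial complexes and their triangles *)

Lemma disk_not_isolated (R : realType) (D : set (plane R)) z :
  topological_disk D -> D z -> ~ (\forall p \near z, D p -> p = z).
Proof.
move=> [f [g [fc gc fD gD [gf fg]]]] Dz nz.
have a2 : disk2 (g z) by apply: gD; exists z.
have nz' : \forall q \near f (g z), D q -> q = z by rewrite fg.
have H := within_near fc a2 nz'.
have [m m2 mz] : exists2 m, disk2 m & m != g z.
  have [e|n] := eqVneq (g z) ((0, 0) : plane R); last first.
    by exists (0, 0); rewrite 1?eq_sym //= /disk2 /= expr0n /= addr0.
  exists (1, 0); first by rewrite /disk2 /= expr0n /= expr1n addr0.
  by rewrite e; apply/eqP => -[/eqP]; rewrite oner_eq0.
have [t0 t00 Ht0] := near_dir (m - g z) H.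
pose t := Num.min t0 1.
have t_gt0 : 0 < t by rewrite lt_min t00 ltr01.
have t01 : 0 <= t <= 1 by rewrite ltW //= ge_min lexx orbT.
have tt : 0 <= t <= t0 by rewrite ltW //= ge_min lexx.
have ce : g z + t *: (m - g z) = (1 - t) *: g z + t *: m.
  by rewrite scalerBl scalerBr scale1r addrA addrAC.
have c2 : disk2 (g z + t *: (m - g z)) by rewrite ce; apply: disk2_convex.
have := Ht0 t tt c2 (fD _ (ex_intro2 _ _ _ c2 erefl)).
move=> /(congr1 g); rewrite gf // => /eqP.
rewrite -subr_eq0 addrAC subrr add0r scaler_eq0 subr_eq0 (negbTE mz) orbF.
by rewrite gt_eqF.
Qed.

Section Complex.
Variables (R : realType) (K : {fset {fset plane R}}).
Hypothesis KC : simplicial_complex K.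
Implicit Types (p q z d a b c : plane R) (s t : {fset plane R}) (k : R).

(** The point lies in the hull of a common face [u]; its barycentric coordinates in [s] are unique
    by affine independence, so a positive one at [q] forces [q] into [u]. *)
Lemma carrier s t (w : plane R -> R) q : s \in K -> t \in K ->
  (forall p, p \in s -> 0 <= w p) -> \sum_(p <- s) w p = 1 ->
  hull t (\sum_(p <- s) w p *: p) -> q \in s -> 0 < w q -> q \in t.
Proof.
move=> sK tK w0 w1 ht qs wq; case: KC => K1 K2 K3.
have [u [us ut stu]] := K3 s t sK tK.
have [w' [w'0 w'1 e]] : hull u (\sum_(p <- s) w p *: p).
  by rewrite -stu; split=> //; exists w.
have [qu|qu] := boolP (q \in u); first exact: (fsubsetP ut).
pose w2 p := if p \in u then w' p else 0.
have s1 : \sum_(p <- s) w2 p = 1.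
  rewrite -w'1 -(big_fset_incl _ us) /=; last by move=> p _ /negbTE; rewrite /w2 => ->.
  by rewrite big_seq [RHS]big_seq; apply: eq_bigr => p; rewrite /w2 => ->.
have s2 : \sum_(p <- s) w2 p *: p = \sum_(p <- s) w p *: p.
  rewrite e -(big_fset_incl _ us) /=; last first.
    by move=> p _ /negbTE; rewrite /w2 => ->; rewrite scale0r.
  by rewrite big_seq [RHS]big_seq; apply: eq_bigr => p; rewrite /w2 => ->.
have [_ indep] := K1 s sK.
have := indep (fun p => w p - w2 p) _ _ q qs.
rewrite sumrB w1 s1 subrr => /(_ erefl).
under eq_bigr do rewrite scalerBl.
rewrite sumrB s2 subrr => /(_ erefl).
by rewrite /w2 (negbTE qu) subr0 => w_0; move: wq; rewrite w_0 ltxx.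
Qed.

(** The three points may coincide, so that edges and vertices are special cases. *)
Lemma carrier_comb s t a b c (ka kb kc : R) : s \in K -> t \in K ->
  a \in s -> b \in s -> c \in s -> 0 < ka -> 0 <= kb -> 0 <= kc ->
  ka + kb + kc = 1 -> hull t (ka *: a + kb *: b + kc *: c) -> a \in t.
Proof.
move=> sK tK sa sb sc a0 b0 c0 abc ht; have a0' := ltW a0.
pose w p := (p == a)%:R * ka + (p == b)%:R * kb + (p == c)%:R * kc.
apply: (@carrier s t w) => //.
- by move=> p _; rewrite !addr_ge0 // mulr_ge0 ?ler0n.
- by rewrite !big_split /= !delta_sum.
- rewrite /w; under eq_bigr do rewrite !scalerDl.
  by rewrite !big_split /= !delta_sumv.
- by rewrite /w eqxx mul1r -addrA ltr_wpDr // addr_ge0 // mulr_ge0.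
Qed.

Lemma carrier_edge s t a b k : s \in K -> t \in K -> a \in s -> b \in s ->
  0 < k < 1 -> hull t ((1 - k) *: a + k *: b) -> a \in t /\ b \in t.
Proof.
move=> sK tK sa sb /andP[k0 k1] h; split.
  apply: (@carrier_comb s t a b b (1 - k) k 0) => //.
  - by rewrite subr_gt0.
  - exact: ltW.
  - by rewrite addr0 subrK.
  - by rewrite scale0r addr0.
apply: (@carrier_comb s t b a a k (1 - k) 0) => //.
- by rewrite subr_ge0 ltW.
- by rewrite addr0 addrC subrK.
- by rewrite scale0r addr0 addrC.
Qed.

Lemma carrier_vertex s t a : s \in K -> t \in K -> a \in s -> hull t a -> a \in t.
Proof.
move=> sK tK sa ha; apply: (@carrier_comb s t a a a 1 0 0) => //.
  by rewrite !addr0.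
by rewrite !scale0r !addr0 scale1r.
Qed.

Lemma no_relation s a b c d (ka kb kc kd : R) : s \in K ->
  uniq [:: a; b; c; d] -> {subset [:: a; b; c; d] <= s} ->
  ka + kb + kc + kd = 0 ->
  ka *: a + kb *: b + kc *: c + kd *: d = 0 -> ka = 0.
Proof.
move=> sK u sub e1 e2.
have [sa sb sc sd] : [/\ a \in s, b \in s, c \in s & d \in s].
  by split; apply: sub; rewrite !inE eqxx ?orbT.
case: KC => K1 _ _; have [_ indep] := K1 s sK.
have := indep (fun p => (p == a)%:R * ka + (p == b)%:R * kb +
  (p == c)%:R * kc + (p == d)%:R * kd) _ _ a sa.
rewrite !big_split /= !delta_sum // => /(_ e1).
under eq_bigr do rewrite !scalerDl.
rewrite !big_split /= !delta_sumv // => /(_ e2).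
move: u; rewrite /= !inE !negb_or => /and3P[/and3P[/negbTE-> /negbTE-> /negbTE->]] _ _.
by rewrite eqxx mul1r !mul0r !addr0.
Qed.

Lemma no_relation3 s a b c (ka kb kc : R) : s \in K ->
  uniq [:: a; b; c] -> {subset [:: a; b; c] <= s} ->
  ka + kb + kc = 0 -> ka *: a + kb *: b + kc *: c = 0 -> ka = 0.
Proof.
move=> sK u sub e1 e2.
have [sa sb sc] : [/\ a \in s, b \in s & c \in s].
  by split; apply: sub; rewrite !inE eqxx ?orbT.
case: KC => K1 _ _; have [_ indep] := K1 s sK.
have := indep (fun p => (p == a)%:R * ka + (p == b)%:R * kb +
  (p == c)%:R * kc) _ _ a sa.
rewrite !big_split /= !delta_sum // => /(_ e1).
under eq_bigr do rewrite !scalerDl.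
rewrite !big_split /= !delta_sumv // => /(_ e2).
move: u; rewrite /= !inE !negb_or => /and3P[/andP[/negbTE-> /negbTE->]] _ _.
by rewrite eqxx mul1r !mul0r !addr0.
Qed.

Lemma area_neq0 s a b c : s \in K -> uniq [:: a; b; c] ->
  {subset [:: a; b; c] <= s} -> area a b c != 0.
Proof.
move=> sK u sub; apply/eqP => ar.
have ub : uniq [:: b; a; c].
  by move: u; rewrite /= !inE !negb_or (eq_sym b a) => /and3P[/andP[-> ->] ->].
have uc : uniq [:: c; a; b].
  move: u; rewrite /= !inE !negb_or (eq_sym c a) (eq_sym c b).
  by move=> /and3P[/andP[-> ->] ->].
have subb : {subset [:: b; a; c] <= s}.
  by move=> p; rewrite !inE => h; apply: sub; rewrite !inE; case/or3P: h => ->; rewrite ?orbT.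
(* Collinear points satisfy the affine relations whose coefficients are the differences of their
   abscissae, or of their ordinates. *)
have [ab ac] : (b.1 - c.1 = 0) /\ (b.2 - c.2 = 0).
  split.
    apply: (@no_relation3 s a b c (b.1 - c.1) (c.1 - a.1) (a.1 - b.1)) => //.
      by lra.
    by apply: plane_eq; rewrite !planeE /=; move: ar; rewrite /area; lra.
  apply: (@no_relation3 s a b c (b.2 - c.2) (c.2 - a.2) (a.2 - b.2)) => //.
    by lra.
  by apply: plane_eq; rewrite !planeE /=; move: ar; rewrite /area; lra.
move: u; rewrite /= !inE !negb_or => /and3P[_ /eqP bc _]; case: bc.
by apply: plane_eq; lra.
Qed.

(** Repeated vertices stand for lower dimensions. Four points of the plane satisfy the affine
    relation whose coefficients are the signed areas of the opposite triangles, against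
    independence. *)
Lemma simplex_size s : s \in K -> exists a b c, s = [fset a; b; c]%fset.
Proof.
move=> sK; case E : (enum_fset s) => [|a [|b [|c [|d l]]]].
- case: KC => K1 _ _; have [/fset0Pn[p ps] _] := K1 s sK.
  by move: ps; rewrite -[p \in s]/(p \in enum_fset s) E.
- exists a, a, a; apply/fsetP => p.
  by rewrite -[p \in s]/(p \in enum_fset s) E !inE !orbb.
- exists a, b, b; apply/fsetP => p.
  by rewrite -[p \in s]/(p \in enum_fset s) E !inE -orbA orbb.
- exists a, b, c; apply/fsetP => p.
  by rewrite -[p \in s]/(p \in enum_fset s) E !inE -orbA.
exfalso; have us : uniq [:: a, b, c, d & l] by rewrite -E fset_uniq.
have sub : {subset [:: a; b; c; d] <= s}.
  move=> p; rewrite -[p \in s]/(p \in enum_fset s) E !inE.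
  by move=> /or4P[] ->; rewrite ?orbT.
have u : uniq [:: a; b; c; d].
  by have := us; rewrite -[a :: _]/([:: a; b; c; d] ++ l) cat_uniq => /and3P[].
have : area b c d = 0.
  apply: (@no_relation s a b c d (area b c d) (- area a c d) (area a b d)
    (- area a b c)) => //.
    by rewrite /area; ring.
  by apply: plane_eq; rewrite !planeE /area /=; ring.
apply/eqP; apply: (area_neq0 sK); first by case/andP: u.
by move=> p hp; apply: sub; rewrite inE hp orbT.
Qed.

(** The hulls are closed and finite in number, so those that miss [z] stay away from it. After a
    small move from [z] one is only in simplices that contain [z]. *)
Lemma near_simplices z :
  \forall p \near z, forall s, s \in K -> hull s p -> hull s z.
Proof.
apply: (@near_all_seq R _ z (enum_fset K) (fun s p => hull s p -> hull s z)).
move=> s _; have [h|h] := pselect (hull s z); first by near=> p.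
have : nbhs z (~` hull s).
  by apply: open_nbhs_nbhs; split=> //; rewrite openC; apply: hull_closed.
by apply: filterS => p /[apply].
Unshelve. all: by end_near. Qed.

Lemma exists_maximal s : s \in K -> exists2 t, (t \in K) && fsubset s t &
  forall u, u \in K -> fsubset t u -> u = t.
Proof.
move=> sK; pose P (t : K) := fsubset s (val t).
have P0 : P [` sK]%fset by apply: fsubset_refl.
case: (arg_maxnP (fun t : K => #|` val t|) P0) => t Pt tmax.
exists (val t); first by rewrite (valP t).
move=> u uK tu; apply/esym/eqP; rewrite eqEfcard tu /=.
by apply: (tmax [` uK]%fset); apply: fsubset_trans tu.
Qed.

Definition triangle a b c := ([fset a; b; c]%fset \in K) && (0 < area a b c).

Hypothesis KD : topological_disk (realization K).

(** Purity of a triangulated disk: near the midpoint of a maximal simplex with at most two vertices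
    the disk would be a point or a segment, so the midpoint would be isolated or would cut it
    locally. *)
Lemma tri_cover s : s \in K -> exists a b c,
  triangle a b c /\ fsubset s [fset a; b; c]%fset.
Proof.
move=> sK; have [t /andP[tK st] tmax] := exists_maximal sK.
have [a [b [c te]]] := simplex_size tK.
have real p : hull t p -> realization K p by exists t.
have two p q : t = [fset p; q]%fset -> False.
  move=> tpq; pose z := (1 - 2%:R^-1) *: p + 2%:R^-1 *: q.
  have half : 0 < (2%:R^-1 : R) < 1 by rewrite invr_gt0 ltr0n /= invf_lt1 ?ltr1n ?ltr0n.
  have pt : p \in t by rewrite tpq !inE eqxx.
  have qt : q \in t by rewrite tpq !inE eqxx orbT.
  have zt : hull t z.
    apply: hull_convex; [exact: mem_hull|exact: mem_hull|].
    by case/andP: half => ? ?; rewrite !ltW.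
  have nz : \forall r \near z, realization K r -> hull t r.
    have := near_simplices z; apply: filterS => r H [u uK ur].
    have [pu qu] := carrier_edge tK uK pt qt half (H u uK ur).
    rewrite -(tmax u uK) //; apply/fsubsetP => x; rewrite tpq.
    by move=> /fset2P[] ->.
  have [pq|pq] := eqVneq p q.
    apply: (@disk_not_isolated R (realization K) z) => //; first exact: real.
    apply: filterS nz => r H /H; rewrite tpq pq => /hull2[k _ ->].
    by rewrite /z pq -!scalerDl !subrK.
  pose phi (r : plane R) := (r.1 - z.1) * (q.1 - p.1) + (r.2 - z.2) * (q.2 - p.2).
  have n0 : 0 < (q.1 - p.1) ^+ 2 + (q.2 - p.2) ^+ 2.
    rewrite lt0r addr_ge0 ?sqr_ge0 // andbT paddr_eq0 ?sqr_ge0 //.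
    rewrite !sqrf_eq0 !subr_eq0; apply/negP => /andP[/eqP h1 /eqP h2].
    by case/eqP: pq; apply: plane_eq.
  have phiE k : phi (z + k *: (q - p)) = k * ((q.1 - p.1) ^+ 2 + (q.2 - p.2) ^+ 2).
    by rewrite /phi !planeE /=; ring.
  apply: (@disk_no_cut R (realization K) z phi) => //.
  - exact: real.
  - move=> r; apply: cvgD; apply: cvgMl; apply: cvgB; try exact: cvg_cst.
      exact: cvg_fst.
    exact: cvg_snd.
  - by rewrite /phi !subrr !mul0r addr0.
  - apply: filterS nz => r H /H; rewrite tpq => /hull2[k _ ->].
    have -> : (1 - k) *: p + k *: q = z + (k - 2%:R^-1) *: (q - p).
      by apply: plane_eq; rewrite /z !planeE /=; ring.
    rewrite phiE => /eqP; rewrite mulf_eq0 (gt_eqF n0) orbF => /eqP ->.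
    by rewrite scale0r addr0.
  move=> P HP; have [t1 t10 H1] := near_dir (q - p) HP.
  have [t2 t20 H2] := near_dir (p - q) HP.
  pose k := Num.min (2%:R^-1) (Num.min t1 t2).
  have k0 : 0 < k by rewrite !lt_min t10 t20 invr_gt0 ltr0n.
  have kh : k <= 2%:R^-1 by rewrite ge_min lexx.
  have k1 : k <= t1 by rewrite !ge_min lexx orbT.
  have k2 : k <= t2 by rewrite !ge_min lexx !orbT.
  have hh l : `|l| <= k -> hull t (z + l *: (q - p)).
    move=> lk; have -> : z + l *: (q - p) =
        (1 - (2%:R^-1 + l)) *: p + (2%:R^-1 + l) *: q.
      by apply: plane_eq; rewrite /z !planeE /=; ring.
    apply: hull_convex; [exact: mem_hull|exact: mem_hull|].
    move: lk; rewrite ler_norml; lra.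
  exists (z + (- k) *: (q - p)), (z + k *: (q - p)); split.
  - by split; apply: real; apply: hh; rewrite ?normrN ger0_norm // ltW.
  - by rewrite scaleNr -scalerN opprB; apply: H2; rewrite ltW.
  - by apply: H1; rewrite ltW.
  - by rewrite !phiE mulNr oppr_lt0 !mulr_gt0.
have [ab|ab] := eqVneq a b.
  by case: (two a c); rewrite te ab fsetUid.
have [ac|ac] := eqVneq a c.
  case: (two a b); rewrite te -ac; apply/fsetP => p; rewrite !inE.
  by case: (p == a); case: (p == b).
have [bc|bc] := eqVneq b c.
  by case: (two a b); rewrite te -bc -fsetUA fsetUid.
have u : uniq [:: a; b; c] by rewrite /= !inE !negb_or ab ac bc.
have sub : {subset [:: a; b; c] <= t}.
  by move=> p; rewrite te !inE => /or3P[] ->; rewrite ?orbT.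
have := area_neq0 tK u sub; rewrite neq_lt => /orP[ar|ar]; last first.
  by exists a, b, c; rewrite /triangle -te tK ar.
exists b, a, c; rewrite /triangle.
have -> : [fset b; a; c]%fset = t by rewrite te [[fset b; a]%fset]fsetUC.
by rewrite tK area_swap oppr_gt0.
Qed.

End Complex.

(** * Adjacent triangles and boundary edges *)

Section Disk.
Variables (R : realType) (K : {fset {fset plane R}}).
Hypothesis KC : simplicial_complex K.
Hypothesis KD : topological_disk (realization K).
Implicit Types (p q z d a b c : plane R) (s t : {fset plane R}) (k l : R).
Notation tri := (triangle K).
Notation real := (realization K).

Lemma near_area b c z : 0 < area z b c -> \forall p \near z, 0 < area p b c.
Proof.
move=> h; have C : (fun p => area p b c) @ z --> area z b c.
  rewrite /area; apply: cvgB; apply: cvgM; apply: cvgB;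
    try exact: cvg_cst; by [exact: cvg_fst|exact: cvg_snd].
exact: (cvgr_gt _ C).
Qed.

Lemma near_area2 a c z : 0 < area a z c -> \forall p \near z, 0 < area a p c.
Proof.
rewrite -area_rot => h; have := near_area h.
by apply: filterS => p; rewrite area_rot.
Qed.

Lemma near_area3 a b z : 0 < area a b z -> \forall p \near z, 0 < area a b p.
Proof.
rewrite (area_rot z a b) => h; have := near_area h.
by apply: filterS => p; rewrite (area_rot p a b).
Qed.

Lemma fset3_rot a b c : [fset b; c; a]%fset = [fset a; b; c]%fset.
Proof. by apply/fsetP => p; rewrite !inE orbC orbA. Qed.

Lemma tri_rotate a b c : tri a b c -> tri b c a.
Proof. by rewrite /triangle (fset3_rot a b c) (area_rot a b c). Qed.

Lemma tri_area a b c : tri a b c -> 0 < area a b c.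
Proof. by case/andP. Qed.

Lemma tri_in a b c : tri a b c -> [fset a; b; c]%fset \in K.
Proof. by case/andP. Qed.

Lemma tri_neq a b c : tri a b c -> [/\ a != b, b != c & a != c].
Proof.
move=> /tri_area abc; split; apply/eqP => e; move: abc; rewrite e /area; lra.
Qed.

Lemma tri_hull a b c p : tri a b c -> hull [fset a; b; c]%fset p <->
  [/\ 0 <= area p b c, 0 <= area a p c & 0 <= area a b p].
Proof. by move=> /tri_area /hull3_area. Qed.

Lemma tri_mem a b c p : p \in [fset a; b; c]%fset -> tri a b c ->
  exists q r, tri p q r /\ [fset p; q; r]%fset = [fset a; b; c]%fset.
Proof.
rewrite !inE -orbA => /or3P[]/eqP-> h.
- by exists b, c.
- by exists c, a; split; [exact: tri_rotate|exact: fset3_rot].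
- by exists a, b; split; [exact/tri_rotate/tri_rotate|exact/esym/fset3_rot].
Qed.

Lemma real_tri p : real p -> exists a b c, tri a b c /\ hull [fset a; b; c]%fset p.
Proof.
move=> [s sK sp]; have [a [b [c [t sub]]]] := tri_cover KC KD sK.
by exists a, b, c; split=> //; apply: hull_sub sp.
Qed.

Lemma tri_real a b c p : tri a b c -> hull [fset a; b; c]%fset p -> real p.
Proof. by move=> /tri_in h hp; exists [fset a; b; c]%fset. Qed.

Lemma tri_carrier a b c p t : tri a b c -> t \in K -> hull t p ->
  hull [fset a; b; c]%fset p -> 0 < area p b c -> a \in t.
Proof.
move=> T tK tp /(tri_hull _ T)[h1 h2 h3] h4; have D := tri_area T; have D' := ltW D.
apply: (carrier_comb KC (s := [fset a; b; c]%fset) (b := b) (c := c)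
  (ka := area p b c / area a b c) (kb := area a p c / area a b c)
  (kc := area a b p / area a b c)) => //;
  rewrite ?(tri_in T) ?inE ?eqxx ?orbT ?divr_gt0 ?divr_ge0 //.
  by rewrite -!mulrDl area_sum divff // gt_eqF.
by rewrite -barycentric // gt_eqF.
Qed.

Lemma vertex_tri s q : s \in K -> hull s q -> [fset q]%fset \in K ->
  exists a b, tri q a b /\ fsubset s [fset q; a; b]%fset.
Proof.
move=> sK sq qK; have [a [b [c [T sub]]]] := tri_cover KC KD sK.
have qs : q \in s by apply: (carrier_vertex KC qK sK); rewrite ?inE.
have [u [v [T' e]]] := tri_mem (fsubsetP sub q qs) T.
by exists u, v; rewrite e.
Qed.

Lemma vertexK s q : s \in K -> q \in s -> [fset q]%fset \in K.
Proof.
move=> sK qs; case: KC => _ H _; apply: (H s) => //; last by rewrite fsub1set.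
by apply/fset0Pn; exists q; rewrite inE.
Qed.

Definition mid a b k := (1 - k) *: a + k *: b.

Lemma mid_id a k : mid a a k = a.
Proof. by apply: plane_eq; rewrite /mid !planeE; ring. Qed.

Lemma area_mid a b k c : area (mid a b k) b c = (1 - k) * area a b c.
Proof. rewrite /area /mid !planeE; ring. Qed.

Lemma area_mid2 a b k c : area a (mid a b k) c = k * area a b c.
Proof. rewrite /area /mid !planeE; ring. Qed.

(** Both triangles lie to the left of [a b], so a point of the first, moved slightly from the
    midpoint of [a b] towards [c], is in the second as well; [c] has positive weight in it. *)
Lemma tri_opposite a b c d : tri a b c -> tri a b d -> c = d.
Proof.
move=> T T'; pose z := mid a b 2%:R^-1.
have [D D'] := (tri_area T, tri_area T').
have n1 : \forall p \near z, 0 < area p b d.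
  by apply: near_area; rewrite area_mid mulr_gt0 //; lra.
have n2 : \forall p \near z, 0 < area a p d.
  by apply: near_area2; rewrite area_mid2 mulr_gt0 //; lra.
have [t0 t00 H] := near_dir (c - z) (filterI n1 n2).
pose t := Num.min t0 2%:R^-1.
have t_gt0 : 0 < t by rewrite lt_min t00 invr_gt0 ltr0n.
have tle : 0 <= t <= t0 by rewrite ltW //= ge_min lexx.
have th : t <= 2%:R^-1 by rewrite ge_min lexx orbT.
have [h1 h2] := H t tle; set p := z + t *: (c - z) in h1 h2.
have e1 : area p b c = (1 - t) / 2%:R * area a b c.
  by rewrite /area /p /z /mid !planeE; field.
have e2 : area a p c = (1 - t) / 2%:R * area a b c.
  by rewrite /area /p /z /mid !planeE; field.
have e3 x : area a b (z + t *: (x - z)) = t * area a b x.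
  by rewrite /area /z /mid !planeE; field.
have pT : hull [fset a; b; c]%fset p.
  by apply/(tri_hull _ T); rewrite e1 e2 e3; split; rewrite mulr_ge0 //; lra.
have pT' : hull [fset a; b; d]%fset p.
  apply/(tri_hull _ T'); rewrite e3; split; [exact: ltW|exact: ltW|].
  by rewrite mulr_ge0 // ltW.
have pT2 : hull [fset c; a; b]%fset p by rewrite -(fset3_rot c a b).
have := tri_carrier (tri_rotate (tri_rotate T)) (tri_in T') pT' pT2.
rewrite -(area_rot p) e3 mulr_gt0 // => /(_ isT).
have [_ bc ac] := tri_neq T.
by rewrite !inE eq_sym (negbTE ac) eq_sym (negbTE bc) => /eqP.
Qed.

(** Move from the inner point to the left of the edge, along the normal [n]: the triangle reached
    still contains the edge, and the side determines its orientation. *)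
Lemma edge_tri s a b k : s \in K -> a \in s -> b \in s -> a != b -> 0 < k < 1 ->
  interior real (mid a b k) -> exists c, tri a b c.
Proof.
move=> sK sa sb ab k01 iz; set z := mid a b k in iz.
pose n : plane R := (- (b.2 - a.2), b.1 - a.1).
have [t t0 H] := near_dir n (filterI iz (near_simplices K z)).
have [|rp Hp] := H t; first by rewrite lexx ltW.
set p := z + t *: n in rp Hp.
have [x [y [w [T Tp]]]] := real_tri rp.
have [xa xb] := carrier_edge KC sK (tri_in T) sa sb k01 (Hp _ (tri_in T) Tp).
have [u [v [T' e]]] := tri_mem xa T.
move: xb Tp; rewrite -e !inE eq_sym (negbTE ab) /= => /orP[]/eqP eb; last first.
  rewrite -eb in T' *; move=> /(tri_hull _ T')[_ + _].
  have -> : area a p b = - (t * ((b.1 - a.1) ^+ 2 + (b.2 - a.2) ^+ 2)).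
    by rewrite /area /p /z /mid !planeE /=; ring.
  rewrite oppr_ge0 pmulr_rle0 // => h.
  have : (b.1 - a.1) ^+ 2 + (b.2 - a.2) ^+ 2 = 0.
    by apply/eqP; rewrite eq_le h addr_ge0 ?sqr_ge0.
  move/eqP; rewrite paddr_eq0 ?sqr_ge0 // !sqrf_eq0 !subr_eq0 => /andP[/eqP e1 /eqP e2].
  by case/eqP: ab; apply: plane_eq.
by exists v; rewrite eb.
Qed.

Lemma edge_interior a b c d k : tri a b c -> tri b a d -> 0 < k < 1 ->
  interior real (mid a b k).
Proof.
move=> T T' /andP[k0 k1]; set z := mid a b k.
have [D D'] := (tri_area T, tri_area T').
have n1 : \forall p \near z, 0 < area p b c.
  by apply: near_area; rewrite area_mid mulr_gt0 //; lra.
have n2 : \forall p \near z, 0 < area a p c.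
  by apply: near_area2; rewrite area_mid2 mulr_gt0 //; lra.
have z' : z = mid b a (1 - k) by rewrite /z /mid subKr addrC.
have n3 : \forall p \near z, 0 < area p a d.
  by apply: near_area; rewrite z' area_mid mulr_gt0 //; lra.
have n4 : \forall p \near z, 0 < area b p d.
  by apply: near_area2; rewrite z' area_mid2 mulr_gt0 //; lra.
apply: filterS (filterI (filterI n1 n2) (filterI n3 n4)) => p [[h1 h2] [h3 h4]].
have [h|h] := lerP 0 (area a b p).
  by apply: (tri_real T); apply/(tri_hull _ T); split=> //; apply: ltW.
apply: (tri_real T'); apply/(tri_hull _ T'); split; try exact: ltW.
by rewrite area_swap oppr_ge0 ltW.
Qed.

Lemma tri_interior a b c p : tri a b c -> 0 < area p b c -> 0 < area a p c ->
  0 < area a b p -> interior real p.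
Proof.
move=> T h1 h2 h3.
apply: filterS (filterI (near_area h1) (filterI (near_area2 h2) (near_area3 h3))).
move=> q [g1 [g2 g3]]; apply: (tri_real T); apply/(tri_hull _ T).
by split; apply: ltW.
Qed.

(** The ray from [q] in the direction [(0, e)] starts in a simplex that contains [q]; the sign of
    [e] selects the upper or the lower ray. *)
Lemma vertical_tri q (e : R) : [fset q]%fset \in K -> interior real q ->
  e != 0 -> exists a b, [/\ tri q a b, 0 <= e * (a.1 - q.1) & e * (b.1 - q.1) <= 0].
Proof.
move=> qK iq e0; pose n : plane R := (0, e).
have [t t0 H] := near_dir n (filterI iq (near_simplices K q)).
have [|[s sK sp] Hp] := H t; first by rewrite lexx ltW.
have [a [b [T sub]]] := vertex_tri sK (Hp s sK sp) qK.
have /(tri_hull _ T)[_ h2 h3] := hull_sub sub sp.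
exists a, b; split=> //.
  rewrite -(pmulr_rge0 _ t0); apply: le_trans h3 _; rewrite le_eqVlt; apply/orP; left.
  by apply/eqP; rewrite /area !planeE /=; ring.
rewrite -(pmulr_rle0 _ t0) -oppr_ge0; apply: le_trans h2 _; rewrite le_eqVlt.
by apply/orP; left; apply/eqP; rewrite /area !planeE /=; ring.
Qed.

(** A point of the ray close to [q] is in both triangles, so a vertex of the first with positive
    weight belongs to the second; the weight of [a] or [b] vanishes only if the ray runs along an
    edge. *)
Lemma vertical_tri_uniq q a b a' b' (e : R) : e != 0 ->
  tri q a b -> tri q a' b' ->
  0 <= e * (a.1 - q.1) -> e * (b.1 - q.1) <= 0 ->
  0 <= e * (a'.1 - q.1) -> e * (b'.1 - q.1) <= 0 ->
  [\/ a = a' /\ b = b', a = b' /\ a.1 = q.1 | b = a' /\ b.1 = q.1].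
Proof.
move=> e0 T T' ha hb ha' hb'; pose n : plane R := (0, e).
have [t t0 H] := near_dir n (filterI (near_area (tri_area T)) (near_area (tri_area T'))).
have [|h h'] := H t; first by rewrite lexx ltW.
set p := q + t *: n in h h'.
have E1 u : area q u p = t * (e * (u.1 - q.1)) by rewrite /area /p !planeE /=; ring.
have E2 u : area q p u = t * - (e * (u.1 - q.1)) by rewrite /area /p !planeE /=; ring.
have pT : hull [fset q; a; b]%fset p.
  apply/(tri_hull _ T); rewrite E1 E2; split; first exact: ltW.
    by rewrite mulr_ge0 ?oppr_ge0 // ltW.
  by rewrite mulr_ge0 // ltW.
have pT' : hull [fset q; a'; b']%fset p.
  apply/(tri_hull _ T'); rewrite E1 E2; split; first exact: ltW.
    by rewrite mulr_ge0 ?oppr_ge0 // ltW.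
  by rewrite mulr_ge0 // ltW.
have [qa ab qb] := tri_neq T.
have aT : b.1 != q.1 -> (a == a') || (a == b').
  move=> bq; have pT2 : hull [fset a; b; q]%fset p by rewrite (fset3_rot q a b).
  have := tri_carrier (tri_rotate T) (tri_in T') pT' pT2; rewrite -2!area_rot E2 => /(_ _).
  rewrite !inE (eq_sym a q) (negbTE qa) /=; apply; rewrite mulr_gt0 // oppr_gt0.
  by rewrite lt_neqAle hb mulf_neq0 // subr_eq0.
have bT : a.1 != q.1 -> (b == a') || (b == b').
  move=> aq; have pT2 : hull [fset b; q; a]%fset p by rewrite -(fset3_rot b q a).
  have := tri_carrier (tri_rotate (tri_rotate T)) (tri_in T') pT' pT2; rewrite -area_rot E1 => /(_ _).
  rewrite !inE (eq_sym b q) (negbTE qb) /=; apply; rewrite mulr_gt0 //.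
  by rewrite lt_neqAle ha eq_sym mulf_neq0 // subr_eq0.
have aa : a = a' -> b = b' by move=> ea; rewrite -ea in T'; apply: tri_opposite T T'.
have bb : b = b' -> a = a'.
  move=> eb; rewrite -eb in T'.
  exact: tri_opposite (tri_rotate (tri_rotate T)) (tri_rotate (tri_rotate T')).
have [aq|aq] := eqVneq a.1 q.1.
  have bq : b.1 != q.1.
    by apply/eqP => bq; have := tri_area T; rewrite /area aq bq !subrr mul0r mulr0 subrr ltxx.
  have /orP[/eqP ea|/eqP ea] := aT bq; first by constructor 1; split; [|exact: aa].
  by constructor 2.
have /orP[/eqP eb|/eqP eb] := bT aq; last by constructor 1; split; [exact: bb|].
have [bq|bq] := eqVneq b.1 q.1; first by constructor 3.
have /orP[/eqP ea|/eqP ea] := aT bq; first by constructor 1; split; [|exact: aa].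
have := tri_area T'; have := tri_area T; rewrite -ea -eb.
by rewrite -[area q b a]area_rot -[area b a q]area_rot area_swap; lra.
Qed.

Lemma real_closed : closed real.
Proof.
move=> p cp; apply: contrapT => np.
have : \forall q \near p, ~ real q.
  by apply: filterS (near_simplices K p) => q H [s sK sq]; apply: np; exists s => //; apply: H.
by move=> /cp[q [rq]].
Qed.

Lemma bdP p : bd K p <-> real p /\ ~ interior real p.
Proof.
rewrite /bd /boundary; split=> -[h1 h2]; split=> //.
  by apply: real_closed.
exact: subset_closure.
Qed.

Lemma not_bd p : real p -> ~ bd K p -> interior real p.
Proof. by move=> rp nb; apply: contrapT => ni; apply/nb/bdP. Qed.

(** If a point of the closed edge were interior, so would be an inner point of the edge close to it;
    then there is a triangle on each side, and all inner points are interior. *)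
Lemma edge_bd s a b k l : s \in K -> a \in s -> b \in s -> 0 < k < 1 ->
  0 <= l <= 1 -> bd K (mid a b k) -> bd K (mid a b l).
Proof.
move=> sK sa sb k01 l01 bz; have [e|ab] := eqVneq a b.
  by move: bz; rewrite e !mid_id.
apply: contrapT => nb; have ry : real (mid a b l).
  by exists s => //; apply: hull_convex => //; exact: mem_hull.
have iy := not_bd ry nb.
have [t0 t00 H] := near_dir (mid a b k - mid a b l) (nbhs_interior iy).
pose t := Num.min t0 2%:R^-1.
have t_gt0 : 0 < t by rewrite lt_min t00 invr_gt0 ltr0n.
have tle : 0 <= t <= t0 by rewrite ltW //= ge_min lexx.
have th : t <= 2%:R^-1 by rewrite ge_min lexx orbT.
have := H t tle; have -> : mid a b l + t *: (mid a b k - mid a b l) =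
    mid a b ((1 - t) * l + t * k).
  by apply: plane_eq; rewrite /mid !planeE /=; ring.
have m01 : 0 < (1 - t) * l + t * k < 1.
  case/andP: k01 => k0 k1; case/andP: l01 => l0 l1.
  have : 0 < t * k by rewrite mulr_gt0.
  have : t * k < t by rewrite gtr_pMr.
  have : 0 <= (1 - t) * l by rewrite mulr_ge0 //; lra.
  have : (1 - t) * l <= 1 - t by rewrite ger_pMr //; lra.
  lra.
move=> im; have [c Tc] := edge_tri sK sa sb ab m01 im.
have ba : b != a by rewrite eq_sym.
have m01' : 0 < 1 - ((1 - t) * l + t * k) < 1 by lra.
have im' : interior real (mid b a (1 - ((1 - t) * l + t * k))).
  by rewrite /mid subKr addrC.
have [d Td] := edge_tri sK sb sa ba m01' im'.
by move/bdP: bz => [_]; apply; apply: edge_interior Tc Td k01.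
Qed.

(** In a triangle that contains it, a boundary point has a vanishing area coordinate, so it is on an
    edge; at an inner point of the edge, [edge_bd] yields the whole edge. The case [a = b] stands
    for a vertex. *)
Lemma bd_face z : bd K z -> exists s a b k,
  [/\ s \in K, a \in s, b \in s, 0 <= k <= 1 & z = mid a b k] /\
  (forall l, 0 <= l <= 1 -> bd K (mid a b l)).
Proof.
move=> bz; have [rz nz] := (bdP z).1 bz.
have [a [b [c [T /(tri_hull _ T) [h1 h2 h3]]]]] := real_tri rz.
have main u v w : tri u v w -> area z v w = 0 -> 0 <= area u z w ->
    0 <= area u v z -> exists s a b k,
    [/\ s \in K, a \in s, b \in s, 0 <= k <= 1 & z = mid a b k] /\
    (forall l, 0 <= l <= 1 -> bd K (mid a b l)).
  move=> T' e1 e2 e3; have D := tri_area T'.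
  have sv : v \in [fset u; v; w]%fset by rewrite !inE eqxx orbT.
  have sw : w \in [fset u; v; w]%fset by rewrite !inE eqxx orbT.
  pose k := area u v z / area u v w.
  have k0 : 0 <= k by rewrite divr_ge0 // ltW.
  have k1 : k <= 1.
    by rewrite ler_pdivrMr // mul1r -(area_sum u v w z) e1 add0r lerDr.
  have zk : z = mid v w k.
    rewrite {1}[z](@barycentric _ u v w) ?gt_eqF // e1 mul0r scale0r add0r.
    congr (_ *: _ + _); rewrite /k -[1](@divff _ (area u v w)) ?gt_eqF // -mulrBl.
    by rewrite -(area_sum u v w z) e1 add0r addrK.
  have vert x : bd K x -> x \in [fset u; v; w]%fset -> z = x -> exists s a b k,
      [/\ s \in K, a \in s, b \in s, 0 <= k <= 1 & z = mid a b k] /\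
      (forall l, 0 <= l <= 1 -> bd K (mid a b l)).
    move=> bx xs ->; exists [fset u; v; w]%fset, x, x, 0.
    by rewrite (tri_in T') lexx ler01 mid_id; split=> // l; rewrite mid_id.
  have [kz|kn0] := eqVneq k 0.
    have zv : z = v by rewrite zk kz /mid subr0 scale1r scale0r addr0.
    by apply: (vert v) => //; rewrite -zv.
  have [ko|kn1] := eqVneq k 1.
    have zw : z = w by rewrite zk ko /mid subrr scale1r scale0r add0r.
    by apply: (vert w) => //; rewrite -zw.
  exists [fset u; v; w]%fset, v, w, k; split.
    by rewrite (tri_in T') k0 k1.
  move=> l l01; apply: (edge_bd (k := k) (tri_in T') sv sw _ l01); last by rewrite -zk.
  by rewrite !lt_neqAle k0 k1 eq_sym kn0 kn1.
have [z1|/eqP n1] := eqVneq (area z b c) 0; first exact: main T z1 h2 h3.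
have [z2|/eqP n2] := eqVneq (area a z c) 0.
  apply: (main b c a (tri_rotate T)); first by rewrite -2!area_rot.
    by rewrite area_rot.
  by rewrite area_rot.
have [z3|/eqP n3] := eqVneq (area a b z) 0.
  apply: (main c a b (tri_rotate (tri_rotate T))); first by rewrite -area_rot.
    by rewrite -area_rot.
  by rewrite -area_rot.
case: nz; apply: (tri_interior T); rewrite lt_neqAle eq_sym.
- by rewrite h1 andbT; apply/eqP.
- by rewrite h2 andbT; apply/eqP.
- by rewrite h3 andbT; apply/eqP.
Qed.

End Disk.

(** * The abstract triangulation carried by the vertices *)

Section Vertices.
Variables (R : realType) (K : {fset {fset plane R}}).
Hypothesis KC : simplicial_complex K.
Hypothesis KD : topological_disk (realization K).

Definition vertices : {fset plane R} := (\bigcup_(s <- K) s)%fset.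

Lemma mem_vertices s p : s \in K -> p \in s -> p \in vertices.
Proof. by move=> sK ps; apply/bigfcupP; exists s; rewrite ?sK. Qed.

Lemma verticesK p : p \in vertices -> [fset p]%fset \in K.
Proof. by move=> /bigfcupP[s]; rewrite andbT => sK ps; apply: vertexK KC _ _ sK ps. Qed.

Definition vx (i : vertices) : R := (val i).1.
Definition vy (i : vertices) : R := (val i).2.
Definition vtri (i j k : vertices) := triangle K (val i) (val j) (val k).
Definition vinn (i : vertices) : bool := `[< interior (realization K) (val i) >].

Lemma tri_vertices a b c : triangle K a b c -> [/\ a \in vertices, b \in vertices & c \in vertices].
Proof.
by move=> /tri_in h; split; apply: (mem_vertices h); rewrite !inE eqxx ?orbT.
Qed.

(** As [q] is interior, so are the points close to it on an edge at [q], and [edge_tri] provides the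
    triangle on the other side of that edge. *)
Lemma vertices_triangulated : triangulated vx vy vtri vinn.
Proof.
have next q a b : vinn q -> vtri q a b -> exists c, vtri q b c.
  move=> /asboolP iq T; have [t0 t00 H] := near_dir (val b - val q) (nbhs_interior iq).
  pose t := Num.min t0 2%:R^-1.
  have t_gt0 : 0 < t by rewrite lt_min t00 invr_gt0 ltr0n.
  have tle : 0 <= t <= t0 by rewrite ltW //= ge_min lexx.
  have th : t <= 2%:R^-1 by rewrite ge_min lexx orbT.
  have im : interior (realization K) (mid (val q) (val b) t).
    have -> : mid (val q) (val b) t = val q + t *: (val b - val q).
      by apply: plane_eq; rewrite /mid !planeE; ring.
    exact: H.
  have [_ _ qb] := tri_neq T.
  have qT : val q \in [fset val q; val a; val b]%fset by rewrite !inE eqxx.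
  have bT : val b \in [fset val q; val a; val b]%fset by rewrite !inE eqxx orbT.
  have t01 : 0 < t < 1 by lra.
  have [c Tc] := edge_tri KC KD (tri_in T) qT bT qb t01 im.
  have [_ _ cV] := tri_vertices Tc.
  by exists [` cV]%fset.
have prev q a b : vinn q -> vtri q a b -> exists c, vtri q c a.
  move=> /asboolP iq T; have [t0 t00 H] := near_dir (val a - val q) (nbhs_interior iq).
  pose t := Num.min t0 2%:R^-1.
  have t_gt0 : 0 < t by rewrite lt_min t00 invr_gt0 ltr0n.
  have tle : 0 <= t <= t0 by rewrite ltW //= ge_min lexx.
  have th : t <= 2%:R^-1 by rewrite ge_min lexx orbT.
  have im : interior (realization K) (mid (val a) (val q) (1 - t)).
    have -> : mid (val a) (val q) (1 - t) = val q + t *: (val a - val q).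
      by apply: plane_eq; rewrite /mid !planeE; ring.
    exact: H.
  have [qa _ _] := tri_neq T; rewrite eq_sym in qa.
  have qT : val q \in [fset val q; val a; val b]%fset by rewrite !inE eqxx.
  have aT : val a \in [fset val q; val a; val b]%fset by rewrite !inE eqxx orbT.
  have t01 : 0 < 1 - t < 1 by lra.
  have [c Tc] := edge_tri KC KD (tri_in T) aT qT qa t01 im.
  have [_ _ cV] := tri_vertices Tc.
  by exists [` cV]%fset; apply: tri_rotate.
have vK (q : vertices) : [fset val q]%fset \in K by apply: verticesK; apply: valP.
split=> //.
- by move=> a b c; apply: tri_rotate.
- by move=> a b c /tri_area.
- by move=> a b c d T T'; apply: val_inj; apply: (tri_opposite KC T T').
- move=> q /asboolP iq.
  have [a [b [T ha hb]]] := vertical_tri KC KD (vK q) iq (oner_neq0 R).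
  have [_ aV bV] := tri_vertices T; exists [` aV]%fset, [` bV]%fset.
  by apply/andP; split=> //; rewrite /vx /=; move: ha hb; rewrite !mul1r; lra.
- move=> q /asboolP iq; have n1 : -1 != 0 :> R by rewrite oppr_eq0 oner_neq0.
  have [a [b [T ha hb]]] := vertical_tri KC KD (vK q) iq n1.
  have [_ aV bV] := tri_vertices T; exists [` aV]%fset, [` bV]%fset.
  by apply/andP; split=> //; rewrite /vx /=; move: ha hb; rewrite !mulN1r; lra.
- move=> q a b a' b' T T' /andP[h1 h2] /andP[h3 h4].
  have := vertical_tri_uniq KC (oner_neq0 R) T T'; rewrite !mul1r.
  rewrite !subr_ge0 !subr_le0 => /(_ h2 h1 h4 h3) [[e1 e2]|[e1 e2]|[e1 e2]].
  - by constructor 1; split; apply: val_inj.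
  - by constructor 2; split=> //; apply: val_inj.
  - by constructor 3; split=> //; apply: val_inj.
- move=> q a b a' b' T T' /andP[h1 h2] /andP[h3 h4].
  have n1 : -1 != 0 :> R by rewrite oppr_eq0 oner_neq0.
  have := vertical_tri_uniq KC n1 T T'; rewrite !mulN1r.
  rewrite !oppr_ge0 !oppr_le0 !subr_ge0 !subr_le0 => /(_ h1 h2 h3 h4) [[e1 e2]|[e1 e2]|[e1 e2]].
  - by constructor 1; split; apply: val_inj.
  - by constructor 2; split=> //; apply: val_inj.
  - by constructor 3; split=> //; apply: val_inj.
Qed.

End Vertices.

(** * Vertical slices and convexity *)

Section Planar.
Variable R : realType.
Implicit Types (A C D : set (plane R)) (p q z d : plane R) (k e x : R).

Lemma convex_setE D p q k : convex_set D -> D p -> D q -> 0 <= k <= 1 ->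
  D ((1 - k) *: p + k *: q).
Proof.
move=> DC Dp Dq /andP[k0 k1].
have := DC q p (Itv01 k0 k1); rewrite !inE => /(_ Dq Dp).
by rewrite addrC.
Qed.

(** Signs let the top and the bottom of slices, and the two possible orientations of [v], be treated
    together. *)
Definition sgn e := e = 1 \/ e = -1.

Lemma sgn_neq0 e : sgn e -> e != 0.
Proof. by case=> ->; rewrite ?oppr_eq0 oner_neq0. Qed.

Lemma sgn_sqr e : sgn e -> e * e = 1.
Proof. by case=> ->; ring. Qed.

Lemma sgnN e : sgn e -> sgn (- e).
Proof. by case=> ->; [right|left; rewrite opprK]. Qed.

Lemma continuous_snd_scale e : continuous (fun p : plane R => e * p.2 : R).
Proof. by move=> p; apply: cvgM; [exact: cvg_cst|exact: cvg_snd]. Qed.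

Lemma continuous_fst_scale e : continuous (fun p : plane R => e * p.1 : R).
Proof. by move=> p; apply: cvgM; [exact: cvg_cst|exact: cvg_fst]. Qed.

Lemma compact_extreme A (f : plane R -> R) : A !=set0 -> compact A ->
  continuous f -> exists2 t, A t & forall q, A q -> f q <= f t.
Proof.
move=> A0 Ac fc.
have [t tA tmax] := compact_EVT_max A0 Ac (continuous_subspaceT fc).
by exists t; [rewrite inE in tA|move=> q Aq; apply: tmax; rewrite inE].
Qed.

Lemma closed_fst c : closed [set p : plane R | p.1 = c].
Proof.
have -> : [set p : plane R | p.1 = c] = fst @^-1` [set c] by [].
apply: closed_comp; last exact: closed_eq.
by move=> p _; exact: cvg_fst.
Qed.

Lemma slice_extreme A e p : compact A -> A p ->
  exists2 t, A t /\ t.1 = p.1 & forall q, A q -> q.1 = p.1 -> e * q.2 <= e * t.2.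
Proof.
move=> Ac Ap; have [|||t [At tp] tmax] :=
    @compact_extreme (A `&` [set q | q.1 = p.1]) (fun q => e * q.2).
- by exists p.
- by apply: compact_closedI => //; exact: closed_fst.
- exact: continuous_snd_scale.
by exists t => // q Aq qp; apply: tmax.
Qed.

Lemma compact_boundary A p : compact A -> boundary A p <-> A p /\ ~ interior A p.
Proof.
move=> Ac; have Acl : closed A by apply: compact_closed => //; exact: norm_hausdorff.
rewrite /boundary; split=> -[h1 h2]; split=> //; last exact: subset_closure.
exact: Acl.
Qed.

Lemma not_interior A p d : (forall t, 0 < t -> ~ A (p + t *: d)) -> ~ interior A p.
Proof.
move=> H iA; have [t t0 /(_ t)] := near_dir d iA.
by rewrite lexx ltW // => /(_ isT); apply: H.
Qed.

Lemma extreme_boundary A e t : sgn e -> compact A -> A t ->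
  (forall q, A q -> q.1 = t.1 -> e * q.2 <= e * t.2) -> boundary A t.
Proof.
move=> se Ac At tmax; apply/(compact_boundary _ Ac); split=> //.
apply: (@not_interior _ _ (0, e)) => k k0 Ak.
have /(tmax _ Ak) : (t + k *: ((0, e) : plane R)).1 = t.1.
  by rewrite planeE scalep1 mulr0 addr0.
rewrite planeE scalep2 mulrDr mulrCA /= (sgn_sqr se) mulr1; lra.
Qed.

(* The point lies in the interior of the quadrilateral [L], [a], [r], [b]. *)
Lemma convex_interior D L r a b z : convex_set D -> D L -> D r -> D a -> D b ->
  a.1 = z.1 -> b.1 = z.1 -> L.1 < z.1 < r.1 -> a.2 < z.2 < b.2 -> interior D z.
Proof.
move=> DC DL Dr Da Db az bz /andP[Lz zr] /andP[za zb].
have slice y : a.2 <= y <= b.2 -> D (z.1, y).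
  move=> /andP[ay yb]; have ab : 0 < b.2 - a.2 by lra.
  pose k := (y - a.2) / (b.2 - a.2).
  have -> : (z.1, y) = (1 - k) *: a + k *: b.
    apply: plane_eq; rewrite !planeE /=; first by rewrite az bz; ring.
    by rewrite /k; field; rewrite gt_eqF.
  apply: convex_setE => //; rewrite divr_ge0 ?subr_ge0 //; last lra.
  by rewrite ler_pdivrMr // mul1r; lra.
(* [q] is on the segment from [m] to a point of the slice through [z] *)
have cone m q : D m -> m.1 != z.1 -> 0 <= (q.1 - z.1) / (m.1 - z.1) < 1 ->
    a.2 <= (q.2 - (q.1 - z.1) / (m.1 - z.1) * m.2) / (1 - (q.1 - z.1) / (m.1 - z.1)) <= b.2 ->
    D q.
  move=> Dm mz; rewrite -subr_eq0 in mz; set k := _ / _ => /andP[k0 k1] /slice Ds.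
  have -> : q = (1 - k) *: (z.1, (q.2 - k * m.2) / (1 - k)) + k *: m.
    apply: plane_eq; rewrite !planeE /=.
      have : k * (m.1 - z.1) = q.1 - z.1 by rewrite /k divfK.
      by lra.
    by field; rewrite gt_eqF // subr_gt0.
  by apply: convex_setE => //; rewrite k0 ltW.
have nearm m : m.1 != z.1 -> \forall q \near z, (q.1 - z.1) / (m.1 - z.1) < 1 /\
    a.2 <= (q.2 - (q.1 - z.1) / (m.1 - z.1) * m.2) / (1 - (q.1 - z.1) / (m.1 - z.1)) <= b.2.
  move=> mz; pose k q : R := (q.1 - z.1) / (m.1 - z.1).
  have kz : k z = 0 by rewrite /k subrr mul0r.
  have kc : k @ z --> k z.
    apply: cvgM; last exact: cvg_cst.
    by apply: cvgB; [exact: cvg_fst|exact: cvg_cst].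
  have yc : (fun q : plane R => (q.2 - k q * m.2) / (1 - k q) : R) @ z --> z.2.
    have -> : z.2 = (z.2 - k z * m.2) / (1 - k z).
      by rewrite kz mul0r !subr0 divr1.
    apply: cvgM; first by apply: cvgB; [exact: cvg_snd|apply: cvgM => //; exact: cvg_cst].
    apply: cvgV; first by rewrite kz subr0 oner_neq0.
    by apply: cvgB => //; exact: cvg_cst.
  have n1 : \forall q \near z, k q < 1 by apply: (cvgr_lt _ kc); rewrite kz ltr01.
  have n2 : \forall q \near z, (q.2 - k q * m.2) / (1 - k q) < b.2.
    exact: (cvgr_lt _ yc).
  have n3 : \forall q \near z, a.2 < (q.2 - k q * m.2) / (1 - k q).
    exact: (cvgr_gt _ yc).
  apply: filterS (filterI n1 (filterI n2 n3)) => q [q1 [q2 q3]].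
  by split=> //; rewrite (ltW q2) (ltW q3).
have Ln : L.1 != z.1 by rewrite lt_eqF.
have rn : r.1 != z.1 by rewrite gt_eqF.
apply: filterS (filterI (nearm L Ln) (nearm r rn)) => q [[q1 q2] [q3 q4]].
have [h|h] := lerP (q.1) (z.1).
  apply: (cone L) => //; rewrite q1 andbT -mulrNN -invrN mulr_ge0 ?invr_ge0; lra.
by apply: (cone r) => //; rewrite q3 andbT divr_ge0 //; lra.
Qed.

End Planar.

(** * Slices of the disk and of its convex image *)

Section Slices.
Variable R : realType.
Implicit Types (p q z d : plane R) (k e x y : R).

(* [th 1] and [th (-1)] are the top and the bottom of the slices of [K], and
   [sg = 1] or [sg = -1] according to whether [v] preserves or reverses the
   vertical order. *)
Record sliced (K : set (plane R)) (v : plane R -> plane R) (xl xr : R)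
    (th : R -> R -> R) (sg : R) : Prop := Sliced {
  sl_sgn : sgn sg;
  sl_lt : xl < xr;
  sl_range : forall p, K p -> xl <= p.1 <= xr;
  sl_ext : forall e x, sgn e -> xl <= x <= xr -> boundary K (x, th e x);
  sl_max : forall e p, sgn e -> K p -> e * p.2 <= e * th e p.1;
  sl_bd : forall p, boundary K p -> xl < p.1 < xr ->
    p.2 = th 1 p.1 \/ p.2 = th (-1) p.1;
  sl_wall : forall p, K p -> p.1 = xl \/ p.1 = xr -> boundary K p;
  sl_cont : forall e, sgn e -> {within `[xl, xr], continuous (th e)};
  sl_order : forall x, xl < x < xr ->
    sg * (v (x, th (-1) x)).2 < sg * (v (x, th 1 x)).2;
  sl_wall_lt : forall p q, K p -> K q -> p.1 = q.1 -> p.1 = xl \/ p.1 = xr ->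
    p.2 < q.2 -> sg * (v p).2 < sg * (v q).2;
  sl_chord : forall e p q k, sgn e -> boundary K p -> boundary K q ->
    0 < k < 1 -> p.1 < q.1 ->
    e * ((1 - k) * (sg * (v p).2) + k * (sg * (v q).2)) <=
    e * (sg * (v ((1 - k) * p.1 + k * q.1, th e ((1 - k) * p.1 + k * q.1))).2) }.

Variables (K D : set (plane R)) (v : plane R -> plane R).
Hypothesis Kc : compact K.
Hypothesis KT : TrV K.
Hypothesis vc : {within boundary K, continuous v}.
Hypothesis vinj : set_inj (boundary K) v.
Hypothesis vv : vertical (boundary K) v.
Hypothesis Dc : compact D.
Hypothesis DC : convex_set D.
Hypothesis DB : boundary D = v @` boundary K.
Hypothesis Kwide : exists p q, [/\ K p, K q & p.1 < q.1].
Hypothesis Khigh : exists p q, [/\ K p, K q, p.1 = q.1 & p.2 < q.2].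
(** What the triangulation contributes at the walls: a segment of [K] leads away from each extreme
    abscissa. The continuity of [ext] there rests on it. *)
Hypothesis Kright : forall z, K z -> (forall p, K p -> z.1 <= p.1) ->
  exists2 z' : plane R, z.1 < z'.1 & forall k, 0 <= k <= 1 -> K ((1 - k) *: z + k *: z').
Hypothesis Kleft : forall z, K z -> (forall p, K p -> p.1 <= z.1) ->
  exists2 z' : plane R, z'.1 < z.1 & forall k, 0 <= k <= 1 -> K ((1 - k) *: z + k *: z').

Let bK p : boundary K p <-> K p /\ ~ interior K p.
Proof. exact: compact_boundary. Qed.

Let bD p : boundary D p <-> D p /\ ~ interior D p.
Proof. exact: compact_boundary. Qed.

Let sgn1 : sgn (1 : R). Proof. by left. Qed.
Let sgnN1 : sgn (-1 : R). Proof. by right. Qed.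

Lemma extremeK e p : sgn e -> K p -> exists y, boundary K (p.1, y) /\
  forall q, K q -> q.1 = p.1 -> e * q.2 <= e * y.
Proof.
move=> se Kp; have [[t1 t2] [/= At tp] tmax] := slice_extreme e Kc Kp.
exists t2; split=> //; rewrite -tp; apply: (extreme_boundary se Kc) => // q Kq.
by rewrite tp; apply: tmax.
Qed.

Lemma extremeD e p : sgn e -> D p -> exists y, boundary D (p.1, y) /\
  forall q, D q -> q.1 = p.1 -> e * q.2 <= e * y.
Proof.
move=> se Kp; have [[t1 t2] [/= At tp] tmax] := slice_extreme e Dc Kp.
exists t2; split=> //; rewrite -tp; apply: (extreme_boundary se Dc) => // q Kq.
by rewrite tp; apply: tmax.
Qed.

Lemma bdD_bdK z : boundary D z -> exists2 p, boundary K p & v p = z /\ p.1 = z.1.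
Proof. by rewrite DB => -[p bp <-]; exists p => //; split=> //; rewrite vv. Qed.

Lemma bdK_bdD p : boundary K p -> boundary D (v p).
Proof. by rewrite DB => bp; exists p. Qed.

Lemma K_abscissa p : K p -> exists2 q, D q & q.1 = p.1.
Proof.
move=> /(extremeK sgn1)[y [/[dup] b /bdK_bdD/bD[Dv _] _]].
by exists (v (p.1, y)) => //; rewrite vv.
Qed.

Lemma D_abscissa p : D p -> exists2 q, K q & q.1 = p.1.
Proof.
move=> /(extremeD sgn1)[y [/bdD_bdK[q /bK[Kq _] [_ e]] _]].
by exists q.
Qed.

(** Since [v] is vertical, [K] and [D] have the same abscissae, and those of the convex [D] form an
    interval. *)
Lemma abscissa_range : exists pl pr, [/\ D pl, D pr, pl.1 < pr.1,
  forall p, K p -> pl.1 <= p.1 <= pr.1 &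
  forall x, pl.1 <= x <= pr.1 -> exists2 p, K p & p.1 = x].
Proof.
have [p0 [q0 [Kp0 Kq0 pq0]]] := Kwide.
have [d0 Dd0 _] := K_abscissa Kp0.
have D0 : D !=set0 by exists d0.
have [pr Dpr prmax] := compact_extreme D0 Dc (@continuous_fst_scale R 1).
have [pl Dpl plmin] := compact_extreme D0 Dc (@continuous_fst_scale R (-1)).
have rg p : K p -> pl.1 <= p.1 <= pr.1.
  move=> /K_abscissa[q Dq <-]; have := prmax q Dq; have := plmin q Dq.
  by rewrite !mul1r !mulN1r lerN2 => -> ->.
have lt : pl.1 < pr.1.
  by have := rg _ Kp0; have := rg _ Kq0; lra.
exists pl, pr; split=> // x /andP[xl xr].
pose k := (x - pl.1) / (pr.1 - pl.1).
have [] := @D_abscissa ((1 - k) *: pl + k *: pr).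
  apply: convex_setE => //; rewrite divr_ge0 ?ler_pdivrMr ?mul1r; lra.
move=> q Kq e; exists q => //; rewrite e !planeE /k; field; lra.
Qed.

(** [v] keeps the top and bottom of a slice of [K] apart, so some slice of [D] has two points;
    segments to [pl] and [pr] spread this to all inner slices. *)
Lemma fat_slice pl pr x : D pl -> D pr ->
  (forall p, K p -> pl.1 <= p.1 <= pr.1) -> pl.1 < x < pr.1 ->
  exists y y', [/\ D (x, y), D (x, y') & y < y'].
Proof.
move=> Dl Dr rg /andP[lx xr].
have [p [q [Kp Kq pq1 pq2]]] := Khigh.
have [x1 [y1 [y2 [D1 D2 y12 x1r]]]] : exists x1 y1 y2,
    [/\ D (x1, y1), D (x1, y2), y1 < y2 & pl.1 <= x1 <= pr.1].
  have [y [by_ ymax]] := extremeK sgn1 Kp.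
  have [y' [by_' ymin]] := extremeK sgnN1 Kp.
  have y'y : y' < y.
    have := ymax q Kq (esym pq1); have := ymin p Kp erefl; lra.
  have n : (v (p.1, y)).2 != (v (p.1, y')).2.
    apply/eqP => e; have : v (p.1, y) = v (p.1, y').
      by apply: plane_eq => //; rewrite !vv.
    move/vinj; rewrite !inE => /(_ by_ by_')[e']; move: y'y; rewrite e' ltxx //.
  have [vy vy'] := (bdK_bdD by_, bdK_bdD by_').
  have [[Dy _] [Dy' _]] := ((bD _).1 vy, (bD _).1 vy').
  have e1 : v (p.1, y) = (p.1, (v (p.1, y)).2) by apply: plane_eq => //; rewrite vv.
  have e2 : v (p.1, y') = (p.1, (v (p.1, y')).2) by apply: plane_eq => //; rewrite vv.
  move: n; rewrite neq_lt => /orP[n|n].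
    by exists p.1, (v (p.1, y)).2, (v (p.1, y')).2; rewrite -e1 -e2 rg.
  by exists p.1, (v (p.1, y')).2, (v (p.1, y)).2; rewrite -e1 -e2 rg.
have comb m k : D m -> 0 <= k < 1 -> x = (1 - k) * x1 + k * m.1 ->
    exists y y', [/\ D (x, y), D (x, y') & y < y'].
  move=> Dm /andP[k0 k1] xe; have k01 : 0 <= k <= 1 by rewrite k0 ltW.
  exists ((1 - k) * y1 + k * m.2), ((1 - k) * y2 + k * m.2); split.
  - by rewrite xe; have := convex_setE DC D1 Dm k01; congr D; apply: plane_eq; rewrite !planeE.
  - by rewrite xe; have := convex_setE DC D2 Dm k01; congr D; apply: plane_eq; rewrite !planeE.
  - by rewrite ltrD2r ltr_pM2l // subr_gt0.
case/andP: x1r => lx1 x1r; have [h|h] := lerP x x1.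
  apply: (comb pl ((x1 - x) / (x1 - pl.1))) => //; last by field; lra.
  by rewrite divr_ge0 ?ltr_pdivrMr ?mul1r; lra.
apply: (comb pr ((x - x1) / (pr.1 - x1))) => //; last by field; lra.
by rewrite divr_ge0 ?ltr_pdivrMr ?mul1r; lra.
Qed.

(** Here [TrV] enters: a connected set of ordinates is an interval. *)
Lemma slice_convex p q y : K p -> K q -> p.1 = q.1 -> p.2 <= y <= q.2 -> K (p.1, y).
Proof.
move=> Kp Kq pq /andP[py yq].
have cI : connected (K `&` [set z | z.1 = p.1]) by apply: KT; exists p.
have : connected (snd @` (K `&` [set z : plane R | z.1 = p.1])).
  apply: connected_continuous_connected => //.
  by apply: continuous_subspaceT => z; exact: cvg_snd.
move=> /connected_intervalP/(_ p.2 q.2) H.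
have [|||z [Kz zp] <-] := H _ _ y.
- by exists p.
- by exists q => //; split.
- by rewrite py yq.
by rewrite /= -zp; case: z Kz {zp}.
Qed.

(** The end of the slice in the direction [e]; for a sign [e] the default 0 occurs only over
    abscissae outside [K]. *)
Definition ext e x : R := xget 0 [set y | boundary K (x, y) /\
  forall q, K q -> q.1 = x -> e * q.2 <= e * y].

Lemma extP e p : sgn e -> K p -> boundary K (p.1, ext e p.1) /\
  forall q, K q -> q.1 = p.1 -> e * q.2 <= e * ext e p.1.
Proof.
move=> se Kp; have := extremeK se Kp; rewrite /ext => H.
by case: xgetP => [y _ //|]; case: H => y Hy /(_ y).
Qed.

Section Range.
Variables (pl pr : plane R).
Hypothesis Dl : D pl.
Hypothesis Dr : D pr.
Hypothesis lr : pl.1 < pr.1.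
Hypothesis rg : forall p, K p -> pl.1 <= p.1 <= pr.1.
Hypothesis onto : forall x, pl.1 <= x <= pr.1 -> exists2 p, K p & p.1 = x.
Notation xl := pl.1.
Notation xr := pr.1.

Lemma ext_bd e x : sgn e -> xl <= x <= xr -> boundary K (x, ext e x).
Proof. by move=> se /onto[p Kp <-]; have [] := extP se Kp. Qed.

Lemma ext_max e p : sgn e -> K p -> e * p.2 <= e * ext e p.1.
Proof. by move=> se Kp; have [_] := extP se Kp; apply. Qed.

(** Over an inner abscissa the points strictly between top and bottom of [D] are interior by
    [convex_interior], so only two boundary points remain. *)
Lemma bdD_slice x u u' z : xl < x < xr -> boundary D z -> z.1 = x ->
  boundary D (x, u) -> boundary D (x, u') -> u < u' -> z.2 = u \/ z.2 = u'.
Proof.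
move=> xlr; have [y [y' [Dy Dy' yy']]] := fat_slice Dl Dr rg xlr.
move=> bz zx bu bu' uu'.
have [w [bw wmin]] := extremeD sgnN1 Dy.
have [w' [bw' wmax]] := extremeD sgn1 Dy.
move: bw bw' wmin wmax => /= bw bw' wmin wmax.
have ww' : w < w' by have := wmax _ Dy' erefl; have := wmin _ Dy erefl; rewrite /=; lra.
have ends t : boundary D t -> t.1 = x -> t.2 = w \/ t.2 = w'.
  move=> /bD[Dt it] tx.
  have := wmax _ Dt tx; have := wmin _ Dt tx; rewrite !mul1r !mulN1r lerN2 => h1 h2.
  have [->|n1] := eqVneq t.2 w; first by left.
  have [->|n2] := eqVneq t.2 w'; first by right.
  case: it; have [[Dw _] [Dw' _]] := ((bD _).1 bw, (bD _).1 bw').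
  apply: (convex_interior DC Dl Dr Dw Dw') => //; first by rewrite tx.
  by rewrite /= !lt_neqAle h1 h2 n2 eq_sym n1.
have := ends _ bz zx; have := ends _ bu erefl; have := ends _ bu' erefl.
rewrite /=; case=> e1; case=> e2; case=> e3; rewrite e3; lra.
Qed.

(** As [v] is injective and vertical, the boundary points in a slice of [K] correspond to those in
    the slice of [D], of which there are two; they can only be top and bottom. Convexity of the
    image thus makes the upper and lower boundary of [K] graphs. *)
Lemma bdK_slice x : xl < x < xr -> ext (-1) x < ext 1 x /\
  forall p, boundary K p -> p.1 = x -> p.2 = ext 1 x \/ p.2 = ext (-1) x.
Proof.
move=> xlr; have xlr' : xl <= x <= xr by lra.
have [y [y' [Dy Dy' yy']]] := fat_slice Dl Dr rg xlr.
have [w [bw wmin]] := extremeD sgnN1 Dy.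
have [w' [bw' wmax]] := extremeD sgn1 Dy.
move: bw bw' wmin wmax => /= bw bw' wmin wmax.
have ww' : w < w' by have := wmax _ Dy' erefl; have := wmin _ Dy erefl; rewrite /=; lra.
have [t bt [vt /= t1]] := bdD_bdK bw; have [t' bt' [vt' /= t'1]] := bdD_bdK bw'.
have tt' : t.2 != t'.2.
  apply/eqP => e; have e' : t = t' by apply: plane_eq => //; rewrite t1.
  by move: ww'; rewrite -[w]/((x, w) : plane R).2 -vt e' vt' ltxx.
have ends p : boundary K p -> p.1 = x -> p = t \/ p = t'.
  move=> bp px; have vp : (v p).1 = x by rewrite vv.
  have [e|e] := bdD_slice xlr (bdK_bdD bp) vp bw bw' ww'.
    left; apply: vinj; rewrite ?inE // vt; exact: plane_eq.
  right; apply: vinj; rewrite ?inE // vt'; exact: plane_eq.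
have [p Kp px] := onto xlr'.
have [Kt _] := (bK _).1 bt; have [Kt' _] := (bK _).1 bt'.
have m1 := ext_max sgn1 Kt; have m1' := ext_max sgn1 Kt'.
have m2 := ext_max sgnN1 Kt; have m2' := ext_max sgnN1 Kt'.
move: m1 m1' m2 m2'; rewrite t1 t'1 !mul1r !mulN1r !lerN2 => m1 m1' m2 m2'.
have lt : ext (-1) x < ext 1 x.
  by move: tt'; rewrite neq_lt => /orP[]; lra.
split=> // q bq qx.
have E1 := ends _ (ext_bd sgn1 xlr') erefl.
have E2 := ends _ (ext_bd sgnN1 xlr') erefl.
case: (ends q bq qx) => ->; case: E1 => /(congr1 snd) /= e1;
  case: E2 => /(congr1 snd) /= e2; lra.
Qed.

Lemma wall_bd p : K p -> p.1 = xl \/ p.1 = xr -> boundary K p.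
Proof.
move=> Kp; case=> e; apply/bK; split=> //.
  apply: (@not_interior _ _ _ (-1, 0)) => t t0 /rg.
  by rewrite !planeE /= e; lra.
apply: (@not_interior _ _ _ (1, 0)) => t t0 /rg.
by rewrite !planeE /= e; lra.
Qed.

Lemma near_fst (P : plane R -> Prop) x0 y0 : (\forall p \near ((x0, y0) : plane R), P p) ->
  \forall x \near x0, P (x, y0).
Proof.
move=> /near_box[e e0 H]; apply/nbhs_ballP; exists e => //= x.
rewrite /ball /= distrC => xe; apply: H => //=; by rewrite subrr normr0.
Qed.

Lemma ext_lower_slant e x0 z' eps : sgn e -> 0 < eps -> K (x0, ext e x0) ->
  z'.1 != x0 ->
  (forall k, 0 <= k <= 1 -> K ((1 - k) *: (x0, ext e x0) + k *: z')) ->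
  \forall x \near x0, 0 <= (x - x0) / (z'.1 - x0) ->
    exists2 y, K (x, y) & e * ext e x0 - eps < e * y.
Proof.
move=> se eps0 Kz zx seg; rewrite -subr_eq0 in zx.
pose k x : R := (x - x0) / (z'.1 - x0).
have k0 : k x0 = 0 by rewrite /k subrr mul0r.
have kc : k @ x0 --> k x0.
  by apply: cvgM; [apply: cvgB; [exact: cvg_id|exact: cvg_cst]|exact: cvg_cst].
have yc : (fun x => e * ((1 - k x) * ext e x0 + k x * z'.2)) @ x0 --> e * ext e x0.
  have {2}-> : ext e x0 = (1 - k x0) * ext e x0 + k x0 * z'.2 by rewrite k0; ring.
  apply: cvgM; first exact: cvg_cst.
  apply: cvgD; apply: cvgM => //; try exact: cvg_cst.
  by apply: cvgB => //; exact: cvg_cst.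
have n1 : \forall x \near x0, k x < 1 by apply: (cvgr_lt _ kc); rewrite k0 ltr01.
have n2 : \forall x \near x0, e * ext e x0 - eps < e * ((1 - k x) * ext e x0 + k x * z'.2).
  by apply: (cvgr_gt _ yc); rewrite ltrBlDr ltrDl.
apply: filterS (filterI n1 n2) => x [h1 h2] h0.
exists ((1 - k x) * ext e x0 + k x * z'.2) => //.
have := seg (k x); rewrite /k in h1 *; rewrite h0 ltW // => /(_ isT).
congr K; apply: plane_eq; rewrite !planeE //=; field; exact: zx.
Qed.

(** Over an inner abscissa a point slightly inside the end of the slice is interior to [K], so the
    neighbouring slices reach it; at the walls the segments from [Kright] and [Kleft] serve
    instead. *)
Lemma ext_lower e x0 eps : sgn e -> 0 < eps -> xl <= x0 <= xr ->
  \forall x \near x0, xl <= x <= xr ->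
    exists2 y, K (x, y) & e * ext e x0 - eps < e * y.
Proof.
move=> se eps0 x0r; have [Kz _] := (bK _).1 (ext_bd se x0r).
have [xe|nl] := eqVneq x0 xl.
  have ext0 p : K p -> (x0, ext e x0).1 <= p.1.
    by move=> /rg; rewrite /= xe => /andP[].
  have [z' /= z1 seg] := Kright Kz ext0.
  have zx : z'.1 != x0 by rewrite gt_eqF.
  have := ext_lower_slant se eps0 Kz zx seg; apply: filterS => x H xr_.
  by apply: H; rewrite divr_ge0; lra.
have [xe|nr] := eqVneq x0 xr.
  have ext0 p : K p -> p.1 <= (x0, ext e x0).1.
    by move=> /rg; rewrite /= xe => /andP[].
  have [z' /= z1 seg] := Kleft Kz ext0.
  have zx : z'.1 != x0 by rewrite lt_eqF.
  have := ext_lower_slant se eps0 Kz zx seg; apply: filterS => x H xr_.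
  by apply: H; rewrite -mulrNN -invrN mulr_ge0 ?invr_ge0; lra.
have x0i : xl < x0 < xr by rewrite !lt_neqAle (eq_sym xl) nl nr.
have [lt ends] := bdK_slice x0i.
pose dl := Num.min (eps / 2%:R) ((ext 1 x0 - ext (-1) x0) / 2%:R).
have d0 : 0 < dl by rewrite lt_min !divr_gt0 ?subr_gt0.
have d1 : dl <= eps / 2%:R by rewrite ge_min lexx.
have d2 : dl <= (ext 1 x0 - ext (-1) x0) / 2%:R by rewrite ge_min lexx orbT.
pose y0 := ext e x0 - e * dl.
have yr : ext (-1) x0 < y0 < ext 1 x0.
  by rewrite /y0; case: se => ->; lra.
have [Kb _] := (bK _).1 (ext_bd sgnN1 x0r); have [Kt _] := (bK _).1 (ext_bd sgn1 x0r).
have Ky : K (x0, y0).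
  by apply: (slice_convex Kb Kt) => //=; case/andP: yr => h1 h2; rewrite !ltW.
have iy : interior K (x0, y0).
  apply: contrapT => ni; have /ends : boundary K (x0, y0) by apply/bK.
  by move=> /(_ erefl) /=; lra.
apply: filterS (near_fst iy) => x Kx _; exists y0 => //.
have := sgn_sqr se; rewrite /y0 mulrBr mulrA => ->; lra.
Qed.

(** The points of [K] that exceed the end over [x0] by at least [eps] form a compact set, whose
    projection is closed and misses [x0]. *)
Lemma ext_upper e x0 eps : sgn e -> 0 < eps -> xl <= x0 <= xr ->
  \forall x \near x0, xl <= x <= xr -> e * ext e x < e * ext e x0 + eps.
Proof.
move=> se eps0 x0r.
pose C := K `&` [set p | e * ext e x0 + eps <= e * p.2].
have Cc : compact C.
  apply: compact_closedI => //.
  have -> : [set p : plane R | e * ext e x0 + eps <= e * p.2] =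
      (fun p : plane R => e * p.2 : R) @^-1` [set y | e * ext e x0 + eps <= y] by [].
  apply: closed_comp; last exact: closed_ge.
  by move=> p _; exact: continuous_snd_scale.
have Fc : closed (fst @` C).
  apply: compact_closed; first exact: norm_hausdorff.
  by apply: continuous_compact => //; apply: continuous_subspaceT => p; exact: cvg_fst.
have n0 : ~ (fst @` C) x0.
  by move=> [p [Kp /= hp] px]; have := ext_max se Kp; rewrite px; lra.
have : nbhs x0 (~` (fst @` C)).
  by apply: open_nbhs_nbhs; split=> //; rewrite openC.
apply: filterS => x nx xr_; rewrite ltNge; apply/negP => h; apply: nx.
have [Kx _] := (bK _).1 (ext_bd se xr_).
by exists (x, ext e x).
Qed.

Lemma ext_cont e : sgn e -> {within `[xl, xr], continuous (ext e)}.
Proof.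
move=> se; apply: near_within => x0 P; rewrite /= in_itv /= => x0r.
move=> /nbhs_ballP[eps /= eps0 HP].
apply: filterS (filterI (ext_lower se eps0 x0r) (ext_upper se eps0 x0r)).
move=> x [h1 h2]; rewrite /= in_itv /= => xr_; apply: HP; rewrite /ball /=.
have [y Ky hy] := h1 xr_; have := ext_max se Ky; have := h2 xr_; rewrite /= => g1 g2.
by rewrite ltr_norml; case: se g1 g2 hy => ->; lra.
Qed.

Let V e x := (v (x, ext e x)).2 : R.

Lemma V_cont e : sgn e -> {within `[xl, xr], continuous (V e)}.
Proof.
move=> se; have C1 : {within `[xl, xr], continuous (fun x => (x, ext e x) : plane R)}.
  apply: near_within => x P Ix /near_box[eps eps0 HP].
  have n1 : \forall y \near ext e x, `|y - ext e x| < eps.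
    by apply/nbhs_ballP; exists eps => //= y; rewrite /ball /= distrC.
  have n2 : \forall y \near x, `|y - x| < eps.
    by apply/nbhs_ballP; exists eps => //= y; rewrite /ball /= distrC.
  have n3 := within_near (ext_cont se) Ix n1.
  by apply: filterS (filterI n2 n3) => y [h1 h2] Iy; apply: HP => //=; apply: h2.
have C2 : {within `[xl, xr], continuous (v \o (fun x => (x, ext e x) : plane R))}.
  by apply: (within_comp _ C1 vc) => x /=; rewrite in_itv /=; apply: ext_bd.
apply: (within_comp (B := setT) (g := snd) _ C2) => //.
by apply: continuous_subspaceT => p; exact: cvg_snd.
Qed.

Lemma near_inside x (P : R -> Prop) : xl <= x <= xr -> (\forall y \near x, P y) ->
  exists2 y, xl < y < xr & P y.
Proof.
move=> xr_ /nbhs_ballP[e /= e0 H].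
pose t := Num.min (2%:R^-1) (e / (xr - xl)).
have w0 : 0 < xr - xl by rewrite subr_gt0; exact: lr.
have t0 : 0 < t by rewrite lt_min invr_gt0 ltr0n divr_gt0.
have t1 : t <= 2%:R^-1 by rewrite ge_min lexx.
have t2 : t * (xr - xl) <= e by rewrite -ler_pdivlMr // ge_min lexx orbT.
have tw : 0 < t * (xr - xl) by rewrite mulr_gt0.
exists (x + t * ((xl + xr) / 2%:R - x)).
  have -> : t * ((xl + xr) / 2%:R - x) = (t * (xr - x) - t * (x - xl)) / 2%:R by field.
  have [h1 h2] := andP xr_.
  have a0 : 0 <= t * (x - xl) by rewrite mulr_ge0 ?subr_ge0 // ltW.
  have a1 : t * (x - xl) <= 2%:R^-1 * (x - xl) by rewrite ler_wpM2r // subr_ge0.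
  have b0 : 0 <= t * (xr - x) by rewrite mulr_ge0 ?subr_ge0 // ltW.
  have b1 : t * (xr - x) <= 2%:R^-1 * (xr - x) by rewrite ler_wpM2r // subr_ge0.
  have ab : t * (xr - xl) = t * (x - xl) + t * (xr - x) by ring.
  lra.
apply: H; rewrite /ball /= opprD addrA subrr sub0r normrN normrM (gtr0_norm t0).
apply: lt_le_trans t2; rewrite ltr_pM2l // ltr_norml; lra.
Qed.

(** The gap between the images of top and bottom is continuous and, as [v] is injective, not 0 over
    inner abscissae, so its sign is constant. At the walls, where a slice may be a point, the
    inequality is weak. *)
Lemma orientation : exists2 sg, sgn sg &
  (forall x, xl < x < xr -> sg * V (-1) x < sg * V 1 x) /\
  (forall x, xl <= x <= xr -> sg * V (-1) x <= sg * V 1 x).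
Proof.
pose G sg x := sg * (V 1 x - V (-1) x).
have Gc sg : {within `[xl, xr], continuous (G sg)}.
  apply/subspace_continuousP => x Ix; apply: cvgM; first exact: cvg_cst.
  have /subspace_continuousP/(_ x Ix) c1 := V_cont sgn1.
  have /subspace_continuousP/(_ x Ix) c2 := V_cont sgnN1.
  exact: cvgB.
have Gn sg x : sgn sg -> xl < x < xr -> G sg x != 0.
  move=> ss xi; rewrite /G mulf_neq0 ?(sgn_neq0 ss) // subr_eq0; apply/eqP => e.
  have xi' : xl <= x <= xr by lra.
  have [b1 b2] := (ext_bd sgn1 xi', ext_bd sgnN1 xi').
  have /vinj : v (x, ext 1 x) = v (x, ext (-1) x) by apply: plane_eq; rewrite ?vv.
  rewrite !inE => /(_ b1 b2)[]; have [lt _] := bdK_slice xi; lra.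
pose xm := (xl + xr) / 2%:R.
have xmi : xl < xm < xr by have lr' : (xl : R) < xr := lr; rewrite /xm; lra.
have [sg ss Gm] : exists2 sg, sgn sg & 0 < G sg xm.
  have := Gn 1 xm sgn1 xmi; rewrite neq_lt => /orP[h|h]; last by exists 1.
  by exists (-1) => //; move: h; rewrite /G; lra.
have Gp x : xl < x < xr -> 0 < G sg x.
  move=> xi; have := Gn sg x ss xi; rewrite neq_lt => /orP[h|//]; exfalso.
  have [c ci Gc0] : exists2 c, xl < c < xr & G sg c = 0.
    have [xx|xx] := lerP x xm.
      have [||c] := @IVT R (G sg) x xm 0 xx.
      - apply: continuous_subspaceW (Gc sg) => c /=; rewrite !in_itv /=; lra.
      - by rewrite minElt maxElt; case: ifP; lra.
      by rewrite in_itv /= => ci Gc0; exists c => //; lra.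
    have [||c] := @IVT R (G sg) xm x 0 (ltW xx).
    - apply: continuous_subspaceW (Gc sg) => c /=; rewrite !in_itv /=; lra.
    - by rewrite minElt maxElt; case: ifP; lra.
    by rewrite in_itv /= => ci Gc0; exists c => //; lra.
  by have := Gn sg c ss ci; rewrite Gc0 eqxx.
exists sg => //; split=> [x xi|x xi].
  by have := Gp x xi; rewrite /G; lra.
suff : 0 <= G sg x by rewrite /G; lra.
rewrite leNgt; apply/negP => h.
have Ix : `[xl, xr]%classic x by rewrite /= in_itv.
have n1 : \forall y \near G sg x, y < 0.
  by apply: (cvgr_lt _ (@cvg_id _ (nbhs (G sg x)))).
have [y yi Gy] := near_inside xi (within_near (Gc sg) Ix n1).
have := Gp y yi; have : G sg y < 0 by apply: Gy; rewrite /= in_itv /=; lra.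
lra.
Qed.

Theorem slices_sliced : exists sg, sliced K v xl xr ext sg.
Proof.
have [sg ss [lt le]] := orientation; exists sg.
split=> //.
- exact: ext_bd.
- exact: ext_max.
- by move=> p bp xi; have [_] := bdK_slice xi; apply.
- exact: wall_bd.
- exact: ext_cont.
(* A slice on a wall consists of boundary points, so [v] is continuous and injective on it, hence
   monotone; the weak inequality at its ends fixes the direction. *)
- move=> p q Kp Kq pq pw lt_pq; set c := p.1 in pq pw.
  have cr : xl <= c <= xr by apply: rg.
  have [[Kt _] [Kb _]] := ((bK _).1 (ext_bd sgn1 cr), (bK _).1 (ext_bd sgnN1 cr)).
  have bd y : ext (-1) c <= y <= ext 1 c -> boundary K (c, y).
    by move=> yr; apply: wall_bd => //; apply: (slice_convex Kb Kt).
  pose f y := sg * (v (c, y)).2.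
  have fc : {within `[ext (-1) c, ext 1 c], continuous f}.
    have C1 : {within `[ext (-1) c, ext 1 c], continuous (fun y => (c, y) : plane R)}.
      apply: near_within => y P _ /near_box[eps eps0 HP].
      apply/nbhs_ballP; exists eps => //= y'; rewrite /ball /= distrC => h _.
      by apply: HP => //=; rewrite subrr normr0.
    have C2 : {within `[ext (-1) c, ext 1 c], continuous (v \o (fun y => (c, y) : plane R))}.
      by apply: (within_comp _ C1 vc) => y /=; rewrite in_itv /=; apply: bd.
    apply: (within_comp (B := setT) (g := fun p : plane R => sg * p.2 : R) _ C2) => //.
    by apply: continuous_subspaceT; exact: continuous_snd_scale.
  have inI r : K r -> r.1 = c -> r.2 \in `[ext (-1) c, ext 1 c].
    move=> Kr rc; have := ext_max sgn1 Kr; have := ext_max sgnN1 Kr.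
    by rewrite rc in_itv /=; lra.
  have [pI qI] := (inI p Kp erefl, inI q Kq (esym pq)).
  have fi : {in `[ext (-1) c, ext 1 c] &, injective f}.
    move=> y y'; rewrite !in_itv /= => yr yr' /(mulfI (sgn_neq0 ss)) e.
    have /vinj : v (c, y) = v (c, y') by apply: plane_eq; rewrite ?vv //; exact: bd.
    by rewrite !inE => /(_ (bd _ yr) (bd _ yr'))[].
  have ex : exists y y', [/\ y \in `[ext (-1) c, ext 1 c],
      y' \in `[ext (-1) c, ext 1 c], y < y' & f y <= f y'].
    exists (ext (-1) c), (ext 1 c); have := le c cr; rewrite /V /f => h.
    by move: pI qI; rewrite !in_itv /=; split=> //; lra.
  have mono := leW_mono_in (itv_continuous_inj_le ex fc fi).
  have := mono p.2 q.2 pI qI; rewrite lt_pq /f.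
  have -> : (c, p.2) = p by apply: plane_eq.
  by have -> : (c, q.2) = q by apply: plane_eq.
(* The chord is in [D], hence bounded by the end of the slice in the direction [e * sg]; this end is
   the image of the top or of the bottom of [K], and [lt] compares the two. *)
- move=> e p q k se bp bq k01 pq.
  have [Dp Dq] : D (v p) /\ D (v q) by split; apply: ((bD _).1 (bdK_bdD _)).1.
  have k01' : 0 <= k <= 1 by lra.
  set x := (1 - k) * p.1 + k * q.1.
  have xi : xl < x < xr.
    have [Kp _] := (bK _).1 bp; have [Kq _] := (bK _).1 bq.
    have := rg Kp; have := rg Kq; case/andP: k01 => k0 k1.
    have e1 : x = p.1 + k * (q.1 - p.1) by rewrite /x; ring.
    have : 0 < k * (q.1 - p.1) by rewrite mulr_gt0 // subr_gt0.
    have : k * (q.1 - p.1) < q.1 - p.1 by rewrite gtr_pMl // subr_gt0.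
    lra.
  have ses : sgn (e * sg).
    by case: se => ->; rewrite ?mul1r // mulN1r; apply: sgnN.
  have [y []] := extremeD ses (convex_setE DC Dp Dq k01').
  rewrite !planeE !vv // -/x => by_ /(_ _ (convex_setE DC Dp Dq k01')).
  rewrite !planeE !vv // => /(_ erefl) h.
  have [w bw [vw w1]] := bdD_bdK by_.
  have [_ ends] := bdK_slice xi; have := ends w bw w1.
  have {}ltx := lt x xi; have we : w = (x, w.2) by apply: plane_eq.
  have yE : y = (v w).2 by rewrite vw.
  rewrite yE in h; move=> E.
  have {E} : y = V 1 x \/ y = V (-1) x.
    by case: E => E; [left|right]; rewrite yE we E.
  rewrite -yE in h => E; move: h; rewrite -/(V e x).
  have -> : e * sg * ((1 - k) * (v p).2 + k * (v q).2) =
    e * ((1 - k) * (sg * (v p).2) + k * (sg * (v q).2)) by ring.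
  move=> h; apply: le_trans h _.
  by case: se => ->; case: E => ->; lra.
Qed.

End Range.

Theorem sliced_exists : exists xl xr th sg, sliced K v xl xr th sg.
Proof.
have [pl [pr [Dl Dr lr rg onto]]] := abscissa_range.
have [sg H] := slices_sliced Dl Dr lr rg onto.
by exists pl.1, pr.1, ext, sg.
Qed.

End Slices.

(** * The boundary values *)

Lemma disk2_compact (R : realType) : compact (@disk2 R).
Proof.
have C : compact ((`[-1, 1]%classic `*` `[-1, 1]%classic) : set (plane R)).
  by apply: compact_setX; exact: segment_compact.
apply: (subclosed_compact _ C).
  have -> : @disk2 R = (fun p : plane R => p.1 ^+ 2 + p.2 ^+ 2 : R) @^-1` [set y | y <= 1] by [].
  apply: closed_comp; last exact: closed_le.
  move=> p _; rewrite /=; apply: cvgD; rewrite !expr2; apply: cvgM;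
    by [exact: cvg_fst|exact: cvg_snd].
move=> [p1 p2]; rewrite /disk2 /= => h.
have h1 := sqr_ge0 p1; have h2 := sqr_ge0 p2.
rewrite !expr2 in h h1 h2.
by split; rewrite /= in_itv /=; apply/andP; split; nra.
Qed.

Lemma disk_compact (R : realType) (D : set (plane R)) : topological_disk D -> compact D.
Proof.
move=> [f [g [fc _ fD gD [_ fg]]]].
have -> : D = f @` @disk2 R.
  apply/seteqP; split=> [p Dp|p]; last exact: fD.
  by exists (g p); [apply: gD; exists p|exact: fg].
by apply: continuous_compact => //; exact: disk2_compact.
Qed.

Lemma not_strictly_between (R : realType) (l r a b c e : R) : sgn e ->
  l <= a <= r -> l <= c <= r -> e * a <= e * b <= e * c ->
  a != b -> c != b -> b = l \/ b = r -> False.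
Proof.
move=> se /andP[la ar] /andP[lc cr] abc; rewrite !neq_lt.
have {}abc : a <= b <= c \/ c <= b <= a.
  by case: se abc => ->; rewrite ?mul1r ?mulN1r ?lerN2 andbC => /andP[-> ->];
    [left|right].
by case: abc => /andP[h1 h2] /orP[h3|h3] /orP[h4|h4] [h5|h5]; lra.
Qed.

Lemma midpoint_between (R : realType) (l r p q e : R) :
  l <= p <= r -> l <= q <= r -> e * p < e * q ->
  l < 2%:R^-1 * p + 2%:R^-1 * q < r.
Proof.
move=> pr qr pq; have : p != q by apply: contraTneq pq => ->; rewrite ltxx.
by rewrite neq_lt => /orP[h|h]; lra.
Qed.

Section Boundary.
Variables (R : realType) (K : {fset {fset plane R}}) (v : plane R -> plane R).
Hypothesis KC : simplicial_complex K.
Hypothesis KD : topological_disk (realization K).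
Hypothesis KT : TrV (realization K).
Hypothesis vSL : SL_map K (bd K) v.
Hypothesis vinj : set_inj (bd K) v.
Hypothesis vv : vertical (bd K) v.
Hypothesis vC : convex_circle (v @` bd K).
Hypothesis vO : forall s : {fset plane R}, spanning K s -> ~ obstructive K v s.
Notation real := (realization K).
Implicit Types (a b c p q z : plane R) (e k l x : R).

Lemma some_interior : exists z, interior real z.
Proof.
have [f [g [_ _ fD _ _]]] := KD.
have /real_tri : real (f (0, 0)).
  by apply: fD; exists (0, 0) => //; rewrite /disk2 /= expr0n /= addr0.
move=> /(_ KC KD)[a [b [c [T _]]]].
exists (3%:R^-1 *: a + 3%:R^-1 *: b + 3%:R^-1 *: c).
have s1 : 3%:R^-1 + 3%:R^-1 + 3%:R^-1 = 1 :> R by field.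
have [h1 h2 h3] := area_comb a b c s1.
by apply: (tri_interior T); rewrite ?h1 ?h2 ?h3 mulr_gt0 ?invr_gt0 ?ltr0n ?(tri_area T).
Qed.

Lemma real_slices : exists xl xr th sg, sliced real v xl xr th sg.
Proof.
have [D [DD DB DC]] := vC.
have [z iz] := some_interior; have rz : real z := interior_subset iz.
apply: (@sliced_exists R real D v) => //.
- exact: disk_compact.
- by case: vSL.
- exact: disk_compact.
- have [t t0 H] := near_dir ((1, 0) : plane R) iz.
  exists z, (z + t *: ((1, 0) : plane R)); split=> //; first by apply: H; rewrite lexx ltW.
  by rewrite !planeE /= mulr1 ltrDl.
- have [t t0 H] := near_dir ((0, 1) : plane R) iz.
  exists z, (z + t *: ((0, 1) : plane R)); split=> //; first by apply: H; rewrite lexx ltW.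
    by rewrite !planeE /= mulr0 addr0.
  by rewrite !planeE /= mulr1 ltrDl.
- move=> p rp pmin; have [a [b [c [T hp]]]] := real_tri KC KD rp.
  have vert q : q \in [fset a; b; c]%fset -> p.1 <= q.1.
    by move=> qT; apply: pmin; apply: (tri_real T); apply: mem_hull.
  (* A triangle whose vertices share one abscissa has area 0. *)
  have [q qT pq] : exists2 q, q \in [fset a; b; c]%fset & p.1 < q.1.
    apply: contrapT => H; have E q : q \in [fset a; b; c]%fset -> q.1 = p.1.
      move=> qT; apply/eqP; rewrite eq_le vert // andbT leNgt; apply/negP => lt.
      by apply: H; exists q.
    have := tri_area T; rewrite /area !E ?inE ?eqxx ?orbT //.
    by rewrite !subrr !mul0r mulr0 subrr ltxx.
  exists q => // k k01; apply: (tri_real T); apply: hull_convex => //.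
  exact: mem_hull.
- move=> p rp pmin; have [a [b [c [T hp]]]] := real_tri KC KD rp.
  have vert q : q \in [fset a; b; c]%fset -> q.1 <= p.1.
    by move=> qT; apply: pmin; apply: (tri_real T); apply: mem_hull.
  have [q qT pq] : exists2 q, q \in [fset a; b; c]%fset & q.1 < p.1.
    apply: contrapT => H; have E q : q \in [fset a; b; c]%fset -> q.1 = p.1.
      move=> qT; apply/eqP; rewrite eq_le vert //= leNgt; apply/negP => lt.
      by apply: H; exists q.
    have := tri_area T; rewrite /area !E ?inE ?eqxx ?orbT //.
    by rewrite !subrr !mul0r mulr0 subrr ltxx.
  exists q => // k k01; apply: (tri_real T); apply: hull_convex => //.
  exact: mem_hull.
Qed.

Lemma edgeK s a b : s \in K -> a \in s -> b \in s -> [fset a; b]%fset \in K.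
Proof.
move=> sK sa sb; case: KC => _ H _; apply: (H s) => //.
  by apply/fset0Pn; exists a; rewrite !inE eqxx.
by apply/fsubsetP => p /fset2P[] ->.
Qed.

Lemma v_mid s a b k : s \in K -> a \in s -> b \in s ->
  (forall l, 0 <= l <= 1 -> bd K (mid a b l)) -> 0 <= k <= 1 ->
  v (mid a b k) = (1 - k) *: v a + k *: v b.
Proof.
move=> sK sa sb sub k01; case: vSL => _ H.
have := H _ (edgeK sK sa sb); have hab : hull [fset a; b]%fset `<=` bd K.
  by move=> p /hull2[l l01 ->]; apply: sub.
by move=> /(_ hab)/(_ a b k); apply=> //; apply: mem_hull; rewrite !inE eqxx ?orbT.
Qed.

Lemma mid0 a b : mid a b 0 = a.
Proof. by rewrite /mid subr0 scale1r scale0r addr0. Qed.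

Lemma mid1 a b : mid a b 1 = b.
Proof. by rewrite /mid subrr scale1r scale0r add0r. Qed.

Lemma vertex_real (i : vertices K) : real (val i).
Proof. by exists [fset val i]%fset; [apply/verticesK/valP|apply: mem_hull; rewrite inE]. Qed.

Lemma outer_bd (i : vertices K) : ~~ vinn i -> bd K (val i).
Proof. by move=> /asboolPn ni; apply/bdP => //; split=> //; exact: vertex_real. Qed.

Lemma bd_outer p (pV : p \in vertices K) : bd K p -> ~~ vinn [` pV]%fset.
Proof. by move=> /bdP[_ np]; apply/asboolPn. Qed.

Section Sliced.
Variables (xl xr : R) (th : R -> R -> R) (sg : R).
Hypothesis SL : sliced real v xl xr th sg.
Notation eta z := (sg * (v z).2).

Definition veta (i : vertices K) : R := eta (val i).

Let sgn1 : sgn (1 : R). Proof. by left. Qed.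
Let sgnN1 : sgn (-1 : R). Proof. by right. Qed.

Lemma bd_real p : bd K p -> real p.
Proof. by move=> /bdP[]. Qed.

(** [v] is affine on boundary edges, so a linear bound at the outer vertices holds on the whole
    boundary. *)
Lemma bd_le (al be : R) e : (forall j : vertices K, ~~ vinn j -> e * veta j <= al * (e * vx j) + be) ->
  forall z, bd K z -> e * eta z <= al * (e * z.1) + be.
Proof.
move=> H z /(bd_face KC KD)[s [a [b [k [[sK sa sb k01 ->] sub]]]]].
have [aV bV] := (mem_vertices sK sa, mem_vertices sK sb).
have ba : bd K a by rewrite -(mid0 a b); apply: sub; rewrite lexx ler01.
have bb : bd K b by rewrite -(mid1 a b); apply: sub; rewrite lexx ler01.
have ha := H _ (bd_outer aV ba); have hb := H _ (bd_outer bV bb).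
rewrite (v_mid sK sa sb sub k01) !planeE; move: ha hb; rewrite /veta /vx /= => ha hb.
case/andP: k01 => k0 k1.
have : (1 - k) * (e * (sg * (v a).2)) <= (1 - k) * (al * (e * a.1) + be).
  by rewrite ler_wpM2l // subr_ge0.
have : k * (e * (sg * (v b).2)) <= k * (al * (e * b.1) + be) by rewrite ler_wpM2l.
lra.
Qed.

(** On a wall [sg] times the height of [v] is strictly increasing; elsewhere a boundary point other
    than the end in the direction [e] is the opposite end. *)
Lemma lower_lt e p : sgn e -> bd K p -> p.2 != th e p.1 ->
  e * eta p < e * eta (p.1, th e p.1).
Proof.
move=> se bp pn; have rp := bd_real bp; have pr := sl_range SL rp.
have bq := sl_ext SL se pr; have rq := bd_real bq; have m := sl_max SL se rp.
have lt : e * p.2 < e * th e p.1.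
  by rewrite lt_neqAle m andbT; apply: contra pn => /eqP/(mulfI (sgn_neq0 se)) ->.
have [w|nw] := pselect (p.1 = xl \/ p.1 = xr).
  case: (se) => se1; subst e.
    by rewrite !mul1r in lt *; apply: (sl_wall_lt SL rp rq).
  by rewrite !mulN1r !ltrN2 in lt *; apply: (sl_wall_lt SL rq rp).
have pi : xl < p.1 < xr.
  case/andP: pr => h1 h2; rewrite !lt_neqAle h1 h2 !andbT eq_sym.
  by apply/andP; split; apply/eqP => h; apply: nw; [left|right].
have o := sl_order SL pi; have pe : p = (p.1, p.2) by case: (p).
have := sl_bd SL bp pi; case: se pn lt => -> pn lt [h|h].
- by rewrite h eqxx in pn.
- by rewrite {1}pe h !mul1r.
- by rewrite {1}pe h !mulN1r ltrN2.
- by rewrite h eqxx in pn.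
Qed.

Lemma chord e p q x : sgn e -> bd K p -> bd K q -> p.1 < x < q.1 ->
  e * ((q.1 - x) * eta p + (x - p.1) * eta q) <=
  (q.1 - p.1) * (e * eta (x, th e x)).
Proof.
move=> se bp bq /andP[px xq]; have pq : p.1 < q.1 by apply: lt_trans xq.
have w0 : 0 < q.1 - p.1 by rewrite subr_gt0.
pose k := (x - p.1) / (q.1 - p.1).
have k01 : 0 < k < 1 by rewrite divr_gt0 ?subr_gt0 //= ltr_pdivrMr // mul1r; lra.
have := sl_chord SL se bp bq k01 pq.
have -> : (1 - k) * p.1 + k * q.1 = x by rewrite /k; field; rewrite gt_eqF.
rewrite -(ler_pM2l w0); congr (_ <= _).
by rewrite /k; field; rewrite gt_eqF.
Qed.

(** For [e = 1] the triangle is counterclockwise with [b] in the middle, so the edge [a c] passes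
    below [b]; [e = -1] is the half-turn of this. *)
Lemma triangle_below e b a c : sgn e -> triangle K b a c ->
  e * a.1 <= e * b.1 <= e * c.1 -> exists2 y, real (b.1, y) & e * y < e * b.2.
Proof.
move=> se T /andP[ab bc]; have D := tri_area T.
have ac : a.1 != c.1.
  apply/eqP => h; move: D; have h1 : a.1 = b.1.
    by apply: (mulfI (sgn_neq0 se)); rewrite -h in bc; apply/le_anti; rewrite ab bc.
  by rewrite /area -h h1 subrr mul0r mulr0 subrr ltxx.
have w : 0 < e * (c.1 - a.1).
  rewrite mulrBr subr_gt0 lt_neqAle (le_trans ab bc) andbT.
  by apply: contra ac => /eqP/(mulfI (sgn_neq0 se)) ->.
pose k := (b.1 - a.1) / (c.1 - a.1).
have ke : k = (e * (b.1 - a.1)) / (e * (c.1 - a.1)).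
  by rewrite /k -mulf_div divff ?mul1r // sgn_neq0.
have k0 : 0 <= k by rewrite ke divr_ge0 ?(ltW w) // mulrBr subr_ge0.
have k1 : k <= 1 by rewrite ke ler_pdivrMr // mul1r !mulrBr lerD2r.
have k01 : 0 <= k <= 1 by rewrite k0 k1.
have ca : c.1 - a.1 != 0 by rewrite subr_eq0 eq_sym.
exists ((1 - k) * a.2 + k * c.2).
  apply: (tri_real T); have -> : (b.1, (1 - k) * a.2 + k * c.2) = (1 - k) *: a + k *: c.
    by apply: plane_eq; rewrite !planeE //= /k; field.
  by apply: hull_convex => //; apply: mem_hull; rewrite !inE eqxx ?orbT.
rewrite -subr_gt0 -(pmulr_rgt0 _ w).
suff -> : e * (c.1 - a.1) * (e * b.2 - e * ((1 - k) * a.2 + k * c.2)) = (e * e) * area b a c.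
  by rewrite (sgn_sqr se) mul1r.
by rewrite /k /area; field.
Qed.

Lemma edge_above e p r t : sgn e -> triangle K p r t -> e * p.1 < e * r.1 ->
  exists2 y, real ((mid p r 2%:R^-1).1, y) & e * (mid p r 2%:R^-1).2 < e * y.
Proof.
move=> se T pr; set m := mid p r _.
have D := tri_area T.
have n1 : \forall z \near m, 0 < area z r t.
  by apply: near_area; rewrite area_mid mulr_gt0 //; lra.
have n2 : \forall z \near m, 0 < area p z t.
  by apply: near_area2; rewrite area_mid2 mulr_gt0 //; lra.
have [k k0 H] := near_dir ((0, e) : plane R) (filterI n1 n2).
have [|h1 h2] := H k; first by rewrite lexx ltW.
have e1 : m + k *: ((0, e) : plane R) = (m.1, m.2 + k * e).
  by apply: plane_eq; rewrite !planeE /= ?mulr0 ?addr0.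
exists (m.2 + k * e).
  rewrite -e1; apply: (tri_real T); apply/(tri_hull _ T); split; [exact: ltW|exact: ltW|].
  have -> : area p r (m + k *: ((0, e) : plane R)) = k * (e * r.1 - e * p.1).
    by rewrite /area /m /mid !planeE /=; ring.
  by rewrite mulr_ge0 ?subr_ge0 // ltW.
rewrite -subr_gt0; have -> : e * (m.2 + k * e) - e * m.2 = k * (e * e) by ring.
by rewrite (sgn_sqr se) mulr1.
Qed.

Lemma upper_extreme e b : sgn e -> bd K b -> xl < b.1 < xr ->
  (exists2 y, real (b.1, y) & e * y < e * b.2) -> b.2 = th e b.1.
Proof.
move=> se bb bi [y ry yb]; have := sl_max SL (sgnN se) ry.
rewrite /= !mulNr lerN2 => h; have := sl_bd SL bb bi.
case: se h yb => -> h yb [] // E; exfalso.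
  by move: h yb; rewrite E !mul1r; lra.
by move: h yb; rewrite E opprK !mulN1r; lra.
Qed.

Lemma lower_extreme e b : sgn e -> bd K b -> xl < b.1 < xr ->
  (exists2 y, real (b.1, y) & e * b.2 < e * y) -> b.2 != th e b.1.
Proof.
move=> se bb bi [y ry yb]; have := sl_max SL se ry => /= h.
by apply/eqP => E; move: yb; rewrite E; lra.
Qed.

Lemma inside_range b : real b -> ~ (b.1 = xl \/ b.1 = xr) -> xl < b.1 < xr.
Proof.
move=> /(sl_range SL)/andP[h1 h2] nw; rewrite !lt_neqAle h1 h2 !andbT eq_sym.
by apply/andP; split; apply/eqP => h; apply: nw; [left|right].
Qed.

(** Between two contact points the chord inequality pushes the image of the boundary up to the line
    that bounds it; hence the arc of the graph of [th e] from [p] to [r] has a flat image. *)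
Lemma obstructed (al be : R) e p r : sgn e ->
  (forall z, bd K z -> e * eta z <= al * (e * z.1) + be) ->
  bd K p -> bd K r -> e * p.1 < e * r.1 ->
  e * eta p = al * (e * p.1) + be -> e * eta r = al * (e * r.1) + be ->
  obstructive K v [fset p; r]%fset.
Proof.
move=> se H bp br pr ep er.
have ext q : bd K q -> e * eta q = al * (e * q.1) + be -> q = (q.1, th e q.1).
  move=> bq eq; apply: plane_eq => //=; apply/eqP; apply/negPn/negP => n.
  have := lower_lt se bq n; have := H _ (sl_ext SL se (sl_range SL (bd_real bq))).
  by rewrite eq /=; lra.
have prn : p.1 != r.1 by apply/eqP => h; move: pr; rewrite h ltxx.
pose X (t : R) := (1 - t) * p.1 + t * r.1.
have Xr t : 0 <= t <= 1 -> xl <= X t <= xr.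
  have /andP[h1 h2] := sl_range SL (bd_real bp).
  have /andP[h3 h4] := sl_range SL (bd_real br).
  move=> /andP[t0 t1]; have t1' : 0 <= 1 - t by rewrite subr_ge0.
  apply/andP; split.
    have := ler_wpM2l t0 h3; have := ler_wpM2l t1' h1; rewrite /X; lra.
  have := ler_wpM2l t0 h4; have := ler_wpM2l t1' h2; rewrite /X; lra.
pose g t := (X t, th e (X t)) : plane R.
exists p, r, (g @` `[0, 1]); split=> //.
- move=> z [t /= + <-]; rewrite in_itv /= => t01.
  by apply: (sl_ext SL se); apply: Xr.
- have Xc : continuous X.
    move=> t; apply: cvgD; apply: cvgM; try exact: cvg_cst; last exact: cvg_id.
    by apply: cvgB; [exact: cvg_cst|exact: cvg_id].
  exists g; split=> //.
  + have thc : {within `[0, 1], continuous (th e \o X)}.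
      apply: (within_comp _ _ (sl_cont SL se)); last exact: continuous_subspaceT.
      by move=> t /=; rewrite !in_itv; apply: Xr.
    apply: near_within => t P t01 /near_box[eps eps0 HP].
    have n1 : \forall y \near th e (X t), `|y - th e (X t)| < eps.
      by apply/nbhs_ballP; exists eps => //= y; rewrite /ball /= distrC.
    have n2 : \forall y \near X t, `|y - X t| < eps.
      by apply/nbhs_ballP; exists eps => //= y; rewrite /ball /= distrC.
    have n3 := within_near thc t01 n1.
    have n4 : \forall y \near t, `|X y - X t| < eps := Xc t _ n2.
    by apply: filterS (filterI n4 n3) => y [h1 h2] Iy; apply: HP => //=; apply: h2.
  + move=> t t' _ _ E; have h : X t = X t' by have := congr1 fst E.
    have : (t - t') * (r.1 - p.1) = 0 by move: h; rewrite /X; lra.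
    move/eqP; rewrite mulf_eq0 !subr_eq0 (eq_sym r.1) (negbTE prn) orbF.
    by move/eqP.
  + by rewrite /g /X subr0 mul1r mul0r addr0 -(ext p).
  + by rewrite /g /X subrr mul0r mul1r add0r -(ext r).
have X0 : X 0 = p.1 by rewrite /X subr0 mul1r mul0r addr0.
have X1 : X 1 = r.1 by rewrite /X subrr mul0r mul1r add0r.
have key t : 0 <= t <= 1 -> e * eta (g t) = al * (e * X t) + be.
  move=> t01; have [->|t0] := eqVneq t 0; first by rewrite /g X0 -(ext p).
  have [->|t1] := eqVneq t 1; first by rewrite /g X1 -(ext r).
  have ti : 0 < t < 1.
    by case/andP: t01 => h1 h2; rewrite !lt_neqAle h1 h2 eq_sym t0 t1.
  apply/le_anti/andP; split; first exact: (H _ (sl_ext SL se (Xr t t01))).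
  case/andP: ti => t0' t1'; have t1'' : 0 < 1 - t by rewrite subr_gt0.
  have [lt|lt] : p.1 < r.1 \/ r.1 < p.1.
    by move: prn; rewrite neq_lt => /orP[]; [left|right].
    have w0 : 0 < r.1 - p.1 by rewrite subr_gt0.
    have Xi : p.1 < X t < r.1.
      have := mulr_gt0 t0' w0; have := mulr_gt0 t1'' w0; rewrite /X; lra.
    have := chord se bp br Xi.
    have -> : e * ((r.1 - X t) * eta p + (X t - p.1) * eta r) =
      (r.1 - X t) * (e * eta p) + (X t - p.1) * (e * eta r) by ring.
    rewrite ep er -/(g t).
    move=> C; rewrite -(ler_pM2l w0); apply: le_trans C.
    by rewrite le_eqVlt; apply/orP; left; apply/eqP; ring.
  have w0 : 0 < p.1 - r.1 by rewrite subr_gt0.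
  have Xi : r.1 < X t < p.1.
    have := mulr_gt0 t0' w0; have := mulr_gt0 t1'' w0; rewrite /X; lra.
  have := chord se br bp Xi.
  have -> : e * ((p.1 - X t) * eta r + (X t - r.1) * eta p) =
    (p.1 - X t) * (e * eta r) + (X t - r.1) * (e * eta p) by ring.
  rewrite ep er -/(g t).
  move=> C; rewrite -(ler_pM2l w0); apply: le_trans C.
  by rewrite le_eqVlt; apply/orP; left; apply/eqP; ring.
(* [e] and [sg] are their own inverses; solving [key] for the ordinate gives this line. *)
exists (0, e * sg * be), (1, e * sg * (al * e)); split.
  by apply/eqP => -[/eqP]; rewrite oner_eq0.
move=> z [z' [t /= + <-] <-]; rewrite in_itv /= => t01; exists (X t).
have bg := sl_ext SL se (Xr t t01).
apply: plane_eq; rewrite !planeE /=; first by rewrite vv // /g /= mulr1 add0r.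
have := key t t01; move: (sgn_sqr se) (sgn_sqr (sl_sgn SL)) => e2 s2 E.
have -> : (v (g t)).2 = (e * e) * (sg * sg) * (v (g t)).2 by rewrite e2 s2 !mul1r.
have -> : (e * e) * (sg * sg) * (v (g t)).2 = e * sg * (e * (sg * (v (g t)).2)) by ring.
rewrite E; ring.
Qed.

Lemma bd_above e : sgn e -> boundary_above (fun i => e * vx i) (fun i => e * vy i)
  (@vtri R K) (@vinn R K) (fun i => e * veta i).
Proof.
move=> se; have e0 := sgn_neq0 se; have e2 := sgn_sqr se; split.
- move=> b a c ob T /andP[ab bc]; have bb := outer_bd ob.
  have below := triangle_below se T (introT andP (conj ab bc)).
  have D := tri_area T.
  have lowa : vx a = vx b -> e * (val a).2 < e * (val b).2.
    move=> h; have := D; rewrite /area -/(vx a) -/(vx b) -/(vx c) h subrr mul0r sub0r => D'.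
    have : 0 < (e * e) * ((val b).2 - (val a).2) * (vx c - vx b).
      by rewrite e2 mul1r; move: D'; lra.
    have -> : (e * e) * ((val b).2 - (val a).2) * (vx c - vx b) =
      (e * (val b).2 - e * (val a).2) * (e * vx c - e * vx b) by ring.
    move=> h'; rewrite -subr_gt0; rewrite ltNge; apply/negP => n.
    by move: h'; rewrite ltNge mulr_le0_ge0 // subr_ge0.
  have lowc : vx c = vx b -> e * (val c).2 < e * (val b).2.
    move=> h; have := D; rewrite /area -/(vx a) -/(vx b) -/(vx c) h subrr mulr0 subr0 => D'.
    have : 0 < (e * e) * ((val b).2 - (val c).2) * (vx b - vx a).
      by rewrite e2 mul1r; move: D'; lra.
    have -> : (e * e) * ((val b).2 - (val c).2) * (vx b - vx a) =
      (e * (val b).2 - e * (val c).2) * (e * vx b - e * vx a) by ring.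
    move=> h'; rewrite -subr_gt0; rewrite ltNge; apply/negP => n.
    by move: h'; rewrite ltNge mulr_le0_ge0 // subr_ge0.
  have strict (i : vertices K) : ~~ vinn i -> vx i = vx b -> e * (val i).2 < e * (val b).2 ->
      (val b).2 = th e (vx b) \/ (vx b = xl \/ vx b = xr) -> e * veta i < e * veta b.
    move=> oi ib lt hb; have bi := outer_bd oi; have [hb'|w] := hb.
      have := lower_lt se bi; rewrite -/(vx i) ib => /(_ _).
      rewrite -hb' /veta; have -> : (vx b, (val b).2) = val b by apply: plane_eq.
      by apply; apply/eqP => h; move: lt; rewrite h ltxx.
    have [ri rb] := (bd_real bi, bd_real bb).
    case: (se) lt => ->; rewrite ?mul1r ?mulN1r ?ltrN2 => lt.
      by apply: (sl_wall_lt SL ri rb ib) => //; rewrite -/(vx i) ib.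
    by apply: (sl_wall_lt SL rb ri (esym ib)).
  (* On a wall [a] and [c] cannot be strictly on both sides of [b], so one of them is on the same
     wall: a boundary vertex with a smaller value. *)
  have [w|nw] := pselect (vx b = xl \/ vx b = xr).
    have wo (i : vertices K) : vx i = vx b -> ~~ vinn i.
      move=> ib; apply/asboolPn => ii; have /bdP[_] : bd K (val i).
        by apply: (sl_wall SL (vertex_real i)); rewrite -/(vx i) ib.
      by apply.
    have [xa|na] := eqVneq (vx a) (vx b).
      constructor 2; rewrite xa; split=> //; split; last exact: wo.
      exact: (strict a (wo a xa) xa (lowa xa) (or_intror w)).
    have [xc|nc] := eqVneq (vx c) (vx b).
      constructor 3; rewrite xc; split=> //; split; last exact: wo.
      exact: (strict c (wo c xc) xc (lowc xc) (or_intror w)).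
    have [ra rc] := (sl_range SL (vertex_real a), sl_range SL (vertex_real c)).
    by case: (not_strictly_between se ra rc (introT andP (conj ab bc)) na nc w).
  have bi := inside_range (vertex_real b) nw.
  (* The disk has points below [b] (in the direction opposite to [e]), so [b] is the end of its
     slice and [chord] applies there. *)
  have bth : (val b).2 = th e (vx b) by apply: upper_extreme.
  have [/andP[/eqP xa oa]|na] := boolP ((vx a == vx b) && ~~ vinn a).
    by constructor 2; rewrite xa; split=> //; split=> //; exact: (strict a oa xa (lowa xa) (or_introl bth)).
  have [/andP[/eqP xc oc]|nc] := boolP ((vx c == vx b) && ~~ vinn c).
    by constructor 3; rewrite xc; split=> //; split=> //; exact: (strict c oc xc (lowc xc) (or_introl bth)).
  have bE : val b = (vx b, th e (vx b)) by apply: plane_eq.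
  constructor 1; split.
  + move=> j k oj ok /andP[jb bk]; have [bj bk'] := (outer_bd oj, outer_bd ok).
    have C : forall p q, bd K p -> bd K q -> p.1 < vx b < q.1 ->
        e * ((q.1 - vx b) * eta p + (vx b - p.1) * eta q) <=
        (q.1 - p.1) * (e * veta b).
      by move=> p q bp bq pq; rewrite /veta bE; apply: chord.
    case: (se) jb bk C => ->; rewrite ?mul1r ?mulN1r ?ltrN2 => jb bk C.
      have := C _ _ bj bk'; rewrite -/(vx j) -/(vx k) jb bk => /(_ isT).
      by rewrite /veta !mul1r; lra.
    have := C _ _ bk' bj; rewrite -/(vx j) -/(vx k) jb bk => /(_ isT).
    by rewrite /veta !mulN1r; lra.
  + move=> j oj /(mulfI e0) jb; have bj := outer_bd oj.
    have [h|h] := eqVneq (val j).2 (th e (vx b)).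
      by rewrite /veta; have -> : val j = val b by apply: plane_eq => //; rewrite h.
    have := lower_lt se bj; rewrite -/(vx j) jb => /(_ h).
    by rewrite -bE /veta => /ltW.
  + by move=> /(mulfI e0) xa; move: na; rewrite xa eqxx negbK.
  + by move=> /(mulfI e0) xc; move: nc; rewrite xc eqxx negbK.
- move=> al be p r t H op or pr T ep er.
  have [bp br] := (outer_bd op, outer_bd or).
  have H' := bd_le H.
  have [pT rT] : val p \in [fset val p; val r; val t]%fset /\
      val r \in [fset val p; val r; val t]%fset by rewrite !inE !eqxx ?orbT.
  have prn : val p != val r by apply/eqP => h; move: pr; rewrite /vx h ltxx.
  set m := mid (val p) (val r) 2%:R^-1.
  have half : 0 < (2%:R^-1 : R) < 1 by lra.
  (* If the midpoint is on the boundary, so is the whole edge; but a triangle lies above it, so the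
     image of the midpoint is strictly below the line that contains the images of both ends. *)
  have [bm|nbm] := pselect (bd K m).
    have sub l : 0 <= l <= 1 -> bd K (mid (val p) (val r) l).
      by move=> l01; apply: (edge_bd KC KD (tri_in T) pT rT half l01 bm).
    have m1 : m.1 = 2%:R^-1 * (vx p) + 2%:R^-1 * (vx r).
      by rewrite /m /mid !planeE /vx; field.
    have mi : xl < m.1 < xr.
      rewrite m1; apply: (midpoint_between (e := e)) pr.
        exact: (sl_range SL (vertex_real p)).
      exact: (sl_range SL (vertex_real r)).
    have := lower_extreme se bm mi (edge_above se T pr).
    move=> /(lower_lt se bm); have := H' _ (sl_ext SL se (sl_range SL (bd_real bm))).
    move=> h1 h2; have : e * eta m < al * (e * m.1) + be := lt_le_trans h2 h1.
    have h01 : 0 <= (2%:R^-1 : R) <= 1 by lra.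
    have vm : (v m).2 = (1 - 2%:R^-1) * (v (val p)).2 + 2%:R^-1 * (v (val r)).2.
      by rewrite /m (v_mid (tri_in T) pT rT sub h01) !planeE.
    rewrite vm m1; move: ep er; rewrite /veta; lra.
  (* Otherwise the edge is spanning, and contact at both ends makes it obstructive. *)
  apply: (vO (s := [fset val p; val r]%fset)).
    split; first exact: (edgeK (tri_in T) pT rT).
      by rewrite cardfs2 prn.
    apply/seteqP; split=> [z /= /fset2P[] ->|z [hz bz]].
    - by split=> //; apply: mem_hull; rewrite !inE eqxx.
    - by split=> //; apply: mem_hull; rewrite !inE eqxx orbT.
    have [k k01 zk] := hull2 hz; rewrite /= !inE.
    have [k0|k0] := eqVneq k 0; first by rewrite zk k0 -/(mid _ _ _) mid0 eqxx.
    have [k1|k1] := eqVneq k 1; first by rewrite zk k1 -/(mid _ _ _) mid1 eqxx orbT.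
    case: nbm; apply: (edge_bd KC KD (tri_in T) pT rT (k := k)) => //.
    - by case/andP: k01 => h1 h2; rewrite !lt_neqAle h1 h2 eq_sym k0 k1.
    - by lra.
    by rewrite /mid -zk.
  exact: (obstructed se H' bp br pr ep er).
- move=> al be q u t H ou iq T /(mulfI e0) uq uy; have bu := outer_bd ou.
  have H' := bd_le H.
  (* The interior vertex [q] on the same vertical excludes a wall, and its position above [u] shows
     that [u] is not the upper end of its slice. *)
  have nw : ~ (vx u = xl \/ vx u = xr).
    move=> w; have /bdP[_] : bd K (val q).
      by apply: (sl_wall SL (vertex_real q)); rewrite -/(vx q) -uq.
    by apply; apply/asboolP.
  have ui := inside_range (vertex_real u) nw.
  have := lower_lt se bu; have := H' _ (sl_ext SL se (sl_range SL (bd_real bu))).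
  rewrite /= => h1 /(_ _)/lt_le_trans/(_ h1); apply.
  apply: lower_extreme => //; exists (val q).2 => //.
  have -> : ((val u).1, (val q).2) = val q by apply: plane_eq.
  exact: vertex_real.
Qed.

End Sliced.
End Boundary.

(** * The extension *)

Section Interpolation.
Variables (R : realType) (K : {fset {fset plane R}}).
Hypothesis KC : simplicial_complex K.
Hypothesis KD : topological_disk (realization K).
Notation real := (realization K).
Variable h : plane R -> R.
Implicit Types (a b c p q z : plane R) (k l x y : R) (s t : {fset plane R}).

Definition aff (m : R * R * R) p : R := m.1.1 * p.1 + m.1.2 * p.2 + m.2.

Lemma aff_sum m s (w : plane R -> R) : \sum_(q <- s) w q = 1 ->
  aff m (\sum_(q <- s) w q *: q) = \sum_(q <- s) w q * aff m q.
Proof.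
move=> w1; rewrite /aff.
have e1 : (\sum_(q <- s) w q *: q).1 = \sum_(q <- s) w q * q.1.
  by elim/big_rec2: _ => // q y1 y2 _ <-.
have e2 : (\sum_(q <- s) w q *: q).2 = \sum_(q <- s) w q * q.2.
  by elim/big_rec2: _ => // q y1 y2 _ <-.
rewrite e1 e2 !mulr_sumr -{1}[m.2]mulr1 -w1 mulr_sumr -!big_split /=.
by apply: eq_bigr => q _; ring.
Qed.

Definition interpolates (m : R * R * R) s := forall q, q \in s -> aff m q = h q.

(** Cramer's rule; the second clause identifies the coefficient of the ordinate with the vertical
    slope. *)
Lemma tri_aff a b c : triangle K a b c -> exists2 m, interpolates m [fset a; b; c]%fset &
  m.1.2 * area a b c = (b.1 - a.1) * (h c - h a) - (h b - h a) * (c.1 - a.1).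
Proof.
move=> T; have D := tri_area T.
have n0 : area a b c != 0 by rewrite gt_eqF.
pose m2 := ((b.1 - a.1) * (h c - h a) - (h b - h a) * (c.1 - a.1)) / area a b c.
pose m1 := ((h b - h a) * (c.2 - a.2) - (b.2 - a.2) * (h c - h a)) / area a b c.
exists (m1, m2, h a - m1 * a.1 - m2 * a.2); last by rewrite /= /m2 divfK.
move=> q; rewrite !inE -orbA => /or3P[]/eqP->; rewrite /aff /=; first ring.
  by move: n0; rewrite /m1 /m2 /area => n0; field.
by move: n0; rewrite /m1 /m2 /area => n0; field.
Qed.

(** The hulls meet in the hull of a common face, at whose vertices both functions take the values of
    [h]. *)
Lemma aff_agree m m' s t p : s \in K -> t \in K -> interpolates m s ->
  interpolates m' t -> hull s p -> hull t p -> aff m p = aff m' p.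
Proof.
move=> sK tK ms mt sp tp; case: KC => _ _ /(_ s t sK tK)[u [us ut stu]].
have [w [w0 w1 ->]] : hull u p by rewrite -stu.
rewrite !aff_sum // big_seq [RHS]big_seq; apply: eq_bigr => q qu.
by rewrite ms ?mt //; [exact: (fsubsetP ut)|exact: (fsubsetP us)].
Qed.

(** By [aff_agree] any simplex containing [p] gives the same value; the default 0 is taken outside
    the disk. *)
Definition interpolation p : R := xget 0 [set y | exists m s,
  [/\ s \in K, interpolates m s, hull s p & y = aff m p]].

Lemma interpolationE m s p : s \in K -> interpolates m s -> hull s p ->
  interpolation p = aff m p.
Proof.
move=> sK ms sp; rewrite /interpolation; case: xgetP => [y _ [m' [t [tK mt tp ->]]]|].
  exact: (aff_agree tK sK mt ms tp sp).
by move=> /(_ (aff m p)) []; exists m, s.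
Qed.

Lemma simplex_aff s : s \in K -> exists m, interpolates m s.
Proof.
move=> sK; have [a [b [c [T sub]]]] := tri_cover KC KD sK.
have [m mT _] := tri_aff T; exists m => q qs.
by apply: mT; apply: (fsubsetP sub).
Qed.

Lemma interpolation_mid s p q k : s \in K -> hull s p -> hull s q -> 0 <= k <= 1 ->
  interpolation ((1 - k) *: p + k *: q) =
  (1 - k) * interpolation p + k * interpolation q.
Proof.
move=> sK sp sq k01; have [m ms] := simplex_aff sK.
rewrite (interpolationE sK ms sp) (interpolationE sK ms sq).
rewrite (interpolationE sK ms (hull_convex sp sq k01)) /aff !planeE; ring.
Qed.

Lemma interpolation_vertex s q : s \in K -> q \in s -> interpolation q = h q.
Proof.
move=> sK qs; have [m ms] := simplex_aff sK.
by rewrite (interpolationE sK ms (mem_hull qs)) ms.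
Qed.

(** Close to [z] only the simplices that contain [z] matter; they are finitely many, and the
    function is affine on each. *)
Lemma interpolation_continuous : {within real, continuous interpolation}.
Proof.
apply: near_within => z P rz HP.
have H : \forall p \near z, forall s, s \in enum_fset K -> hull s p -> P (interpolation p).
  apply: near_all_seq => s sK.
  have [sz|nsz] := pselect (hull s z); last first.
    have : nbhs z (~` hull s).
      by apply: open_nbhs_nbhs; split=> //; rewrite openC; apply: hull_closed.
    by apply: filterS => p /[apply].
  have [m ms] := simplex_aff sK.
  have C : (aff m : plane R -> R) @ z --> aff m z.
    rewrite /aff; apply: cvgD; last exact: cvg_cst.
    apply: cvgD; apply: cvgM; try exact: cvg_cst.
      exact: cvg_fst.
    exact: cvg_snd.
  have n1 : \forall p \near z, P (aff m p).
    by apply: C; rewrite -(interpolationE sK ms sz).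
  by apply: filterS n1 => p Pp sp; rewrite (interpolationE sK ms sp).
by apply: filterS H => p Hp [s sK sp]; apply: (Hp s).
Qed.

Variable sg : R.
(** The values [h] are to be heights multiplied by [sg]; a second factor [sg] restores the
    orientation of [v]. *)
Definition vertical_map p : plane R := (p.1, sg * interpolation p).

Lemma vertical_map_SL : SL_map K real vertical_map.
Proof.
split; last first.
  move=> s sK _ p q k sp sq k01; rewrite /vertical_map (interpolation_mid sK sp sq k01).
  by apply: plane_eq; rewrite !planeE //=; ring.
apply: near_within => z P rz /near_box[eps eps0 HP].
have C : (fun y : R => sg * y) @ interpolation z --> sg * interpolation z.
  by apply: cvgM; [exact: cvg_cst|exact: cvg_id].
have n1 : \forall y \near sg * interpolation z, `|y - sg * interpolation z| < eps.
  by apply/nbhs_ballP; exists eps => //= y; rewrite /ball /= distrC.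
have n2 := within_near interpolation_continuous rz (C _ n1).
apply: filterS (filterI n2 (near_in_box z eps0)) => p [h1 [h2 _]] rp.
by apply: HP => //=; apply: h1.
Qed.

Hypothesis h_gt0 : forall a b c, triangle K a b c ->
  0 < (b.1 - a.1) * (h c - h a) - (h b - h a) * (c.1 - a.1).

Lemma interpolation_lt s p q : s \in K -> hull s p -> hull s q -> p.1 = q.1 ->
  p.2 < q.2 -> interpolation p < interpolation q.
Proof.
move=> sK sp sq pq lt; have [a [b [c [T sub]]]] := tri_cover KC KD sK.
have [m mT mE] := tri_aff T; have m0 : 0 < m.1.2.
  by rewrite -(pmulr_lgt0 _ (tri_area T)) mE h_gt0.
rewrite (interpolationE (tri_in T) mT (hull_sub sub sp)).
rewrite (interpolationE (tri_in T) mT (hull_sub sub sq)).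
by rewrite /aff pq ltrD2r ltrD2l ltr_pM2l.
Qed.

(* The interpolation increases near each point of the segment, in the upward
   direction; so its maximum can only be attained at the upper end. *)
Lemma interpolation_increasing x y1 y2 :
  (forall y, y1 <= y <= y2 -> real (x, y)) -> y1 < y2 ->
  interpolation (x, y1) < interpolation (x, y2).
Proof.
move=> seg lt; pose phi y := interpolation (x, y).
have up y : y1 <= y < y2 -> exists2 y', y < y' <= y2 & phi y < phi y'.
  move=> /andP[h1 h2]; have [t0 t00 H] := near_dir ((0, 1) : plane R) (near_simplices K (x, y)).
  pose t := Num.min t0 (y2 - y).
  have t_gt0 : 0 < t by rewrite lt_min t00 subr_gt0.
  have tle : 0 <= t <= t0 by rewrite ltW //= ge_min lexx.
  have ty : t <= y2 - y by rewrite ge_min lexx orbT.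
  have {}H := H t tle.
  have e : (x, y) + t *: ((0, 1) : plane R) = (x, y + t).
    by apply: plane_eq; rewrite !planeE /= ?mulr0 ?addr0 ?mulr1.
  have [|s sK sp] := seg (y + t); first lra.
  exists (y + t); first lra.
  apply: (@interpolation_lt s) => //=; last lra.
  by apply: H => //; rewrite e.
have phic : {within `[y1, y2], continuous phi}.
  have C1 : {within `[y1, y2], continuous (fun y => (x, y) : plane R)}.
    apply: near_within => y P _ /near_box[eps eps0 HP].
    apply/nbhs_ballP; exists eps => //= y'; rewrite /ball /= distrC => d _.
    by apply: HP => //=; rewrite subrr normr0.
  apply: (within_comp _ C1 interpolation_continuous) => y /=; rewrite in_itv /=; exact: seg.
have [y ym ymax] := EVT_max (ltW lt) phic; rewrite in_itv /= in ym.
have yE : y = y2.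
  case/andP: ym => h1 h2; apply/eqP; rewrite eq_le h2 leNgt; apply/negP => h3.
  have [|y' /andP[h4 h5] h6] := up y; first by rewrite h1.
  have : phi y' <= phi y by apply: ymax; rewrite in_itv /= (le_trans h1 (ltW h4)).
  by rewrite leNgt h6.
have [|y' /andP[h4 h5] h6] := up y1; first by rewrite lexx.
apply: lt_le_trans h6 _; rewrite -yE; apply: ymax.
by rewrite in_itv /= (ltW h4).
Qed.

Hypothesis KT : TrV real.
Hypothesis sg0 : sg != 0.

(** Points with the same image share a vertical; by [TrV] the segment between them is in the disk,
    and the interpolation increases strictly along it. *)
Lemma vertical_map_inj : set_inj real vertical_map.
Proof.
have main p q : real p -> real q -> p.1 = q.1 -> p.2 < q.2 -> interpolation p < interpolation q.
  move=> rp rq pq lt; have pE : p = (p.1, p.2) by apply: plane_eq.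
  have qE : q = (p.1, q.2) by apply: plane_eq.
  rewrite pE qE; apply: interpolation_increasing => // y yr.
  exact: (slice_convex KT rp rq pq yr).
move=> p q; rewrite !inE => rp rq E.
have e1 : p.1 = q.1 by have := congr1 fst E.
have e2 : interpolation p = interpolation q.
  by apply: (mulfI sg0); have := congr1 snd E.
apply: plane_eq => //; have [lt|lt|//] := ltgtP p.2 q.2.
  by have := main p q rp rq e1 lt; rewrite e2 ltxx.
by have := main q p rq rp (esym e1) lt; rewrite e2 ltxx.
Qed.

End Interpolation.

Theorem lemma4 (R : realType) (K : {fset {fset plane R}})
    (v : plane R -> plane R) :
  SL_disk K -> TrV (realization K) ->
  SL_embedding K (bd K) v -> vertical (bd K) v ->
  convex_circle (v @` bd K) ->
  (forall s : {fset plane R}, spanning K s -> ~ obstructive K v s) ->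
  exists w : plane R -> plane R,
    [/\ SL_embedding K (realization K) w, vertical (realization K) w
      & forall p, bd K p -> w p = v p].
Proof.
move=> [KC KD] KT [vSL vinj] vv vC vO.
have [xl [xr [th [sg SL]]]] := real_slices KC KD KT vSL vinj vv vC.
have A (e : R) (se : sgn e) := bd_above KC KD vSL vv vO SL se.
have A1 := A 1 (or_introl erefl); have A2 := A (-1) (or_intror erefl).
have mulN (f : vertices K -> R) : (fun i => -1 * f i) = (fun i => - f i).
  by apply/funext => i; rewrite mulN1r.
have mul1 (f : vertices K -> R) : (fun i => 1 * f i) = f.
  by apply/funext => i; rewrite mul1r.
rewrite !mul1 in A1; rewrite !mulN in A2.
have [h0 hb hpos] := monotone_extension (vertices_triangulated KC KD) A1 A2.
pose h p := if insub p is Some i then h0 i else 0.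
have hE (i : vertices K) : h (val i) = h0 i by rewrite /h valK.
have h_gt0 a b c : triangle K a b c ->
    0 < (b.1 - a.1) * (h c - h a) - (h b - h a) * (c.1 - a.1).
  move=> T; have [aV bV cV] := tri_vertices T.
  have := hpos [` aV]%fset [` bV]%fset [` cV]%fset T.
  by rewrite /det3 -!hE.
have sgs := sl_sgn SL; have sg0 := sgn_neq0 sgs.
exists (vertical_map K h sg); split=> //.
  split; first exact: vertical_map_SL.
  exact: (vertical_map_inj KC KD h_gt0 KT sg0).
(* On a boundary edge both maps are affine, so it is enough to compare them at its ends. *)
move=> p bp; have [s [a [b [k [[sK sa sb k01 ->] sub]]]]] := bd_face KC KD bp.
have [aV bV] := (mem_vertices sK sa, mem_vertices sK sb).
have ba : bd K a by rewrite -(mid0 a b); apply: sub; rewrite lexx ler01.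
have bb : bd K b by rewrite -(mid1 a b); apply: sub; rewrite lexx ler01.
have hv q (qV : q \in vertices K) : bd K q -> sg * h q = (v q).2.
  move=> bq; have -> : h q = h0 [` qV]%fset by rewrite -hE.
  rewrite hb; last by apply: bd_outer.
  by rewrite /veta mulrA (sgn_sqr sgs) mul1r.
rewrite (v_mid KC vSL sK sa sb sub k01).
apply: plane_eq; rewrite !planeE /vertical_map /=.
  by rewrite !vv.
rewrite /mid (interpolation_mid KC KD h sK (mem_hull sa) (mem_hull sb) k01).
rewrite (interpolation_vertex KC KD h sK sa) (interpolation_vertex KC KD h sK sb).
by rewrite -(hv a aV ba) -(hv b bV bb); ring.
Qed.
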